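(* Let $(F_j)_{j=0}^\infty$ be a JTG family with associated space $JT_{\mathcal F_2}$. For every (infinite dimensional closed) subspace $Y$ of $JT_{\mathcal F_2}$ and every $\varepsilon>0$ there exists a subspace of $Y$ which is $1+\varepsilon$ isomorphic to $\ell_2$.
   Context: $c_{00}(\mathbb N)$ is the space of finitely supported real sequences with unit vectors $(e_n)$; $e_n^*$ is the same unit vector regarded as a functional; $f\in c_{00}(\mathbb N)$ acts by $f(x)=\sum_nf(n)x(n)$; $Ef$ is the restriction of $f$ to an interval $E$; $f<g$ means $\max\operatorname{supp}f<\min\operatorname{supp}g$, and a block sequence is one with successive supports. A James Tree Generating (JTG) family is a sequence $(F_j)_{j=0}^\infty$ of subsets of $c_{00}(\mathbb N)$ such that: (A) $F_0=\{\pm e_n^*:n\in\mathbb N\}$ and each $F_j$ is nonempty, countable, symmetric, compact in the topology of pointwise convergence and closed under restrictions to intervals of $\mathbb N$; (B) setting $\tau_j=\sup\{\|f\|_\infty:f\in F_j\}$, the sequence $(\tau_j)_{j\in\mathbb N}$ is strictly decreasing and $\sum_{j=1}^\infty\tau_j\le1$; (C) for every block sequence $(x_k)$ of $c_{00}(\mathbb N)$, every $j\ge0$ and every $\delta>0$ there is $x\in\mathrm{span}\{x_k:k\in\mathbb N\}$ with $\delta\cdot\sup\{f(x):f\in\bigcup_{i\ge0}F_i\}>\sup\{f(x):f\in F_j\}$. Fix disjoint infinite $\Xi_1,\Xi_2\subset\mathbb N$ and an injective $\sigma_{\mathcal F}$ from the set of finite sequences $(f_1<\dots<f_d)$ in $\bigcup_{j\ge1}F_j\setminus\{0\}$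 into $\Xi_2$ with $\sigma_{\mathcal F}(f_1,\dots,f_d)>\max\{k:\exists i,\ f_i\in F_k\}$. A finite or infinite block sequence $s=(f_i)_i$ in $\bigcup_{j\ge1}F_j\setminus\{0\}$ is $\sigma_{\mathcal F}$ special if $f_1\in\bigcup_{l\in\Xi_1}F_l$ and $f_{i+1}\in F_{\sigma_{\mathcal F}(f_1,\dots,f_i)}$ for all $i$; $\operatorname{ind}_s(f_1)=\min\{j:f_1\in F_j\}$, $\operatorname{ind}_s(f_i)=\sigma_{\mathcal F}(f_1,\dots,f_{i-1})$ for $i\ge2$. A finitely supported $\sigma_{\mathcal F}$ special functional is $x^*=E\sum_if_i$ with $s=(f_i)_i$ special and $E$ a finite interval; its index set is $\operatorname{ind}(x^* )=\{\operatorname{ind}_s(f_i):Ef_i\ne0\}$ (pairwise disjointness of indices of several functionals is meant for some choice of representing sequences and intervals). For $f\in\bigcup_{i\ge1}F_i\setminus\{0\}$ used as a single functional, $\operatorname{ind}(f)=\{\min\{j\ge1:f\in F_j\}\}$. Let $\mathscr S$ be the set of finitely supported $\sigma_{\mathcal F}$ special functionals. $\mathcal F_2=F_0\cup\{\sum_{k=1}^da_kx_k^*:a_k\in\mathbb Q,\ \sum a_k^2\le1,\ x_k^*\in\mathscr S\cup\bigcup_{i\ge1}F_i,\ (\operatorname{ind}(x_k^* ))_{k=1}^d$ pairwise disjoint$\}$, and $JT_{\mathcal F_2}$ is the completion of $c_{00}(\mathbb N)$ under $\|x\|_{\mathcal F_2}=\sup\{f(x):f\in\mathcal F_2\}$.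 Two spaces are $1+\varepsilon$ isomorphic if there is an isomorphism $T$ between them with $\|T\|\,\|T^{-1}\|\le1+\varepsilon$. *)

(* Defs.v *)
From HB Require Import structures.
From mathcomp Require Import all_boot all_order all_algebra.
From mathcomp Require Import all_classical all_reals all_analysis.

Set Implicit Arguments.
Unset Strict Implicit.
Unset Printing Implicit Defensive.

Import Order.TTheory GRing.Theory Num.Theory.
Import numFieldNormedType.Exports.

Local Open Scope classical_set_scope.
Local Open Scope ring_scope.

Section FinitelySupported.
Variable R : realType.

Definition supp (f : nat -> R) : set nat := [set n | f n != 0].

Definition finsupp : {pred nat -> R} := mem [set f | finite_set (supp f)].

Lemma finsupp_submod_closed : submod_closed finsupp.
Proof.
split.
  rewrite inE/=; apply: sub_finite_set (finite_set0 nat) => n.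
  by rewrite /supp/= eqxx.
move=> a f g; rewrite !inE => ff fg.
apply: (@sub_finite_set _ _ (supp f `|` supp g)); last by rewrite finite_setU.
move=> n; rewrite /supp/= => ne0.
have [f0|] := eqVneq (f n) 0; last by left.
by right; apply: contra_neq ne0 => g0; rewrite !fctE f0 g0 scaler0 addr0.
Qed.

HB.instance Definition _ :=
  GRing.isSubmodClosed.Build R (nat -> R) finsupp finsupp_submod_closed.

(* Coordinates are indexed from 0. *)
Record c00 := C00 { c00_fun :> nat -> R; c00P : c00_fun \in finsupp }.

HB.instance Definition _ := [isSub for c00_fun].
HB.instance Definition _ := [Choice of c00 by <:].
HB.instance Definition _ := [SubChoice_isSubLmodule of c00 by <:].

Lemma unit_finsupp n : (fun m : nat => (m == n)%:R : R) \in finsupp.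
Proof.
rewrite inE/=; apply: sub_finite_set (finite_set1 n) => m; rewrite /supp/=.
by have [//|_] := eqVneq m n; rewrite eqxx.
Qed.

Definition unit_vec n : c00 := C00 (unit_finsupp n).

Definition cut_fun (E : set nat) (f : nat -> R) : nat -> R :=
  fun n => if n \in E then f n else 0.

Lemma cut_fun_finsupp (E : set nat) (f : c00) : cut_fun E f \in finsupp.
Proof.
have := c00P f; rewrite !inE/=; apply: sub_finite_set => n; rewrite /supp/cut_fun/=.
by case: ifP => // _ /=; rewrite eqxx.
Qed.

Definition restr (E : set nat) (f : c00) : c00 := C00 (cut_fun_finsupp E f).

Definition act (f x : c00) : R := \sum_(n \in [set: nat]) f n * x n.

Definition sup_act (A : set c00) (x : c00) : \bar R :=
  ereal_sup [set (act f x)%:E | f in A].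

Definition supnorm (f : c00) : R := sup (range (fun n => `|f n|)).

Definition lt_supp (f g : c00) := forall m n, supp f m -> supp g n -> (m < n)%N.

(* The index set I is meant to be an initial segment of nat. *)
Definition block_seq (I : set nat) (s : nat -> c00) :=
  (forall i, I i -> s i != 0) /\
  (forall i, I i.+1 -> lt_supp (s i) (s i.+1)).

End FinitelySupported.
Arguments finsupp {R}.

Definition nat_interval (E : set nat) :=
  forall a b, E a -> E b -> forall c, (a <= c <= b)%N -> E c.

Definition least (A : set nat) : set nat :=
  [set k | A k /\ forall j, A j -> (k <= j)%N].

Definition lspan (R : realType) (V : lmodType R) (A : set V) : set V :=
  [set x | exists d (a : 'I_d -> R) (v : 'I_d -> V),
     (forall i, A (v i)) /\ x = \sum_i a i *: v i].

Section JTG.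
Variable R : realType.
Variable F : nat -> set (c00 R).

Definition tau j : \bar R := ereal_sup [set (supnorm f)%:E | f in F j].

(* F 0 does not contain 0 and is not pointwise closed, so compactness and
   closure under restrictions can only be required for j >= 1. *)
Record JTG : Prop := {
  JTG_F0 : F 0%N = [set f | exists n, f = unit_vec R n \/ f = - unit_vec R n] ;
  JTG_neq0 : forall j, (1 <= j)%N -> F j !=set0 ;
  JTG_countable : forall j, (1 <= j)%N -> countable (F j) ;
  JTG_symmetric : forall j, (1 <= j)%N -> forall f, F j f -> F j (- f) ;
  JTG_compact : forall j, (1 <= j)%N ->
    compact ((@c00_fun R) @` F j : set {ptws nat -> R}) ;
  JTG_restr : forall j, (1 <= j)%N -> forall f E,
    F j f -> nat_interval E -> F j (restr E f) ;
  JTG_tau_decr : forall i j, (1 <= i)%N -> (i < j)%N -> (tau j < tau i)%E ;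
  JTG_tau_sum : (\sum_(1 <= j <oo) tau j <= 1)%E ;
  JTG_span : forall x : nat -> c00 R, block_seq setT x ->
    forall j (delta : R), 0 < delta -> exists2 v, lspan (range x) v &
      (sup_act (F j) v < delta%:E * sup_act (\bigcup_i F i) v)%E }.

Definition F_pos : set (c00 R) := \bigcup_(j in [set j | (1 <= j)%N]) F j.

Definition coding_dom : set (seq (c00 R)) :=
  [set s | [/\ s != [::], (forall f, f \in s -> F_pos f) &
               block_seq `I_(size s) (nth 0 s)]].

(* By tau_k -> 0, a nonzero f lies in finitely many F k; the last clause says
   that sigma s exceeds the maximum of these k for f in s. *)
Definition is_coding (Xi2 : set nat) (sigma : seq (c00 R) -> nat) :=
  [/\ set_inj coding_dom sigma,
      (forall s, coding_dom s -> Xi2 (sigma s)) &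
      (forall s, coding_dom s ->
         forall f k, f \in s -> F k f -> (k < sigma s)%N)].

Variable Xi1 : set nat.
Variable sigma : seq (c00 R) -> nat.

(* A sequence of length d (resp. an infinite sequence) is a function on nat
   read on I = `I_d (resp. I = setT). *)
Record special (I : set nat) (s : nat -> c00 R) : Prop := {
  special_dom : I = setT \/ exists d, I = `I_d.+1 ;
  special_block : block_seq I s ;
  special_F_pos : forall i, I i -> F_pos (s i) ;
  special_head : exists2 l, Xi1 l & F l (s 0%N) ;
  special_next : forall i, I i.+1 -> F (sigma (mkseq s i.+1)) (s i.+1) }.

Definition seq_ind (s : nat -> c00 R) (i : nat) : set nat :=
  if i is 0%N then least [set j | F j (s 0%N)] else [set sigma (mkseq s i)].

Definition special_with (x : c00 R) (J : set nat) :=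
  exists I s E, [/\ special I s, nat_interval E, finite_set E,
    (x : nat -> R) = cut_fun E (fun n => \sum_(i \in I) s i n) &
    J = \bigcup_(i in [set i | I i /\ restr E (s i) != 0]) seq_ind s i].

(* ind is defined for nonzero functionals only; 0 gets the empty index set. *)
Definition single_with (x : c00 R) (J : set nat) :=
  F_pos x /\ J = [set k | x != 0 /\ least [set j | (1 <= j)%N /\ F j x] k].

Definition F2 : set (c00 R) := F 0%N `|`
  [set f | exists d (a : 'I_d -> rat) (x : 'I_d -> c00 R) (J : 'I_d -> set nat),
     [/\ \sum_k a k ^+ 2 <= 1,
         (forall k, special_with (x k) (J k) \/ single_with (x k) (J k)),
         trivIset setT J &
         f = \sum_k ratr (a k) *: x k]].

(* These conditions characterise the completion X of (c00, sup_act F2), with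
   its canonical embedding iota, up to isometric isomorphism. *)
Definition is_JT (X : completeNormedModType R) (iota : {linear c00 R -> X}) :=
  (forall x, `|iota x|%:E = sup_act F2 x) /\ dense (range iota).

End JTG.

Section Ell2.
Variable R : realType.

(* Only the empty set is null for the counting measure, so no quotient of the
   functions of finite L2 norm is needed. *)
Definition ell2 := LfunType (@counting nat R) (lee1n 2).

HB.instance Definition _ := GRing.Lmodule.on ell2.

Definition ell2_norm (x : ell2) : R := fine 'N[@counting nat R]_2%:E[EFin \o x].

Let ell2_normE (x : ell2) :
  (ell2_norm x)%:E = 'N[@counting nat R]_2%:E[EFin \o x]%E.
Proof. exact: finite_norm_fine. Qed.

Lemma ell2_normD (x y : ell2) : ell2_norm (x + y) <= ell2_norm x + ell2_norm y.
Proof. exact: ler_LnormD. Qed.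

Lemma ell2_normZ (a : R) (x : ell2) : ell2_norm (a *: x) = `|a| * ell2_norm x.
Proof.
apply: EFin_inj; rewrite EFinM !ell2_normE.
exact: (LnormZ x a).
Qed.

Lemma ell2_norm0_eq0 (x : ell2) : ell2_norm x = 0 -> x = 0.
Proof.
move=> x0; apply/LfuneqP => n.
have [A [_ + sub]] := @fine_Lnormr_eq0 _ _ _ _ _ (lee1n 2) x x0.
rewrite /= /counting; case: ifPn => [/asboolP finA|//] /eqP.
rewrite eqe pnatr_eq0 finmap.cardfs_eq0 => /eqP A0.
apply: contrapT => xn0; have : A n by apply: sub => /= /(_ I).
by rewrite -(fset_setK finA) A0 set_fset0.
Qed.

HB.instance Definition _ :=
  Lmodule_isNormed.Build R ell2 ell2_normD ell2_normZ ell2_norm0_eq0.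

End Ell2.

Section Isomorphisms.
Variable R : realType.

Definition inf_dim_closed_subspace (V : normedModType R) (Y : set V) :=
  [/\ closed Y, submod_closed [in Y] &
      ~ exists2 B : set V, finite_set B & Y `<=` lspan B].

Definition opnorm (V W : normedModType R) (A : set V) (T : V -> W) : \bar R :=
  ereal_sup [set `|T x|%:E | x in [set x | A x /\ `|x| <= 1]].

Definition isomorphic_onto (V W : normedModType R) (c : R) (Z : set W) :=
  exists (T : {linear V -> W}) (S : W -> V),
    [/\ range T = Z, cancel T S, continuous T, {within Z, continuous S} &
        (opnorm setT T * opnorm Z S <= c%:E)%E].

End Isomorphisms.

(* Main.v *)
Require Import Defs.
From HB Require Import structures.
From mathcomp Require Import all_boot all_order all_algebra.
From mathcomp Require Import all_classical all_reals all_analysis.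
From mathcomp Require Import ring lra zify.

Set Implicit Arguments.
Unset Strict Implicit.
Unset Printing Implicit Defensive.

Import Order.TTheory GRing.Theory Num.Theory.
Import numFieldNormedType.Exports.

Local Open Scope classical_set_scope.
Local Open Scope ring_scope.

(**
Call a functional basic if it is special, single or in [F 0].  Norm one vectors [x n] on which
all basic functionals are tiny, at a rate depending on [x 0, ..., x (n - 1)], span an almost
isometric copy of l2.  Indeed, choose [b 0 <= b 1 <= ...] fast growing; in a combination of
functionals with pairwise disjoint index sets, only those whose least index lies in
[[b n, b (n + 1))] matter on [x n]: those with an index below [b n] are few, as the index sets are
disjoint, and each is tiny on [x n], while the others are negligible since the sup norms [tau j]
are summable.

Such vectors exist in every block subspace.  Otherwise every vector of the subspace is normed up
to a factor [eps] by a basic functional.  By condition (C) there are blocks that only see the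
indices in consecutive windows.  Split them into [q] large groups and pick, from the last group to
the first, a norm one combination [z i] of the [i]-th group that is annihilated by the pasts of all
special functionals acting on some [z j] with [j > i].  Since [sigma] is injective, two special
functionals sharing an index have a common past, and Bessel's inequality bounds the number of those
acting on [z j] with disjoint index sets; so finitely many pasts have to be killed, which is a
dimension count.  A special functional then acts on at most two of the [z i], hence every basic
functional is at most 3 on [Z = sum z i], whereas the functionals acting on the [z i] show that the
norm of [Z] is at least [eps * sqrt q / 2]: a contradiction for large [q].
*)

(** * Finitely supported sequences *)

(** The obstacle is that one special functional may pass through the windows of many vectors, so
    disjoint windows alone do not bound it on a sum. The groups are treated backwards because the
    pasts to be killed on [z i] depend on the later vectors [z j]. Pasts are taken before cutting by
    intervals, so that intervals add no conditions; this is enough because a functional acting on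
    both sides of a vector is not cut on it. Condition (C) compares a single family with the union
    of all, so smallness on all families below a given index needs an iteration. Elements of [Y] lie
    in the completion: coordinate functionals extend to it and separate its points, so [Y] contains
    nonzero vectors whose first K coordinates vanish, and these are close to blocks. The norm is a
    supremum over rational combinations, hence Bessel's inequality involves rounding. *)

Lemma fsum_nat (V : zmodType) (I : set nat) (G : nat -> V) B :
  (forall n, I n -> (B <= n)%N -> G n = 0) ->
  \sum_(i \in I) G i = \sum_(i < B | (i : nat) \in I) G i.
Proof.
move=> GB; rewrite -(big_mkord (fun i => i \in I) G).
rewrite (fsbigE [seq i <- iota 0 B | i \in I]) /=.
- rewrite big_filter_cond /index_iota subn0; apply: eq_bigl => i.
  by rewrite andbb.
- by rewrite filter_uniq ?iota_uniq.
- by move=> i /=; rewrite mem_filter => /andP[+ _]; rewrite inE.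
- move=> i Ii; rewrite mem_filter mem_iota add0n /= negb_and -leqNgt.
  by rewrite mem_set //= => ?; exact: GB.
Qed.

(** One-dimensional Helly: the intervals with centre [v i] and radius [e i] meet pairwise, and the
    supremum of their left ends lies in all of them. It yields values at points of a completion or a
    closure without a choice of sequences. *)
Lemma common_center (R : realType) (I : Type) (i0 : I) (v e : I -> R) :
  (forall i j, `|v i - v j| <= e i + e j) -> exists r, forall i, `|v i - r| <= e i.
Proof.
move=> ve; pose S := range (fun i => v i - e i).
have S_ub i : ubound S (v i + e i).
  move=> _ [j _ <-]; rewrite lerBlDr -addrA -lerBlDl.
  by rewrite addrC (le_trans (ler_norm _)) // distrC addrC.
have hS : has_sup S.
  by split; [exists (v i0 - e i0), i0|exists (v i0 + e i0); exact: S_ub].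
exists (sup S) => i; rewrite ler_norml; apply/andP; split.
  by rewrite lerNl opprB lerBlDr addrC; apply: ge_sup; [exact: hS.1|exact: S_ub].
by rewrite lerBlDr -lerBlDl; apply: ub_le_sup; [exact: hS.2|exists i].
Qed.

Section C00.
Variable R : realType.
Implicit Types f x y : c00 R.

Lemma c00_ext x y : (forall n, x n = y n) -> x = y.
Proof. by move=> xy; apply: val_inj; apply/funext. Qed.

Lemma c00_bound x : exists B, forall n, (B <= n)%N -> x n = 0.
Proof.
have := c00P x; rewrite inE /= => /finite_seqP[s xs].
have [B HB] : exists B, forall n, supp x n -> (n < B)%N.
  exists (\sum_(n <- s) n.+1)%N => n; rewrite xs /= => ns.
  by rewrite (big_rem n) //= leq_addr.
exists B => n Bn; apply: contrapT => /eqP /HB; rewrite ltnNge Bn //.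
Qed.

Lemma c00D x y n : (x + y) n = x n + y n. Proof. by []. Qed.
Lemma c00Z a x n : (a *: x) n = a * x n. Proof. by []. Qed.
Lemma c00N x n : (- x) n = - x n. Proof. by []. Qed.
Lemma c00_0 n : (0 : c00 R) n = 0. Proof. by []. Qed.
Lemma c00_sum (I : Type) (r : seq I) (P : pred I) (G : I -> c00 R) n :
  (\sum_(i <- r | P i) G i) n = \sum_(i <- r | P i) G i n.
Proof. by elim/big_rec2: _ => //= i y1 y2 _ <-. Qed.

Lemma restrE E x n : restr E x n = if n \in E then x n else 0.
Proof. by []. Qed.

Lemma restr_sum (I : Type) (r : seq I) (P : pred I) (G : I -> c00 R) E :
  restr E (\sum_(i <- r | P i) G i) = \sum_(i <- r | P i) restr E (G i).
Proof.
apply: c00_ext => n; rewrite restrE !c00_sum; case: ifP => nE.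
  by apply: eq_bigr => i _; rewrite restrE nE.
by rewrite big1 // => i _; rewrite restrE nE.
Qed.

Lemma restr0 E : restr E 0 = 0 :> c00 R.
Proof. by apply: c00_ext => n; rewrite restrE; case: ifP. Qed.

Lemma actE f x B : (forall n, (B <= n)%N -> x n = 0) ->
  act f x = \sum_(n < B) f n * x n.
Proof.
move=> xB; rewrite /act (@fsum_nat _ _ _ B).
  by apply: eq_bigl => i; rewrite in_setT.
by move=> n _ /xB ->; rewrite mulr0.
Qed.

Lemma actC f x : act f x = act x f.
Proof. by rewrite /act; apply: eq_fsbigr => i _; rewrite mulrC. Qed.

Lemma act_is_scalable f : scalable_for *%R (act f).
Proof.
move=> a x; have [B xB] := c00_bound x.
rewrite !(@actE _ _ B) ?mulr_sumr//.
  by apply: eq_bigr => i _; rewrite c00Z mulrCA.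
by move=> n /xB xn; rewrite c00Z xn mulr0.
Qed.

Lemma act_is_additive f : additive (act f).
Proof.
move=> x y; have [B xB] := c00_bound x; have [C yC] := c00_bound y.
have xM n : (maxn B C <= n)%N -> x n = 0 by rewrite geq_max => /andP[/xB].
have yM n : (maxn B C <= n)%N -> y n = 0 by rewrite geq_max => /andP[_ /yC].
rewrite !(@actE _ _ (maxn B C)) //.
  by rewrite -sumrB; apply: eq_bigr => i _; rewrite c00D c00N mulrBr.
by move=> n Bn; rewrite c00D c00N xM // yM // subrr.
Qed.

HB.instance Definition _ f :=
  GRing.isZmodMorphism.Build (c00 R) R (act f) (act_is_additive f).
HB.instance Definition _ f :=
  GRing.isScalable.Build R (c00 R) R *%R (act f) (act_is_scalable f).

Lemma act_suml (I : Type) (r : seq I) (P : pred I) (G : I -> c00 R) x :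
  act (\sum_(i <- r | P i) G i) x = \sum_(i <- r | P i) act (G i) x.
Proof. by rewrite actC linear_sum; apply: eq_bigr => i _; rewrite actC. Qed.

Lemma actZl a f x : act (a *: f) x = a * act f x.
Proof. by rewrite actC linearZ /= actC. Qed.

Lemma actNl f x : act (- f) x = - act f x.
Proof. by rewrite actC linearN /= actC. Qed.

Lemma act0l x : act 0 x = 0 :> R.
Proof. by rewrite actC linear0. Qed.

Lemma act_unit k x : act (unit_vec R k) x = x k.
Proof.
rewrite actC (@actE _ _ k.+1) /=.
  rewrite big_ord_recr /= eqxx mulr1 big1 ?add0r // => i _ /=.
  by rewrite ltn_eqF ?mulr0.
by move=> n kn; rewrite gtn_eqF.
Qed.

Lemma act_restr f x E : act (restr E f) x = act f (restr E x).
Proof.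
rewrite /act; apply: eq_fsbigr => n _; rewrite !restrE.
by case: ifP; rewrite ?mul0r ?mulr0.
Qed.

Lemma restr_id E x : supp x `<=` E -> restr E x = x.
Proof.
move=> xE; apply: c00_ext => n; rewrite restrE; case: ifP => // nE.
apply/esym/eqP; apply: contraFT nE => xn; rewrite inE; exact: xE.
Qed.

Lemma restr_eq0 E x : (forall n, E n -> x n = 0) -> restr E x = 0.
Proof.
move=> xE; apply: c00_ext => n; rewrite restrE; case: ifP => //.
by rewrite inE => /xE.
Qed.

Lemma c00_decomp x B : (forall n, (B <= n)%N -> x n = 0) ->
  x = \sum_(k < B) x k *: unit_vec R k.
Proof.
move=> xB; apply: c00_ext => n; rewrite c00_sum.
under eq_bigr do rewrite c00Z /=.
have [nB|Bn] := ltnP n B.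
  rewrite (bigD1 (Ordinal nB)) //= eqxx mulr1 big1 ?addr0 // => i ni.
  rewrite (_ : (n == i) = false) ?mulr0 //.
  by apply: contra_neqF ni => /eqP e; apply/val_inj; rewrite /= e.
rewrite xB // big1 // => i _; rewrite gtn_eqF ?mulr0 //.
exact: leq_trans Bn.
Qed.

Definition norm1 x : R := \sum_(n \in [set: nat]) `|x n|.

Lemma norm1_ge0 x : 0 <= norm1 x.
Proof. by apply: fsumr_ge0. Qed.

Lemma act_le_norm1 f x t : (forall n, `|f n| <= t) -> `|act f x| <= t * norm1 x.
Proof.
move=> ft; have [B xB] := c00_bound x.
rewrite (@actE _ _ B) // /norm1 (@fsum_nat _ _ _ B); last first.
  by move=> n _ /xB ->; rewrite normr0.
apply: le_trans (ler_norm_sum _ _ _) _; rewrite mulr_sumr.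
rewrite [leRHS](eq_bigl xpredT); last by move=> i; rewrite in_setT.
by apply: ler_sum => i _; rewrite normrM ler_wpM2r.
Qed.

Lemma supnorm_ge f n : `|f n| <= supnorm f.
Proof.
have [B fB] := c00_bound f.
apply: ub_le_sup; last by exists n.
exists (\sum_(i < B) `|f i|) => _ [m _ <-].
have [mB|/fB ->] := ltnP m B; last by rewrite normr0 sumr_ge0.
by rewrite (bigD1 (Ordinal mB)) //= lerDl sumr_ge0.
Qed.

End C00.

(** * The families F j *)

Section FamilyBasics.
Variables (R : realType) (F : nat -> set (c00 R)).
Hypothesis F_JTG : JTG F.

Lemma F_posN j f : F j f -> F j (- f).
Proof.
case: j => [|j]; last exact: JTG_symmetric.
rewrite (JTG_F0 F_JTG) => -[n [->|->]]; exists n; first by right.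
by left; rewrite opprK.
Qed.

Lemma F_pos0 j : (1 <= j)%N -> F j 0.
Proof.
move=> j1; have [f Ff] := JTG_neq0 F_JTG j1.
have := JTG_restr F_JTG j1 Ff (E := set0); rewrite (_ : restr _ _ = 0).
  by apply; move=> a b [].
by apply: restr_eq0.
Qed.

(** The alternative is due to [F 0], which lacks 0: restricting a signed unit vector may leave
    nothing. *)
Lemma F_restr j f E : F j f -> nat_interval E -> F j (restr E f) \/ restr E f = 0.
Proof.
case: j => [|j] Fj HE; last by left; exact: (JTG_restr F_JTG).
move: Fj; rewrite (JTG_F0 F_JTG) => -[n nf].
have {nf}[a [a1 ->]] : exists a : R, (a = 1 \/ a = - 1) /\ f = a *: unit_vec R n.
  by case: nf => ->; [exists 1; rewrite scale1r|exists (- 1); rewrite scaleN1r];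
    split; auto.
case: (pselect (E n)) => En.
  left; rewrite restr_id; last first.
    move=> m xm; have /eqP : (a *: unit_vec R n) m != 0 := xm.
    by rewrite c00Z /=; case: eqVneq => [->//|_]; rewrite mulr0.
  by exists n; case: a1 => ->; rewrite ?scale1r ?scaleN1r; auto.
right; apply: restr_eq0 => m Em; rewrite c00Z /=; case: eqVneq => [mn|_].
  by case: En; rewrite -mn.
by rewrite mulr0.
Qed.

Lemma tau_ge j f n : F j f -> (`|f n|%:E <= tau F j)%E.
Proof.
move=> Ff; apply: (@le_trans _ _ (supnorm f)%:E).
  by rewrite lee_fin supnorm_ge.
by apply: ereal_sup_ubound; exists f.
Qed.

Lemma tau_ge0 j : (1 <= j)%N -> (0 <= tau F j)%E.
Proof. by move=> /(JTG_neq0 F_JTG)[f] /(tau_ge 0); apply: le_trans. Qed.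

Lemma tau_partial n : (\sum_(1 <= j < n) tau F j <= 1)%E.
Proof.
apply: le_trans (JTG_tau_sum F_JTG).
have t0 : forall k, (1 <= k)%N -> true -> (0 <= tau F k)%E.
  by move=> k k1 _; exact: tau_ge0.
exact: (nneseries_lim_ge _ t0).
Qed.

Lemma sup_bounds : exists t : nat -> R,
  [/\ forall j, 0 <= t j, forall j f n, F j f -> `|f n| <= t j &
    forall d, 0 < d -> exists b, forall c, \sum_(b <= j < c) t j <= d].
Proof.
have fint j : (1 <= j)%N -> tau F j \is a fin_num.
  move=> j1; rewrite ge0_fin_numE ?tau_ge0 //.
  have := tau_partial j.+1; rewrite big_nat_recr //= => H.
  apply: (@le_lt_trans _ _ 1%E); last by rewrite ltry.
  apply: le_trans H; apply: leeDr; rewrite big_nat_cond; apply: sume_ge0 => i.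
  by rewrite andbT => /andP[/tau_ge0].
(* Members of [F 0] are signed unit vectors, so 1 bounds them; the sum in (B) starts at index 1. *)
pose t j : R := if j is 0%N then 1 else fine (tau F j).
have t0 j : 0 <= t j by case: j => [|j] //=; rewrite fine_ge0 // tau_ge0.
have tsum n : \sum_(1 <= j < n) t j <= 1.
  rewrite -lee_fin -sumEFin; apply: le_trans (tau_partial n).
  rewrite big_nat_cond [leRHS]big_nat_cond lee_sum // => -[|j] //.
  by rewrite andbT => /andP[j1 _]; rewrite /= fineK ?fint.
exists t; split => //.
  move=> [|j] f n Fj.
    move: Fj; rewrite (JTG_F0 F_JTG) => -[k [] ->] /=; rewrite ?normrN;
      by case: eqP => _ /=; rewrite ?normr1 ?normr0.
  by rewrite /t -lee_fin fineK ?fint // tau_ge.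
move=> d d0; pose S := [set \sum_(1 <= j < n) t j | n in [set: nat]].
have hS : has_sup S.
  split; first by exists (\sum_(1 <= j < 0) t j), 0%N.
  by exists 1 => _ [n _ <-].
(* A partial sum within d of the supremum leaves at most d for every later stretch. The cut is
   placed at [b.+1], which is at least 1 even for b = 0. *)
have [_ [b _ <-] Hb] := sup_adherent d0 hS.
exists b.+1 => c.
have [cb|bc] := leqP c b.+1; first by rewrite big_geq // ltW.
have Sc : \sum_(1 <= j < c) t j <= sup S by apply: ub_le_sup; [exact: hS.2|exists c].
rewrite (@big_cat_nat _ _ _ b.+1) // in Sc; last exact: ltnW.
have tb : \sum_(1 <= j < b) t j <= \sum_(1 <= j < b.+1) t j.
  case: b {Hb bc Sc} => [|b]; first by rewrite !big_geq.
  by rewrite [leRHS]big_nat_recr // lerDl.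
have {}Sc := le_trans (lerD tb (lexx _)) Sc.
by move: Hb Sc; set u := sup S; clearbody u; lra.
Qed.

(** The common shape of the parts of one functional and of the merged parts of several functionals
    with disjoint index sets. The value 0 stands for an absent index; it is allowed separately since
    [F 0] does not contain it. *)
Definition selection (h : nat -> c00 R) := forall j, F j (h j) \/ h j = 0.

(** One b serves all selections, because [t j * norm1 x] dominates the action of every member of
    [F j] on x. *)
Lemma tail_act x d : 0 < d -> exists b, forall h, selection h ->
  forall c, \sum_(b <= j < c) `|act (h j) x| <= d.
Proof.
move=> d0; have [t [t0 tF tS]] := sup_bounds.
have dx : 0 < d / (1 + norm1 x) by rewrite divr_gt0 // ltr_pwDl // norm1_ge0.
have [b Hb] := tS _ dx; exists b => h hh c.
apply: (@le_trans _ _ (\sum_(b <= j < c) t j * norm1 x)).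
  apply: ler_sum => j _; apply: act_le_norm1 => n.
  by case: (hh j) => [/tF|->] //; rewrite normr0.
rewrite -mulr_suml; apply: le_trans (ler_wpM2r (norm1_ge0 x) (Hb c)) _.
have := norm1_ge0 x; move: (norm1 x) => u u0.
rewrite -mulrA ger_pMr // mulrC ler_pdivrMr; lra.
Qed.

End FamilyBasics.

(** * Special functionals *)

Section Special.
Variables (R : realType) (F : nat -> set (c00 R)).
Variables (Xi1 Xi2 : set nat) (sigma : seq (c00 R) -> nat).
Hypothesis F_JTG : JTG F.
Hypothesis sigma_coding : is_coding F Xi2 sigma.

Notation special := (special F Xi1 sigma).

(** The unique element of [seq_ind], as a number; for a special sequence the default 0 of [xget] is
    never met. *)
Definition sindex (s : nat -> c00 R) (i : nat) : nat :=
  if i is 0%N then xget 0%N (least [set j | F j (s 0%N)]) else sigma (mkseq s i).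

Lemma leastP (A : set nat) : A !=set0 -> least A = [set xget 0%N (least A)].
Proof.
move=> [j Aj].
have exA : exists j, `[< A j >] by exists j; apply/asboolP.
have [k /asboolP Ak kmin] := ex_minnP exA.
have Lk : least A k by split => // i Ai; apply: kmin; apply/asboolP.
have Lu i : least A i -> i = k.
  move=> [Ai imin]; apply/eqP; rewrite eqn_leq imin //=.
  by apply: kmin; apply/asboolP.
case: (xgetP 0%N (least A)) => [x -> Lx|/(_ k)] //.
by apply/seteqP; split => i /=; [move=> /Lu ->; rewrite (Lu _ Lx)|move=> ->].
Qed.

Section OneSpecial.
Variables (I : set nat) (s : nat -> c00 R).
Hypothesis sp : special I s.

Lemma special_down i m : I i -> (m <= i)%N -> I m.
Proof.
have [->|[d ->]] := special_dom sp; first by [].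
by move=> /= id mi; exact: leq_ltn_trans id.
Qed.

Lemma special_F_pos i : I i -> F_pos F (s i).
Proof. exact: special_F_pos sp _. Qed.

Lemma sindex0 : I 0%N -> seq_ind F sigma s 0 = [set sindex s 0].
Proof. by move=> /special_F_pos[j _ Fj]; apply: leastP; exists j. Qed.

Lemma seq_indE i : I i -> seq_ind F sigma s i = [set sindex s i].
Proof. by case: i => // /sindex0. Qed.

Lemma sindex_in i : I i -> F (sindex s i) (s i).
Proof.
case: i => [I0|i Ii]; last exact: special_next sp _ Ii.
have : seq_ind F sigma s 0 (sindex s 0) by rewrite sindex0.
by case.
Qed.

Lemma special_neq0 i : I i -> s i != 0.
Proof. exact: (special_block sp).1. Qed.

Lemma neq0_supp (x : c00 R) : x != 0 -> exists n, x n != 0.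
Proof.
move=> /eqP x0; apply: contrapT => /forallNP H; apply: x0; apply: c00_ext => n.
by rewrite c00_0; apply/eqP; apply: contrapT => /negP; exact: H.
Qed.

Lemma special_lt_supp i m : I i -> (m < i)%N -> lt_supp (s m) (s i).
Proof.
elim: i => // i IH Ii; rewrite ltnS leq_eqVlt => /predU1P[->|mi].
  exact: (special_block sp).2.
have Ii' : I i by apply: special_down Ii _.
have [n ni] := neq0_supp (special_neq0 Ii').
move=> k l sk sl; apply: (@ltn_trans n); first exact: (IH Ii' mi k n sk ni).
exact: ((special_block sp).2 _ Ii n l ni sl).
Qed.

(** Successive nonempty supports move right by at least one at each step, so a bounded interval
    meets only finitely many terms. *)
Lemma special_supp_ge i n : I i -> s i n != 0 -> (i <= n)%N.
Proof.
elim: i n => // i IH n Ii sn; have Ii' : I i by apply: special_down Ii _.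
have [m mi] := neq0_supp (special_neq0 Ii').
apply: leq_ltn_trans (IH _ Ii' mi) _.
exact: ((special_block sp).2 _ Ii m n mi sn).
Qed.

Lemma special_supp_uniq i m n : I i -> I m -> s i n != 0 -> s m n != 0 -> i = m.
Proof.
move=> Ii Im si sm; case: (ltngtP i m) => // [im|mi].
  by have := special_lt_supp Im im si sm; rewrite ltnn.
by have := special_lt_supp Ii mi sm si; rewrite ltnn.
Qed.

Lemma special_coding_dom i : I i -> coding_dom F (mkseq s i.+1).
Proof.
move=> Ii; have Im m : (m < i.+1)%N -> I m by move=> mi; exact: special_down Ii _.
split.
- by rewrite -size_eq0 size_mkseq.
- move=> f /mapP[m]; rewrite mem_iota add0n => /andP[_ mi] ->.
  exact: special_F_pos (Im _ mi).
- rewrite size_mkseq; split=> m mi; rewrite !nth_mkseq //.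
  + exact: special_neq0 (Im _ mi).
  + exact: special_lt_supp (Im _ mi) _.
  + exact: ltnW.
Qed.

(** A value of [sigma] exceeds every k such that an earlier term lies in [F k], and each earlier
    term lies in the family of its own index. *)
Lemma sindex_lt i m : I i -> (m < i)%N -> (sindex s m < sindex s i)%N.
Proof.
case: i => // i Ii mi; have Ii' : I i by apply: special_down Ii _.
have [_ _ H] := sigma_coding.
apply: (H _ (special_coding_dom Ii') (s m)).
  by apply/mapP; exists m; rewrite // mem_iota.
by apply: sindex_in; apply: special_down Ii' _.
Qed.

Lemma sindex_ltP i m : I i -> I m -> (sindex s m < sindex s i)%N -> (m < i)%N.
Proof.
move=> Ii Im; apply: contraTT; rewrite -!leqNgt leq_eqVlt.
by move=> /predU1P[->//|im]; exact/ltnW/sindex_lt.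
Qed.

Lemma sindex_inj i m : I i -> I m -> sindex s i = sindex s m -> i = m.
Proof.
move=> Ii Im e; case: (ltngtP i m) => // [im|mi].
  by have := sindex_lt Im im; rewrite e ltnn.
by have := sindex_lt Ii mi; rewrite e ltnn.
Qed.

End OneSpecial.

(** Terms are looked up by index instead of position, which makes different sequences comparable. In
    a special sequence the indices are distinct, so the choice made by [cid] is forced. *)
Definition piece (I : set nat) (s : nat -> c00 R) (j : nat) : c00 R :=
  if pselect (exists i, I i /\ sindex s i = j) is left e then s (sval (cid e)) else 0.

(* The part of the special sequence with indices below [a], not cut by any interval. *)
Definition past I s a : c00 R := \sum_(0 <= j < a) piece I s j.

Lemma piece_kap I s i : special I s -> I i -> piece I s (sindex s i) = s i.
Proof.
move=> sp Ii; rewrite /piece; case: pselect => [e|]; last by case; exists i.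
by case: (cid e) => m /= [Im ek]; rewrite (sindex_inj sp Im Ii ek).
Qed.

Lemma piece0 I s j : (forall i, I i -> sindex s i <> j) -> piece I s j = 0.
Proof. by move=> H; rewrite /piece; case: pselect => // e; have [i [/H]] := e. Qed.

Lemma piece_cases I s j : special I s ->
  (exists i, [/\ I i, sindex s i = j & piece I s j = s i]) \/ piece I s j = 0.
Proof.
move=> sp; case: (pselect (exists i, I i /\ sindex s i = j)) => [[i [Ii <-]]|H].
  by left; exists i; rewrite piece_kap.
by right; apply: piece0 => i Ii e; apply: H; exists i.
Qed.

(* A common index beyond both heads determines both sequences up to it. *)
Lemma past_eq I s I' s' i i' a : special I s -> special I' s' -> I i -> I' i' ->
  sindex s i = sindex s' i' -> (a <= sindex s i)%N -> (sindex s 0 < a)%N -> (sindex s' 0 < a)%N ->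
  past I s a = past I' s' a.
Proof.
move=> sp sp' Ii Ii' e ai h h'.
(* Position 0 is excluded, as head indices are below a. So both indices are values of [sigma], whose
   injectivity recovers the two initial sequences. *)
case: i Ii e ai => [|i] Ii e ai; first by rewrite leqNgt h in ai.
case: i' Ii' e => [|i'] Ii' e; first by rewrite e leqNgt h' in ai.
have Ii1 : I i by apply: (special_down sp) Ii _.
have Ii1' : I' i' by apply: (special_down sp') Ii' _.
have [sinj _ _] := sigma_coding.
have es : mkseq s i.+1 = mkseq s' i'.+1.
  apply: sinj => //; rewrite inE; first exact: (special_coding_dom sp).
  exact: (special_coding_dom sp').
have ei : i = i' by have := congr1 size es; rewrite !size_mkseq => -[].
subst i'.
have sE m : (m <= i)%N -> s m = s' m.
  by move=> mi; have := congr1 (fun t => nth 0 t m) es; rewrite !nth_mkseq.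
have kE m : (m <= i)%N -> sindex s m = sindex s' m.
  case: m => [|m] mi; first by rewrite /sindex sE.
  rewrite /sindex; congr sigma; apply/eq_in_map => k; rewrite mem_iota => /andP[_ km].
  by apply: sE; exact: leq_trans (ltnW km) mi.
rewrite /past; apply: eq_big_nat => j /andP[_ ja].
(* Indices increase along a sequence, so a term of index below a stands at a position at most i,
   where the two sequences agree. *)
have below (K : set nat) t m : special K t -> K i.+1 -> K m -> sindex t i.+1 = sindex s i.+1 ->
    sindex t m = j -> (m <= i)%N.
  move=> spt Ki Km et tm; rewrite -ltnS; apply: (sindex_ltP spt) => //.
  by rewrite tm et; exact: leq_trans ai.
case: (piece_cases j sp) => [[m [Im mj ->]]|p0].
  have mi := below _ _ _ sp Ii Im erefl mj.
  rewrite -mj kE // (piece_kap sp') ?sE //.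
  exact: (special_down sp') Ii1' _.
case: (piece_cases j sp') => [[m [Im mj pm]]|->//].
have mi := below _ _ _ sp' Ii' Im (esym e) mj.
have Im' : I m by exact: (special_down sp) Ii1 mi.
by move: p0; rewrite -mj -kE // (piece_kap sp) // => sm0; have := special_neq0 sp Im'; rewrite sm0 eqxx.
Qed.

Lemma past_head I s a : special I s -> (a <= sindex s 0)%N -> past I s a = 0.
Proof.
move=> sp h; rewrite /past big_nat big1 // => j /andP[_ ja]; apply: piece0 => i Ii e.
have : (sindex s i < sindex s 0)%N by rewrite e; exact: leq_trans h.
by apply/negP; rewrite -leqNgt; case: i Ii {e} => // i Ii;
  exact/ltnW/(sindex_lt sp Ii (ltn0Sn i)).
Qed.

(* [h j] is the part of index [j] of the functional [g] with index set [J]. *)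
Definition parts (g : c00 R) (J : set nat) (h : nat -> c00 R) :=
  [/\ forall j, J j -> F j (h j), forall j, ~ J j -> h j = 0 &
    exists b, (forall j, J j -> (j < b)%N) /\
      forall c, (b <= c)%N -> g = \sum_(0 <= j < c) h j].

Lemma parts_selection g J h : parts g J h -> selection F h.
Proof. by move=> [h1 h2 _] j; case: (pselect (J j)) => [/h1|/h2]; auto. Qed.

(** At each coordinate at most one term is nonzero, and E is bounded, so the sum can be regrouped by
    indices. *)
Lemma special_parts (g : c00 R) I s E J : special I s -> nat_interval E -> finite_set E ->
  (g : nat -> R) = cut_fun E (fun n => \sum_(i \in I) s i n) ->
  J = \bigcup_(i in [set i | I i /\ restr E (s i) != 0]) seq_ind F sigma s i ->
  parts g J (fun j => restr E (piece I s j)).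
Proof.
move=> sp itvE /finite_seqP[r rE] gE JE.
have [B HB] : exists B, forall n, E n -> (n < B)%N.
  by exists (\sum_(n <- r) n.+1)%N => n; rewrite rE => nr; rewrite (big_rem n) //= leq_addr.
have JP j : J j <-> exists i, [/\ I i, restr E (s i) != 0 & j = sindex s i].
  rewrite JE; split=> [[i [/= Ii ne]]|[i [Ii ne ->]]].
    by rewrite (seq_indE sp) // => ->; exists i.
  by exists i; rewrite ?(seq_indE sp).
(* A sum serves as a bound: it exceeds the indices of the first B terms, and later terms have their
   support beyond E. *)
pose b := (\sum_(i < B) (sindex s i).+1)%N.
have kb i : (i < B)%N -> (sindex s i < b)%N.
  by move=> iB; rewrite /b (bigD1 (Ordinal iB)) //= leq_addr.
split.
- move=> j /JP[i [Ii ne ->]]; rewrite (piece_kap sp) //.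
  by case: (F_restr F_JTG (sindex_in sp Ii) itvE) => // e; rewrite e eqxx in ne.
- move=> j nJ; case: (piece_cases j sp) => [[i [Ii ij ->]]|->]; last exact: restr0.
  by apply: contrapT => /eqP ne; apply: nJ; apply/JP; exists i.
exists b; split=> [j /JP[i [Ii ne ->]]|c bc].
  have [n ] := neq0_supp ne; rewrite restrE; case: ifP; rewrite ?eqxx // inE => En sn.
  by apply: kb; exact: leq_ltn_trans (special_supp_ge sp Ii sn) (HB _ En).
apply: c00_ext => n; rewrite c00_sum gE /cut_fun.
case: ifPn => nE; last by rewrite big1 // => j _; rewrite restrE (negbTE nE).
under [RHS]eq_bigr do rewrite restrE nE.
case: (pselect (exists i, I i /\ s i n != 0)) => [[i [Ii si]]|H]; last first.
  have s0 i : I i -> s i n = 0.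
    by move=> Ii; apply/eqP; apply: contrapT => /negP ?; apply: H; exists i.
  rewrite fsbig1 // big1 // => j _.
  by case: (piece_cases j sp) => [[i [Ii _ ->]]|->] //; exact: s0.
have s0 m : I m -> m <> i -> s m n = 0.
  move=> Im mi; apply/eqP; apply: contrapT => /negP sm.
  exact/mi/(special_supp_uniq sp Im Ii sm si).
rewrite -(fsbig_widen [set i] I); last 2 first.
- by move=> _ ->.
- by move=> m [Im /= mi]; exact: s0.
rewrite fsbig_set1.
have ic : (sindex s i < c)%N.
  apply: leq_trans bc; apply: kb; apply: leq_ltn_trans (special_supp_ge sp Ii si) _.
  by apply: HB; rewrite inE in nE.
rewrite big_mkord (bigD1 (Ordinal ic)) //= (piece_kap sp) // big1 ?addr0 // => j ji.
case: (piece_cases j sp) => [[m [Im mj ->]]|->] //; apply: s0 => // mi.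
by move/eqP: ji; apply; apply: val_inj; rewrite /= -mj mi.
Qed.

Definition atom (g : c00 R) (J : set nat) :=
  special_with F Xi1 sigma g J \/ single_with F g J.

(* Elements of [F 0] get index 0: they cannot be combined, but obey the same estimates. *)
Definition basic_functional g J := atom g J \/ (F 0%N g /\ J = [set 0%N]).

(** Needed to feed pieces of functionals back into Bessel's inequality: a piece must again be an
    atom, with the correspondingly smaller index set. *)
Definition trunc_parts (h : nat -> c00 R) (J : set nat) :=
  forall a c, atom (\sum_(a <= j < c) h j) (J `&` [set j | (a <= j < c)%N]).

Lemma atom0 : atom 0 set0.
Proof.
right; split; first by exists 1%N => //; exact: (F_pos0 F_JTG).
by apply/seteqP; split => // k [/eqP].
Qed.

Lemma singleton_parts g j : F j g -> parts g [set j] (fun k => if k == j then g else 0).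
Proof.
move=> Fg; split.
- by move=> _ ->; rewrite eqxx.
- by move=> k /eqP /negbTE ->.
exists j.+1; split=> [_ ->//|c jc].
by rewrite big_mkord (bigD1 (Ordinal jc)) //= eqxx big1 ?addr0 // => k /negbTE; rewrite -val_eqE /= => ->.
Qed.

Lemma single_withP g J : single_with F g J -> (g = 0 /\ J = set0) \/
  exists j, [/\ g != 0, (1 <= j)%N, F j g & J = [set j]].
Proof.
move=> [[j j1 Fj] ->]; have [->|g0] := eqVneq g 0.
  by left; split => //; apply/seteqP; split => // k [].
right; have := @leastP [set j | (1 <= j)%N /\ F j g] (ex_intro _ j (conj j1 Fj)).
set k := xget _ _ => L.
have [[k1 Fk] _] : least [set j | (1 <= j)%N /\ F j g] k by rewrite L.
exists k; split => //; rewrite L.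
by apply/seteqP; split => [i []|i].
Qed.

Lemma sum_piece_trunc (h : nat -> c00 R) a c C : (c <= C)%N ->
  \sum_(0 <= j < C) (if (a <= j < c)%N then h j else 0) = \sum_(a <= j < c) h j.
Proof.
move=> cC; rewrite -big_mkcond /= [RHS](big_nat_widen _ _ C) // [RHS](big_nat_widenl _ 0%N) //.
by apply: eq_bigl => j; rewrite andbC.
Qed.

(** Indices and supports increase together, so cutting to a window of indices amounts to cutting to
    an interval of coordinates. *)
Lemma special_trunc I s E J : special I s -> nat_interval E -> finite_set E ->
  J = \bigcup_(i in [set i | I i /\ restr E (s i) != 0]) seq_ind F sigma s i ->
  trunc_parts (fun j => restr E (piece I s j)) J.
Proof.
move=> sp itvE finE JE a c; left.
pose W i := I i /\ (a <= sindex s i < c)%N.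
(* The part of E inside the convex hull of the supports of the terms with index in the window. *)
pose E' := E `&` [set n | (exists i m, [/\ W i, s i m != 0 & (m <= n)%N]) /\
                          (exists i m, [/\ W i, s i m != 0 & (n <= m)%N])].
have E'P i : I i -> restr E' (s i) =
    if (a <= sindex s i < c)%N then restr E (s i) else 0.
  move=> Ii; case: ifPn => Wi; apply: c00_ext => n; rewrite restrE.
    rewrite restrE; have [->|sn] := eqVneq (s i n) 0; first by rewrite !if_same.
    congr (if _ then _ else _); apply/idP/idP; rewrite !inE; first by case.
    by move=> En; split => //; split; exists i, n.
  case: ifPn => //; rewrite inE => -[En [[i1 [m1 [[Ii1 /andP[ai1 _]] s1 mn]]]]].
  move=> [i2 [m2 [[Ii2 /andP[_ i2c]] s2 nm]]].
  apply/eqP; apply: contraNT Wi => sn; apply/andP; split; rewrite leqNgt; apply/negP.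
    move=> ia; have ii : (i < i1)%N by apply: (sindex_ltP sp) => //; exact: leq_trans ai1.
    by have := special_lt_supp sp Ii1 ii sn s1; rewrite ltnNge mn.
  rewrite ltnS => ci.
  have ii : (i2 < i)%N by apply: (sindex_ltP sp) => //; exact: leq_trans ci.
  by have := special_lt_supp sp Ii ii s2 sn; rewrite ltnNge nm.
have itvE' : nat_interval E'.
  move=> x y [Ex [[i1 [m1 [W1 s1 l1]]] _]] [Ey [_ [i2 [m2 [W2 s2 l2]]]]] z /andP[xz zy].
  split; first by apply: itvE Ex Ey _ _; rewrite xz.
  by split; [exists i1, m1|exists i2, m2]; split => //; lia.
have finE' : finite_set E' by apply: sub_finite_set finE => n [].
have finfun : cut_fun E' (fun n => \sum_(i \in I) s i n) \in finsupp.
  rewrite inE; apply: sub_finite_set finE' => n; rewrite /supp /cut_fun /=.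
  by case: ifP; rewrite ?eqxx // inE.
pose J' := \bigcup_(i in [set i | I i /\ restr E' (s i) != 0]) seq_ind F sigma s i.
have [_ _ [b [_ Hb]]] := @special_parts (C00 finfun) I s E' J' sp itvE' finE' erefl erefl.
exists I, s, E'; split => //; last first.
  rewrite JE; apply/seteqP; split=> j /=.
    move=> [[i [Ii ne]]]; rewrite (seq_indE sp) // => /= -> Wi.
    by exists i; rewrite ?(seq_indE sp) //=; split => //; rewrite E'P // Wi.
  move=> [i [Ii ne]]; rewrite (seq_indE sp) // => /= ->.
  move: ne; rewrite E'P //; case: ifP => [Wi ne|]; last by rewrite eqxx.
  by split => //; exists i; rewrite ?(seq_indE sp).
have -> : \sum_(a <= j < c) restr E (piece I s j) = C00 finfun; last by [].
rewrite (Hb (maxn b c)) ?leq_maxl // -(@sum_piece_trunc _ a c (maxn b c)) ?leq_maxr //.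
apply: eq_bigr => j _; case: (piece_cases j sp) => [[i [Ii <- ->]]|->].
  by rewrite E'P.
by rewrite !restr0 if_same.
Qed.

Lemma atom_parts g J : atom g J -> exists h, parts g J h /\ trunc_parts h J.
Proof.
case=> [[I [s [E [sp itvE finE gE JE]]]]|sg].
  exists (fun j => restr E (piece I s j)); split; first exact: special_parts gE JE.
  exact: special_trunc.
have [[-> ->]|[j [g0 j1 Fj JE]]] := single_withP sg.
  exists (fun=> 0); split.
    by split => //; exists 0%N; split => // c _; rewrite big1.
  by move=> a c; rewrite big1 // set0I; exact: atom0.
exists (fun k => if k == j then g else 0); rewrite JE.
split; first exact: singleton_parts.
move=> a c; case: (boolP (a <= j < c)%N) => jac.
  have -> : \sum_(a <= k < c) (if k == j then g else 0) = g.
    case/andP: jac => aj jc.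
    rewrite (big_cat_nat aj (ltnW jc)) /= big_nat big1 ?add0r; last first.
      by move=> k /andP[_ kj]; rewrite ltn_eqF.
    rewrite big_ltn // eqxx big_nat big1 ?addr0 // => k /andP[jk _].
    by rewrite gtn_eqF.
  have -> : [set j] `&` [set k | (a <= k < c)%N] = [set j].
    by apply/seteqP; split => [k []|k -> //].
  by rewrite -JE; right.
have -> : [set j] `&` [set k | (a <= k < c)%N] = set0.
  by apply/seteqP; split => [k [/= ->]|k //]; rewrite (negbTE jac).
rewrite big_nat big1; first exact: atom0.
by move=> k kac; case: eqP => // kj; rewrite -kj kac in jac.
Qed.

End Special.

(** * The norm *)

Section FiniteSums.
Variable R : realType.

Lemma cauchy_schwarz_sum (I : Type) (r : seq I) (P : pred I) (a b : I -> R) :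
  (\sum_(i <- r | P i) a i * b i) ^+ 2 <=
  (\sum_(i <- r | P i) a i ^+ 2) * (\sum_(i <- r | P i) b i ^+ 2).
Proof.
set A := \sum_(i <- r | P i) a i ^+ 2; set B := \sum_(i <- r | P i) b i ^+ 2.
set C := \sum_(i <- r | P i) _.
have quad u v : 0 <= u ^+ 2 * A - 2 * u * v * C + v ^+ 2 * B.
  have -> : u ^+ 2 * A - 2 * u * v * C + v ^+ 2 * B =
      \sum_(i <- r | P i) (u * a i - v * b i) ^+ 2.
    rewrite !mulr_sumr -sumrN -!big_split /=; apply: eq_bigr => i _; ring.
  by apply: sumr_ge0 => i _; exact: sqr_ge0.
have A0 : 0 <= A by apply: sumr_ge0 => i _; exact: sqr_ge0.
have B0 : 0 <= B by apply: sumr_ge0 => i _; exact: sqr_ge0.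
(* At (B, C) the form equals B (A B - C^2). *)
have := quad B C; have [B00|Bn] := eqVneq B 0; last first.
  have {}B0 : 0 < B by rewrite lt_neqAle eq_sym Bn.
  move=> H; rewrite -subr_ge0 -(pmulr_rge0 _ B0); apply: le_trans H _.
  by rewrite le_eqVlt; apply/orP; left; apply/eqP; ring.
move=> _; have [->|C0] := eqVneq C 0; first by rewrite expr0n mulr_ge0.
(* For B = 0 the form is linear in v, and this v gives it the negative value -A - 2. *)
have := quad 1 ((A + 1) / C); rewrite B00 mulr0 expr1n mul1r mulr1 -mulrA divfK //.
lra.
Qed.

(** [F2] admits rational coefficients only. Rounding c towards 0 does not increase the sum of
    squares and costs as little of the value as wished. *)
Lemma ratr_under (c v d : R) : 0 < d ->
  exists q : rat, (ratr q : R) ^+ 2 <= c ^+ 2 /\ c * v - d <= ratr q * v.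
Proof.
move=> d0.
have pos (c' v' : R) : 0 <= c' ->
    exists q : rat, (ratr q : R) ^+ 2 <= c' ^+ 2 /\ c' * v' - d <= ratr q * v'.
  rewrite le_eqVlt => /predU1P[<-|c0].
    by exists 0; rewrite rmorph0 !mul0r sub0r oppr_le0; split => //; exact: ltW.
  have lt : Num.max 0 (c' - d / (1 + `|v'|)) < c'.
    by rewrite gt_max c0 gtrBl divr_gt0 // ltr_pwDl.
  have [q] := rat_in_itvoo lt; rewrite in_itv /= gt_max => /andP[/andP[q0 q1] q2].
  exists q; split; first by rewrite lerXn2r ?nnegrE ?ltW.
  have v1 : 0 < 1 + `|v'| by rewrite ltr_pwDl.
  have H : (c' - ratr q) * v' <= d.
    apply: (@le_trans _ _ ((c' - ratr q) * (1 + `|v'|))).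
      by rewrite ler_wpM2l ?subr_ge0 ?(ltW q2) // ler_wpDl // ler_norm.
    by rewrite -ler_pdivlMr // lerBlDr addrC -lerBlDr ltW.
  lra.
have [c0|c0] := leP 0 c; first exact: pos.
have c0' : 0 <= - c by rewrite oppr_ge0 ltW.
have [q [q1 q2]] := pos _ (- v) c0'.
by exists (- q); rewrite raddfN /= sqrrN -[c ^+ 2]sqrrN mulNr -mulrN -[c * v]mulrNN.
Qed.

(** Finite-dimensional duality: the extremal coefficients [v k / s], with s the l2 norm of v, are
    rounded to rationals. *)
Lemma l2_le_of_rat d (v : 'I_d -> R) (M : R) : 0 <= M ->
  (forall a : 'I_d -> rat, \sum_k a k ^+ 2 <= 1 -> \sum_k ratr (a k) * v k <= M) ->
  \sum_k v k ^+ 2 <= M ^+ 2.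
Proof.
move=> M0 H; rewrite leNgt; apply/negP => ltM.
set S := \sum_k v k ^+ 2 in ltM.
have S0 : 0 < S by apply: le_lt_trans ltM; exact: sqr_ge0.
pose s := Num.sqrt S.
have sS : s ^+ 2 = S by rewrite sqr_sqrtr // ltW.
have s0 : 0 < s by rewrite sqrtr_gt0.
have Ms : M < s by rewrite -(@ltr_pXn2r _ 2) ?nnegrE ?sS // ltW.
(* Half of the gap s - M is shared among the d coefficients; the added 1 covers d = 0. *)
have dlt : 0 < (s - M) / 2 / (d%:R + 1).
  by rewrite divr_gt0 ?divr_gt0 ?subr_gt0 // ltr_wpDl.
have [q Hq] := @choice _ _ _ (fun k => ratr_under (v k / s) (v k) dlt).
have q1 : \sum_k q k ^+ 2 <= 1.
  rewrite -(@ler_rat R) rmorph1 rmorph_sum /=.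
  apply: (@le_trans _ _ (\sum_k (v k / s) ^+ 2)).
    by apply: ler_sum => k _; rewrite rmorphXn; exact: (Hq k).1.
  under eq_bigr do rewrite expr_div_n; rewrite -mulr_suml sS divff //.
  by rewrite gt_eqF.
have := H _ q1; apply/negP; rewrite -ltNge.
apply: (@lt_le_trans _ _ (\sum_k (v k / s * v k - (s - M) / 2 / (d%:R + 1)))); last first.
  by apply: ler_sum => k _; exact: (Hq k).2.
rewrite big_split /= (_ : \sum_k v k / s * v k = s); last first.
  transitivity (S / s); last by rewrite -sS expr2 mulfK ?gt_eqF.
  by rewrite mulr_suml; apply: eq_bigr => k _; rewrite mulrAC expr2.
rewrite sumrN sumr_const card_ord -[X in _ < _ - X]mulr_natl.
have : d%:R * ((s - M) / 2 / (d%:R + 1)) <= (s - M) / 2.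
  rewrite mulrCA ger_pMr ?divr_gt0 ?subr_gt0 //.
  by rewrite ler_pdivrMr ?mul1r ?lerDl // ltr_wpDl.
by move: Ms; set u := d%:R * _; clearbody u; lra.
Qed.

End FiniteSums.

Section Norm.
Variables (R : realType) (F : nat -> set (c00 R)).
Variables (Xi1 Xi2 : set nat) (sigma : seq (c00 R) -> nat).
Variables (X : completeNormedModType R) (iota : {linear c00 R -> X}).
Hypothesis F_JTG : JTG F.
Hypothesis sigma_coding : is_coding F Xi2 sigma.
Hypothesis X_JT : is_JT F Xi1 sigma iota.

Notation F2 := (F2 F Xi1 sigma).
Notation atom := (atom F Xi1 sigma).
Notation basic_functional := (basic_functional F Xi1 sigma).
Notation N x := (`|iota x|).

Lemma F2_le f x : F2 f -> act f x <= N x.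
Proof.
move=> f2; rewrite -lee_fin (X_JT.1 x); apply: ereal_sup_ubound; exists f => //.
Qed.

Lemma F2_norm_le f x : F2 f -> `|act f x| <= N x.
Proof.
move=> f2; rewrite ler_norml F2_le // andbT lerNl -linearN /=.
by rewrite -[N x]normrN -linearN F2_le.
Qed.

Lemma F2_approx x d : 0 < d -> exists2 f, F2 f & N x - d < act f x.
Proof.
move=> d0; have supE := X_JT.1 x.
have lt : ((N x - d)%:E < sup_act F2 x)%E by rewrite -supE lte_fin gtrBl.
have [_ [f f2 <-] H] := ereal_sup_gt lt.
by exists f.
Qed.

Lemma atom_F2 g J : atom g J -> F2 g.
Proof.
move=> ag; right; exists 1%N, (fun=> 1), (fun=> g), (fun=> J); split.
- by rewrite big_ord1 expr1n.
- by move=> _; exact: ag.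
- by move=> i j _ _ _; rewrite !ord1.
- by rewrite big_ord1 rmorph1 scale1r.
Qed.

Lemma basic_functional_F2 g J : basic_functional g J -> F2 g.
Proof. by case=> [/atom_F2 //|[F0g _]]; left. Qed.

Lemma F_F2 j f : F j f -> F2 f.
Proof.
case: j => [|j] Fj; first by left.
apply: (@atom_F2 _ [set k | f != 0 /\ least [set j | (1 <= j)%N /\ F j f] k]).
by right; split => //; exists j.+1.
Qed.

Lemma basic_functional_le g J x : basic_functional g J -> `|act g x| <= N x.
Proof. by move=> /basic_functional_F2 /F2_norm_le; apply. Qed.

Lemma F_le j f x : F j f -> `|act f x| <= N x.
Proof. by move=> /F_F2 /F2_norm_le; apply. Qed.

Lemma coord_le (x : c00 R) n : `|x n| <= N x.
Proof.
rewrite -act_unit; apply: (@F_le 0); rewrite (JTG_F0 F_JTG).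
by exists n; left.
Qed.

Lemma N_gt0 x : x != 0 -> 0 < N x.
Proof.
move=> /neq0_supp[n xn]; apply: lt_le_trans (coord_le x n).
by rewrite normr_gt0.
Qed.

(* Disjoint index sets give a Bessel inequality, since F2 absorbs l2-combinations. *)
Lemma atoms_bessel (I : finType) (P : pred I) (g : I -> c00 R) (J : I -> set nat) x :
  (forall i, P i -> atom (g i) (J i)) ->
  (forall i j, P i -> P j -> J i `&` J j !=set0 -> i = j) ->
  \sum_(i | P i) act (g i) x ^+ 2 <= N x ^+ 2.
Proof.
move=> ag dJ; rewrite -[leLHS]/(\sum_(i in P) act (g i) x ^+ 2) big_enum_val /=.
have Pe (k : 'I_#|P|) : P (enum_val k) by have := enum_valP k.
apply: l2_le_of_rat => // a a1.
have -> : \sum_k ratr (a k) * act (g (enum_val k)) x =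
    act (\sum_k ratr (a k) *: g (enum_val k)) x.
  by rewrite act_suml; apply: eq_bigr => k _; rewrite actZl.
apply: F2_le; right; exists #|P|, a, (fun k => g (enum_val k)), (fun k => J (enum_val k)).
split => //; first by move=> k; exact: ag (Pe k).
by move=> k l _ _ /(dJ _ _ (Pe k) (Pe l)) /enum_val_inj.
Qed.

End Norm.

(** * Block sequences *)

Section Spans.
Variables (R : realType) (V : lmodType R).
Implicit Types A : set V.

Lemma lspan0 A : lspan A 0.
Proof.
by exists 0%N, (fun=> 0), (fun=> 0); split; [case|rewrite big_ord0].
Qed.

Lemma lspanD A x y : lspan A x -> lspan A y -> lspan A (x + y).
Proof.
move=> [d [a [v [vA ->]]]] [e [b [u [uA ->]]]].
exists (d + e)%N, (fun i : 'I_(d + e) => match fintype.split i with inl k => a k | inr k => b k end),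
  (fun i : 'I_(d + e) => match fintype.split i with inl k => v k | inr k => u k end); split.
  by move=> i; case: (fintype.split i).
rewrite big_split_ord /=; congr (_ + _); apply: eq_bigr => i _.
  by rewrite (unsplitK (inl i)).
by rewrite (unsplitK (inr i)).
Qed.

Lemma lspanZ A c x : lspan A x -> lspan A (c *: x).
Proof.
move=> [d [a [v [vA ->]]]]; exists d, (fun i => c * a i), v; split => //.
by rewrite scaler_sumr; apply: eq_bigr => i _; rewrite scalerA.
Qed.

Lemma lspan_gen A x : A x -> lspan A x.
Proof.
move=> Ax; exists 1%N, (fun=> 1), (fun=> x); split => //.
by rewrite big_ord1 scale1r.
Qed.

Lemma lspan_sum A (I : Type) (r : seq I) (P : pred I) (c : I -> R) (u : I -> V) :
  (forall i, P i -> lspan A (u i)) -> lspan A (\sum_(i <- r | P i) c i *: u i).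
Proof.
move=> uA; elim/big_rec: _ => [|i x Pi Ax]; first exact: lspan0.
by apply: lspanD => //; apply: lspanZ; exact: uA.
Qed.

Lemma lspan_range (w : nat -> V) x : lspan (range w) x ->
  exists d (c : nat -> R), x = \sum_(i < d) c i *: w i.
Proof.
(* Coefficients vanishing beyond d let combinations of different lengths be added termwise. *)
suff H : lspan (range w) x -> exists d (c : nat -> R), forall e, (d <= e)%N ->
    x = \sum_(i < e) c i *: w i.
  by move=> /H[d [c /(_ d (leqnn d)) ->]]; exists d, c.
move=> [n [a [v [vw ->]]]]; elim/big_ind: _ => [|y z|i _].
- by exists 0%N, (fun=> 0) => e _; rewrite big1 // => i _; rewrite scale0r.
- move=> [d [c yE]] [d' [c' zE]]; exists (maxn d d'), (fun i => c i + c' i) => e.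
  rewrite geq_max => /andP[de d'e]; rewrite (yE e) // (zE e) // -big_split /=.
  by apply: eq_bigr => i _; rewrite scalerDl.
- have [m _ <-] := vw i; exists m.+1, (fun k => if k == m then a i else 0) => e me.
  rewrite (bigD1 (Ordinal me)) //= eqxx big1 ?addr0 // => k; rewrite -val_eqE /=.
  by move=> /negbTE ->; rewrite scale0r.
Qed.

End Spans.

Lemma kernel_vector (K : fieldType) g m (A : 'M[K]_(g, m)) : (m < g)%N ->
  exists2 c : 'rV[K]_g, c != 0 & c *m A = 0.
Proof.
move=> mg; have : kermx A != 0.
  rewrite kermx_eq0 /row_free; apply: contraTneq mg => <-.
  by rewrite -leqNgt rank_leq_col.
by move=> /rowV0Pn[c /sub_kermxP cA c0]; exists c.
Qed.

Lemma half_pow_sum (R : realFieldType) d (e : R) : 0 <= e ->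
  \sum_(n < d) e / 2 ^+ n.+1 <= e.
Proof.
move=> e0; suff -> : \sum_(n < d) e / 2 ^+ n.+1 = e - e / 2 ^+ d.
  by rewrite lerBlDr lerDl divr_ge0 // exprn_ge0.
elim: d => [|d IH]; first by rewrite big_ord0 expr0 divr1 subrr.
rewrite big_ord_recr /= IH exprS; field.
by rewrite expf_neq0.
Qed.

Section Blocks.
Variable R : realType.
Implicit Types x : nat -> c00 R.

Definition above K (v : c00 R) := forall n, (n < K)%N -> v n = 0.

Lemma block_lt x m n : block_seq setT x -> (m < n)%N -> lt_supp (x m) (x n).
Proof.
move=> [x0 xlt]; elim: n => // n IH; rewrite ltnS leq_eqVlt => /predU1P[->|mn].
  exact: xlt.
have [k nk] := neq0_supp (x0 n I).
move=> i j mi nj; apply: (@ltn_trans k); first exact: (IH mn i k mi nk).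
exact: (xlt n I k j nk nj).
Qed.

Lemma block_supp_ge x n k : block_seq setT x -> x n k != 0 -> (n <= k)%N.
Proof.
move=> [x0 xlt]; elim: n k => // n IH k xk; have [m nm] := neq0_supp (x0 n I).
exact: leq_ltn_trans (IH _ nm) (xlt n I m k nm xk).
Qed.

Lemma block_shift x k : block_seq setT x -> block_seq setT (fun n => x (k + n)%N).
Proof.
move=> bx; split=> n _; first exact: bx.1.
by apply: block_lt => //; rewrite addnS.
Qed.

(** Dependent choice with a state in T handed from one vector to the next; each new vector is
    requested beyond the support of the previous one. *)
Lemma block_choice (T : Type) (Q : T -> c00 R -> T -> Prop) :
  (forall t K, exists v t', [/\ Q t v t', v != 0 & above K v]) ->
  forall t0 K, exists x t, [/\ t 0%N = t0, forall n, Q (t n) (x n) (t n.+1),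
    block_seq setT x & forall n, above K (x n)].
Proof.
move=> HQ t0 K.
have [f Hf] := @choice (T * nat) (c00 R * T)
  (fun p q => [/\ Q p.1 q.1 q.2, q.1 != 0 & above p.2 q.1])
  (fun p => let: ex_intro v (ex_intro t' H) := HQ p.1 p.2 in ex_intro _ (v, t') H).
have [bd Hbd] := @choice _ _ _ (@c00_bound R).
pose st := fix st n := if n is n'.+1 then
   let p := st n' in ((f p).2, maxn p.2 (bd (f p).1)) else (t0, K).
exists (fun n => (f (st n)).1), (fun n => (st n).1); split => //.
- by move=> n; case: (Hf (st n)).
- split=> [n _|n _ i j /= fi fj]; first by case: (Hf (st n)).
  rewrite ltnNge; apply/negP => ji; have [_ _ ab] := Hf (st n.+1).
  have : (f (st n.+1)).1 j != 0 by exact: fj.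
  rewrite ab ?eqxx //=; apply: (@leq_ltn_trans i) => //.
  rewrite ltnNge geq_max negb_and; apply/orP; right; apply/negP => /Hbd e.
  by move: fi; rewrite /supp /= e eqxx.
- move=> n j jK; have [_ _ ab] := Hf (st n); apply: ab; apply: leq_trans jK _.
  by elim: n {j} => //= n IH; rewrite leq_max IH.
Qed.

End Blocks.

(** * Consequences of condition (C) *)

Section SmallVectors.
Variables (R : realType) (F : nat -> set (c00 R)).
Variables (Xi1 Xi2 : set nat) (sigma : seq (c00 R) -> nat).
Variables (X : completeNormedModType R) (iota : {linear c00 R -> X}).
Hypothesis F_JTG : JTG F.
Hypothesis sigma_coding : is_coding F Xi2 sigma.
Hypothesis X_JT : is_JT F Xi1 sigma iota.

Notation N x := (`|iota x|).

(** Restricting f to the convex hull of the support of [x n] removes the other blocks, and the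
    restriction stays in the family or vanishes. *)
Lemma block_coef_act x i f d (c : nat -> R) n :
  block_seq setT x -> F i f -> (n < d)%N ->
  exists2 f', F i f' \/ f' = 0 & act f' (\sum_(m < d) c m *: x m) = c n * act f (x n).
Proof.
move=> bx Ff nd.
pose H := [set k | (exists2 k1, x n k1 != 0 & (k1 <= k)%N) /\
                   (exists2 k2, x n k2 != 0 & (k <= k2)%N)].
have itvH : nat_interval H.
  move=> a b [[k1 x1 l1] _] [_ [k2 x2 l2]] k /andP[ak kb].
  by split; [exists k1|exists k2] => //; lia.
exists (restr H f); first by case: (F_restr F_JTG Ff itvH); auto.
  rewrite act_restr restr_sum (bigD1 (Ordinal nd)) //= big1 ?addr0.
    rewrite restr_id ?linearZ //= => k xk.
    have xk' : (c n *: x n) k != 0 := xk.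
    have {}xk : x n k != 0 by apply: contraNN xk'; rewrite c00Z => /eqP ->; rewrite mulr0.
    by split; exists k.
  move=> m; rewrite -val_eqE /= => mn; apply: restr_eq0 => k [[k1 x1 l1] [k2 x2 l2]].
  rewrite c00Z; have [->|xm] := eqVneq (x m k) 0; first by rewrite mulr0.
  have [mn'|nm|e] := ltngtP m n; last by rewrite e eqxx in mn.
  - by have := block_lt bx mn' xm x1; rewrite ltnNge l1.
  - by have := block_lt bx nm x2 xm; rewrite ltnNge l2.
Qed.

Lemma block_coef x i f d (c : nat -> R) n : block_seq setT x -> F i f ->
  1 <= act f (x n) -> (n < d)%N -> `|c n| <= N (\sum_(m < d) c m *: x m).
Proof.
move=> bx Ff f1 nd; have [f' Ff' f'E] := block_coef_act c bx Ff nd.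
apply: (@le_trans _ _ `|c n * act f (x n)|).
  by rewrite normrM ler_peMr // (le_trans f1) ?ler_norm.
rewrite -f'E; case: Ff' => [/(F_le X_JT)|->]; first exact.
by rewrite act0l normr0.
Qed.

(** Induction on j, because (C) handles one family only. Blocks that are small on the families below
    j, at a summable rate, are combined by (C) into a vector small on [F j]; after normalisation the
    coefficients are at most 2, so the smallness on the lower families survives. *)
Lemma small_vectors j w d K : block_seq setT w -> 0 < d ->
  exists v, [/\ lspan (range w) v, exists i f, F i f /\ 1 <= act f v,
    forall i, (i < j)%N -> forall f, F i f -> `|act f v| <= d & above K v].
Proof.
elim: j w d K => [|j IH] w d K bw d0.
  have [m wm] := neq0_supp (bw.1 K I).
  exists ((w K m)^-1 *: w K); split => //.
  - by apply: lspanZ; apply: lspan_gen; exists K.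
  - exists 0%N, (unit_vec R m); rewrite (JTG_F0 F_JTG); split; first by exists m; left.
    by rewrite act_unit c00Z mulVf.
  - move=> n nK; rewrite c00Z; have [->|/(block_supp_ge bw)] := eqVneq (w K n) 0.
      by rewrite mulr0.
    by rewrite leqNgt nK.
(* The state is just a counter, which sets the precision of the n-th block. *)
have [] := @block_choice R nat (fun n v n' => [/\ n' = n.+1, lspan (range w) v,
   exists i f, F i f /\ 1 <= act f v &
   forall i, (i < j)%N -> forall f, F i f -> `|act f v| <= (d / 2) / 2 ^+ n.+1])
   _ 0%N K.
  move=> n K'.
  have dn : 0 < d / 2 / 2 ^+ n.+1 by rewrite !divr_gt0 // exprn_gt0.
  have [v [v1 [i [f [Ff fv]]] v3 v4]] := IH w _ K' bw dn.
  exists v, n.+1; split => //; first by split => //; exists i, f.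
  by apply/eqP => ve; move: fv; rewrite ve linear0 ler10.
move=> x [t [t0 Qx bx abx]].
have tn n : t n = n by elim: n => // n IHn; have [-> _ _ _] := Qx n; rewrite IHn.
have d2 : 0 < d / 2 by rewrite divr_gt0.
have [v vx vlt] := JTG_span F_JTG bx j d2.
pose U := sup_act (\bigcup_i F i) v.
have UN : (U <= (N v)%:E)%E.
  apply: ge_ereal_sup => _ [f [i _ Fi] <-]; rewrite lee_fin.
  by apply: le_trans (ler_norm _) _; exact: (F_le X_JT _ Fi).
have Fle i f : F i f -> ((act f v)%:E <= sup_act (F i) v)%E.
  by move=> Ff; apply: ereal_sup_ubound; exists f.
have Ule i f : F i f -> (`|act f v|%:E <= U)%E.
  move=> Ff; case: (ger0P (act f v)) => _.
    by apply: ereal_sup_ubound; exists f => //; exists i.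
  rewrite -actNl; apply: ereal_sup_ubound; exists (- f) => //; exists i => //.
  exact: F_posN.
have [f0 Ff0] : exists f, F j f.
  case: (j) => [|k]; last by have [f] := JTG_neq0 F_JTG (ltn0Sn k); exists f.
  by exists (unit_vec R 0); rewrite (JTG_F0 F_JTG); exists 0%N; left.
have U0 : (0 <= U)%E by apply: le_trans (Ule _ _ Ff0); rewrite lee_fin.
have Ufin : U \is a fin_num by rewrite ge0_fin_numE // (le_lt_trans UN) ?ltry.
have [u uE] : exists u, U = u%:E by exists (fine U); rewrite fineK.
have Fj f : F j f -> `|act f v| < d / 2 * u.
  move=> Ff; rewrite -lte_fin EFinM -uE; apply: le_lt_trans vlt.
  case: (ger0P (act f v)) => _; first exact: Fle.
  by rewrite -actNl; apply: Fle; exact: F_posN.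
(* The strict inequality of (C) excludes u = 0. *)
have u0 : 0 < u.
  by have := le_lt_trans (normr_ge0 _) (Fj _ Ff0); rewrite pmulr_rgt0.
have {}Ule i f : F i f -> `|act f v| <= u by move=> /Ule; rewrite uE lee_fin.
have u2 : 0 < 2 / u by rewrite divr_gt0.
(* The supremum over all families becomes 2, leaving room for a functional with value at least 1,
   while the bound [d / 2 * u] on [F j] becomes d. *)
exists ((2 / u) *: v).
have vw : lspan (range w) v.
  have [e [c ->]] := lspan_range vx; apply: lspan_sum => n _.
  by have [] := Qx n.
split.
- exact: lspanZ.
- have lt : ((u / 2)%:E < U)%E by rewrite uE lte_fin ltr_pdivrMr // ltr_pMr // ltrDl.
  have [_ [f [i _ Ff] <-]] := ereal_sup_gt lt; rewrite lte_fin => fu.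
  exists i, f; split => //; rewrite linearZ /= mulrAC ler_pdivlMr // mul1r.
  by rewrite mulrC -ler_pdivrMr // ltW.
- move=> i; rewrite ltnS leq_eqVlt => /predU1P[->|ij] f Ff.
    rewrite linearZ /= normrM gtr0_norm // mulrAC ler_pdivrMr //.
    by rewrite mulrC -ler_pdivlMr // mulrAC ltW // Fj.
  have [e [c vE]] := lspan_range vx.
  have cb n : (n < e)%N -> `|2 / u * c n| <= 2.
    move=> ne; have [_ _ [i' [f' [Ff' f1]]] _] := Qx n.
    have [f'' Ff'' f''E] := block_coef_act c bx Ff' ne; rewrite -vE in f''E.
    have cu : `|c n| <= u.
      apply: (@le_trans _ _ `|c n * act f' (x n)|).
        by rewrite normrM ler_peMr // (le_trans f1) ?ler_norm.
      by rewrite -f''E; case: Ff'' => [/Ule//|->]; rewrite act0l normr0 ltW.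
    by rewrite normrM gtr0_norm // mulrAC ler_pdivrMr // ler_wpM2l.
  rewrite vE scaler_sumr linear_sum /=; apply: le_trans (ler_norm_sum _ _ _) _.
  apply: (@le_trans _ _ (\sum_(n < e) d / 2 ^+ n.+1)); last by apply: half_pow_sum; exact: ltW.
  apply: ler_sum => n _; rewrite scalerA linearZ /= normrM.
  have [_ _ _ /(_ i ij f Ff)] := Qx n; rewrite tn => H.
  apply: le_trans (ler_pM _ _ (cb _ (ltn_ord n)) H) _ => //.
  by rewrite mulrA mulrCA divff ?mulr1.
- have [e [c ->]] := lspan_range vx => k kK; rewrite c00Z c00_sum big1 ?mulr0 // => n _.
  by rewrite c00Z abx // mulr0.
Qed.
End SmallVectors.

(** * Concentration on a window of indices *)

Section Concentration.
Variables (R : realType) (F : nat -> set (c00 R)).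
Variables (Xi1 Xi2 : set nat) (sigma : seq (c00 R) -> nat).
Variables (X : completeNormedModType R) (iota : {linear c00 R -> X}).
Hypothesis F_JTG : JTG F.
Hypothesis sigma_coding : is_coding F Xi2 sigma.
Hypothesis X_JT : is_JT F Xi1 sigma iota.

Notation N x := (`|iota x|).

(* No functional acts on [v], up to [d], through parts with indices outside of [[a, c)]. *)
Definition concentrated (v : c00 R) a c (d : R) := forall h, selection F h ->
  forall B, \sum_(0 <= j < B | ~~ (a <= j < c)%N) `|act (h j) v| <= d.

(** Below the window at most a parts contribute, each at most d; beyond it the tail bound
    applies. *)
Lemma concentratedI (v : c00 R) a c d d' : (a <= c)%N ->
  (forall i f, (i < a)%N -> F i f -> `|act f v| <= d) -> 0 <= d ->
  (forall h, selection F h -> forall B, \sum_(c <= j < B) `|act (h j) v| <= d') ->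
  concentrated v a c (d *+ a + d').
Proof.
move=> ac small d0 tail h hh B.
apply: (@le_trans _ _ (\sum_(0 <= j < maxn B c | ~~ (a <= j < c)%N) `|act (h j) v|)).
  rewrite [leRHS](@big_cat_nat _ _ _ B) ?leq_maxl //= lerDl.
  by apply: sumr_ge0.
rewrite (@big_cat_nat _ _ _ c) ?leq_maxr //= (@big_cat_nat _ _ _ a _ c) //=.
rewrite [X in _ + X + _]big_nat_cond [X in _ + X + _]big1 ?addr0; last first.
  by move=> j /andP[->].
apply: lerD.
  apply: (@le_trans _ _ (\sum_(0 <= j < a) d)); last by rewrite sumr_const_nat subn0.
  rewrite big_nat_cond [leRHS]big_nat_cond big_mkcond [leRHS]big_mkcond /=.
  apply: ler_sum => j _; rewrite andbT; case: ifP => [/andP[ja _]|_].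
    rewrite ja; case: (hh j) => [|->]; first by apply: small.
    by rewrite act0l normr0.
  by case: ifP.
apply: le_trans (tail h hh (maxn B c)).
by rewrite big_mkcond /=; apply: ler_sum => j _; case: ifP.
Qed.

Lemma concentrated_sum n (c : 'I_n -> R) (x : 'I_n -> c00 R) (a' b' : 'I_n -> nat) a b d :
  (forall i, `|c i| <= 1) -> (forall i, concentrated (x i) (a' i) (b' i) d) ->
  (forall i, (a <= a' i)%N /\ (b' i <= b)%N) ->
  concentrated (\sum_i c i *: x i) a b (d *+ n).
Proof.
move=> c1 cx ab h hh B.
apply: (@le_trans _ _ (\sum_(i < n) \sum_(0 <= j < B | ~~ (a <= j < b)%N) `|act (h j) (x i)|)).
  rewrite exchange_big /=; apply: ler_sum => j _; rewrite linear_sum /=.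
  apply: le_trans (ler_norm_sum _ _ _) _; apply: ler_sum => i _.
  by rewrite linearZ /= normrM ler_piMl.
rewrite -[X in d *+ X]card_ord -sumr_const; apply: ler_sum => i _.
apply: le_trans (cx i h hh B); rewrite big_mkcond [leRHS]big_mkcond /=.
apply: ler_sum => j _; have [aa bb] := ab i.
case: ifP => [out|_]; last by case: ifP.
rewrite ifT //; apply: contraNN out => /andP[aj jb].
by rewrite (leq_trans aa aj) (leq_trans jb bb).
Qed.

Lemma concentrated_act v a c d g J h : concentrated v a c d -> parts F g J h -> (a <= c)%N ->
  `|act g v - act (\sum_(a <= j < c) h j) v| <= d.
Proof.
move=> cv ph ac; have hh := parts_selection ph; have [_ _ [b [_ Hb]]] := ph.
rewrite (Hb (maxn b c)) ?leq_maxl // -(@sum_piece_trunc _ h a c (maxn b c)) ?leq_maxr //.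
rewrite !act_suml -sumrB; apply: le_trans (ler_norm_sum _ _ _) _.
apply: le_trans (cv h hh (maxn b c)); rewrite [leRHS]big_mkcond /=.
apply: ler_sum => j _; case: ifP => _; first by rewrite subrr normr0.
by rewrite act0l subr0.
Qed.

Lemma concentrated_sub v a c d h : concentrated v a c d -> selection F h ->
  forall a' c', (c <= a')%N \/ (c' <= a)%N -> `|act (\sum_(a' <= j < c') h j) v| <= d.
Proof.
move=> cv hh a' c' out; rewrite -(@sum_piece_trunc _ h a' c' c') // act_suml.
apply: le_trans (ler_norm_sum _ _ _) _; apply: le_trans (cv h hh c').
rewrite [leRHS]big_mkcond /= big_nat [leRHS]big_nat; apply: ler_sum => j /andP[_ jc].
case: ifP => [/andP[aj _]|_]; last by rewrite act0l normr0; case: ifP.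
by rewrite ifT //; case: out => out; apply/negP; lia.
Qed.

(** The left end a of a window is fixed before its vector: [small_vectors] takes care of the
    families below a, and [tail_act] then supplies the right end, from which the next window
    starts. *)
Lemma concentrated_blocks w (d : R) : block_seq setT w -> 0 < d ->
  exists x b, [/\ block_seq setT x, b 0%N = 1%N,
    forall n, lspan (range w) (x n),
    forall n, (b n < b n.+1)%N /\ concentrated (x n) (b n) (b n.+1) d &
    forall n, exists i f, F i f /\ 1 <= act f (x n)].
Proof.
move=> bw d0.
(* The state is the left end of the window. Starting from 1 keeps index 0, that of [F 0], out of
   every window. *)
have [] := @block_choice R nat (fun a v c => [/\ lspan (range w) v,
   (a < c)%N /\ concentrated v a c d & exists i f, F i f /\ 1 <= act f v]) _ 1%N 0%N.
  move=> a K.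
  (* The a families below the window share the error d / 2; the successor avoids a division by 0. *)
  have d1 : 0 < d / 2 / a.+1%:R by rewrite !divr_gt0.
  have [v [v1 [i [f [Ff fv]]] v3 v4]] := small_vectors F_JTG X_JT a K bw d1.
  have d2 : 0 < d / 2 by rewrite divr_gt0.
  have [c Hc] := tail_act F_JTG v d2.
  exists v, (maxn a.+1 c); split => //; last first.
    by apply/eqP => ve; move: fv; rewrite ve linear0 ler10.
  split => //; last by exists i, f.
  split; first by rewrite leq_max leqnn.
  have := @concentratedI v a (maxn a.+1 c) (d / 2 / a.+1%:R) (d / 2).
  move=> /(_ _ _ _ _) H h hh B; apply: (le_trans (H _ _ _ _ h hh B)).
  - by rewrite leq_max leqnSn.
  - by move=> k g ka; exact: v3.
  - exact: ltW.
  - move=> h' hh' B'; apply: le_trans (Hc h' hh' B').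
    have [Bc|cB] := leqP B' (maxn a.+1 c); first by rewrite big_geq // sumr_ge0.
    rewrite [leRHS](@big_cat_nat _ _ _ (maxn a.+1 c)) ?leq_maxr //=; last exact: ltnW.
    by rewrite lerDr sumr_ge0.
  - rewrite [leRHS](splitr d) lerD2r -[X in X <= _]mulr_natr mulrAC ler_pdivrMr //.
    by rewrite ler_wpM2l ?(ltW d2) // ler_nat.
move=> x [b [b0 Qx bx _]]; exists x, b; split => //.
- by move=> n; case: (Qx n).
- by move=> n; case: (Qx n).
- by move=> n; case: (Qx n).
Qed.

End Concentration.

(** * Vectors on which basic functionals are small *)

(** A sequence without related pairs is extended as long as possible. It cannot reach length r, so
    it stops at one that covers everything. C is read from earlier to later elements, as it is not
    assumed symmetric. *)
Lemma greedy_cover (T : Type) (t0 : T) (P : T -> Prop) (C : T -> T -> Prop) r :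
  (forall u : nat -> T, (forall i, (i < r)%N -> P (u i)) ->
     (forall i j, (i < j < r)%N -> ~ C (u i) (u j)) -> False) ->
  exists n (u : nat -> T), [/\ (n <= r)%N, forall i, (i < n)%N -> P (u i) &
    forall t, P t -> exists2 i, (i < n)%N & C (u i) t].
Proof.
move=> H; apply: contrapT => K.
suff [u [uP uC]] : exists u : nat -> T, (forall i, (i < r)%N -> P (u i)) /\
     (forall i j, (i < j < r)%N -> ~ C (u i) (u j)) by exact: (H u).
have : (r <= r)%N by [].
elim: {-2}r => [_|n IH nr]; first by exists (fun=> t0); split => // i j; rewrite ltn0 andbF.
have [u [uP uC]] := IH (ltnW nr).
have [t [Pt Ct]] : exists t, P t /\ forall i, (i < n)%N -> ~ C (u i) t.
  apply: contrapT => L; apply: K; exists n, u; split => //; first exact: ltnW.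
  move=> t Pt; apply: contrapT => M; apply: L; exists t; split => // i ni Ci.
  by apply: M; exists i.
exists (fun i => if i == n then t else u i); split.
  by move=> i; rewrite ltnS leq_eqVlt; case: eqP => //= _; exact: uP.
move=> i j /andP[ij]; rewrite ltnS leq_eqVlt => jn.
have -> : (i == n) = false by apply/eqP; lia.
by move: jn; case: eqP => [jn _|_ /= jn]; [apply: Ct; lia|apply: uC; rewrite ij].
Qed.

(** No large entry lies strictly between two large ones, so there are at most two of them. *)
Lemma sum_two_big (R : realType) q (v : 'I_q -> R) (th : R) : 0 <= th ->
  (forall i, `|v i| <= 1) ->
  (forall i j k : 'I_q, (i < j < k)%N -> th < `|v i| -> th < `|v k| -> `|v j| <= th) ->
  `|\sum_i v i| <= 2 + q%:R * th.
Proof.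
move=> th0 v1 vm; apply: le_trans (ler_norm_sum _ _ _) _.
pose S := [set i : 'I_q | th < `|v i|]%SET.
apply: (@le_trans _ _ (\sum_i ((i \in S)%:R + th))).
  apply: ler_sum => i _; rewrite inE; case: ltP => //= h; last by rewrite add0r.
  by apply: le_trans (v1 i) _; rewrite lerDl.
rewrite big_split /= sumr_const card_ord mulr_natl lerD2r.
rewrite -natr_sum -big_mkcond /= sum1_card ler_nat.
have [->|/set0Pn[i0 i0S]] := eqVneq S finset.set0; first by rewrite cards0.
have [lo loS lomin] := @arg_minnP _ i0 (mem S) (fun i => i : nat) i0S.
have [hi hiS himax] := @arg_maxnP _ i0 (mem S) (fun i => i : nat) i0S.
apply: (@leq_trans #|[set lo; hi]%SET|); last by rewrite cards2; case: (_ != _).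
apply: subset_leq_card; apply/fintype.subsetP => i iS; rewrite !inE.
apply: contraT; rewrite negb_or -!val_eqE /= => /andP[il ih].
have lohi : (lo < i < hi)%N.
  have h1 : (lo <= i)%N := lomin i iS; have h2 : (i <= hi)%N := himax i iS.
  by rewrite !ltn_neqAle eq_sym il h1 ih.
have SP k : k \in S -> th < `|v k| by rewrite inE.
by have := vm _ _ _ lohi (SP _ loS) (SP _ hiS); rewrite leNgt (SP _ iS).
Qed.

Section Pasts.
Variables (R : realType) (F : nat -> set (c00 R)).
Variables (Xi1 Xi2 : set nat) (sigma : seq (c00 R) -> nat).
Variables (X : completeNormedModType R) (iota : {linear c00 R -> X}).
Hypothesis F_JTG : JTG F.
Hypothesis sigma_coding : is_coding F Xi2 sigma.
Hypothesis X_JT : is_JT F Xi1 sigma iota.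

Notation atom := (atom F Xi1 sigma).
Notation special := (special F Xi1 sigma).
Notation N x := (`|iota x|).

(** The past depends on the chosen sequence and not on the functional alone, so the greedy choice
    ranges over representations. *)
Record representation := Representation {
  sI : set nat; ss : nat -> c00 R; sE : set nat; sg : c00 R; sJ : set nat }.

Definition is_representation t := [/\ special (sI t) (ss t), nat_interval (sE t),
  finite_set (sE t),
  (sg t : nat -> R) = cut_fun (sE t) (fun n => \sum_(i \in sI t) ss t i n) &
  sJ t = \bigcup_(i in [set i | sI t i /\ restr (sE t) (ss t i) != 0])
    seq_ind F sigma (ss t) i].

Notation spast t a := (past F sigma (sI t) (ss t) a).
Notation spart t := (fun j => restr (sE t) (piece F sigma (sI t) (ss t) j)).

Lemma representation_parts t : is_representation t -> parts F (sg t) (sJ t) (spart t).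
Proof. by case=> sp i f g j; exact: (special_parts F_JTG sigma_coding sp i f g j). Qed.

Lemma representation_trunc t : is_representation t ->
  trunc_parts F Xi1 sigma (spart t) (sJ t).
Proof. by case=> sp i f g j; exact: (special_trunc F_JTG sigma_coding sp i f j). Qed.

Lemma representation_ind t j : is_representation t -> sJ t j -> exists2 i, sI t i & j = sindex F sigma (ss t) i.
Proof.
case=> sp _ _ _ -> [i [/= Ii _]]; rewrite (seq_indE sp) // => ->; by exists i.
Qed.

(* A maximal family acting on v with index sets disjoint inside the window is
   finite by Bessel; any other functional shares an index, hence the past, with
   one of the family. *)
Lemma finitely_many_pasts v a c (th : R) r : (a <= c)%N -> 0 < th -> N v <= 1 ->
  concentrated F v a c (th / 2) -> 4 < r%:R * th ^+ 2 ->
  exists l : seq (c00 R), (size l <= r)%N /\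
    forall t, is_representation t -> th < `|act (sg t) v| ->
      spast t a = 0 \/ spast t a \in l.
Proof.
move=> ac th0 v1 cv r4.
(* Only heads of index below a are considered: beyond that the past is 0. *)
pose P t := [/\ is_representation t, th < `|act (sg t) v| & (sindex F sigma (ss t) 0 < a)%N].
pose C t t' := sJ t `&` sJ t' `&` [set j | (a <= j < c)%N] !=set0.
pose t0 := Representation set0 (fun=> 0) set0 0 set0.
have [u uP uC|n [u [nr uP uC]]] := @greedy_cover representation t0 P C r.
  pose g i := \sum_(a <= j < c) spart (u i) j.
  have gat (i : 'I_r) : true -> atom (g i) (sJ (u i) `&` [set j | (a <= j < c)%N]).
    by move=> _; have [ok _ _] := uP i (ltn_ord i); exact: representation_trunc.
  have dis (i j : 'I_r) : true -> true ->
      (sJ (u i) `&` [set j | (a <= j < c)%N]) `&` (sJ (u j) `&` [set j | (a <= j < c)%N]) !=set0 -> i = j.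
    move=> _ _ [k [[k1 k2] [k3 _]]]; apply/val_inj/eqP => /=; case: ltngtP => // ij.
      by case: (uC i j) => //; [rewrite ij /=|exists k].
    by case: (uC j i) => //; [rewrite ij /=|exists k].
  have := atoms_bessel X_JT v gat dis; apply/negP; rewrite -ltNge.
  apply: (@le_lt_trans _ _ 1); first by rewrite expr_le1.
  (* Passing to the window part loses at most th / 2 of a value above th, so r disjoint functionals
     would give a sum of squares of at least r th^2 / 4 > 1. *)
  apply: (@lt_le_trans _ _ (\sum_(i < r) (th / 2) ^+ 2)).
    rewrite sumr_const card_ord -[ltRHS]mulr_natl.
    have -> : r%:R * (th / 2) ^+ 2 = r%:R * th ^+ 2 / 4 by field.
    by rewrite ltr_pdivlMr // mul1r.
  apply: ler_sum => i _; rewrite -[leRHS]real_normK ?num_real // lerXn2r ?nnegrE //.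
    by rewrite divr_ge0 // ltW.
  have [ok big _] := uP i (ltn_ord i).
  have := concentrated_act cv (representation_parts ok) ac; rewrite -/(g i) => H.
  have := ler_dist_dist (act (sg (u i)) v) (act (g i) v).
  move=> /le_trans /(_ H); rewrite ler_norml => /andP[_]; move: big.
  by set y := `|act (sg _) v|; set z := `|act (g i) v|; clearbody y z; lra.
exists (mkseq (fun i => spast (u i) a) n); split; first by rewrite size_mkseq.
move=> t ok big; have [ha|ah] := ltnP (sindex F sigma (ss t) 0) a; last first.
  by left; case: ok => sp *; exact: (past_head sigma_coding sp).
right; have [i ni [j [[ij tj] /andP[aj _]]]] := uC t (And3 ok big ha).
have [oki _ hi] := uP i ni.
have [m Im jm] := representation_ind oki ij; have [m' Im' jm'] := representation_ind ok tj.
apply/mapP; exists i; rewrite ?mem_iota //.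
case: (ok) (oki) => sp _ _ _ _ [sp' _ _ _ _].
by apply: (past_eq sigma_coding sp sp' Im' Im); rewrite -?jm -?jm'.
Qed.

End Pasts.

(** * Group vectors annihilated by pasts *)

Section GroupVectors.
Variables (R : realType) (F : nat -> set (c00 R)).
Variables (Xi1 Xi2 : set nat) (sigma : seq (c00 R) -> nat).
Variables (X : completeNormedModType R) (iota : {linear c00 R -> X}).
Hypothesis F_JTG : JTG F.
Hypothesis sigma_coding : is_coding F Xi2 sigma.
Hypothesis X_JT : is_JT F Xi1 sigma iota.

Notation N x := (`|iota x|).
Notation spast t a := (past F sigma (sI t) (ss t) a).
Notation spart t := (fun j => restr (sE t) (piece F sigma (sI t) (ss t) j)).
Notation is_representation := (is_representation F Xi1 sigma).

Section Groups.
Variables (w x : nat -> c00 R) (b : nat -> nat) (d : R) (gsize : nat).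
Hypothesis block_x : block_seq setT x.
Hypothesis x_span : forall n, lspan (range w) (x n).
Hypothesis x_conc : forall n, (b n < b n.+1)%N /\ concentrated F (x n) (b n) (b n.+1) d.
Hypothesis x_large : forall n, exists i f, F i f /\ 1 <= act f (x n).

Definition combination i z := exists c : nat -> R, z = \sum_(m < gsize) c m *: x (i * gsize + m)%N.

Definition group_vector i z := [/\ lspan (range w) z, N z = 1,
  concentrated F z (b (i * gsize)) (b (i.+1 * gsize)) (d *+ gsize) & combination i z].

Lemma b_mono m n : (m <= n)%N -> (b m <= b n)%N.
Proof.
apply: (homo_leq (f := b) (r := leq)) => // [? ? ?|k]; first exact: leq_trans.
by apply: ltnW; case: (x_conc k).
Qed.

Lemma group_vector_lt_supp i j z z' : (i < j)%N -> combination i z -> combination j z' ->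
  lt_supp z z'.
Proof.
move=> ij [c ->] [c' ->] k l.
have H (e : nat -> R) (i' : nat) n : supp (\sum_(m < gsize) e m *: x (i' * gsize + m)%N) n ->
    exists2 m, (m < gsize)%N & x (i' * gsize + m)%N n != 0.
  rewrite /supp /=; apply: contraPP => K; apply/negP; rewrite negbK c00_sum big1 // => m _.
  rewrite c00Z; have [->|xm] := eqVneq (x (i' * gsize + m)%N n) 0; first by rewrite mulr0.
  by case: K; exists m.
move=> /H[m mg xm] /H[m' mg' xm']; apply: (block_lt block_x _ xm xm').
apply: (@leq_trans (i.+1 * gsize)); first by rewrite mulSn addnC ltn_add2r.
by apply: leq_trans (leq_addr _ _); rewrite leq_mul2r ij orbT.
Qed.

(** There are more vectors than conditions. Coefficients are bounded by the norm of the combination,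
    so after normalisation they are at most 1 and the [gsize] errors d just add up. *)
Lemma group_vector_annihilating i (l : seq (c00 R)) : (size l < gsize)%N ->
  exists z, group_vector i z /\ forall f, f \in l -> act f z = 0.
Proof.
move=> lg; pose y m := x (i * gsize + m)%N.
pose A := \matrix_(m < gsize, k < size l) act l`_k (y m).
have [c c0 cA] := kernel_vector A lg.
pose e m := if insub m is Some j then c 0 j else 0.
have eE (m : 'I_gsize) : e m = c 0 m by rewrite /e valK.
pose V := \sum_(m < gsize) e m *: y m.
have by_ : block_seq setT y by exact: block_shift.
have eN m : (m < gsize)%N -> `|e m| <= N V.
  move=> mg; have [k [f [Ff f1]]] := x_large (i * gsize + m).
  exact: (block_coef F_JTG X_JT e by_ Ff f1 mg).
have V0 : 0 < N V.
  rewrite lt_neqAle normr_ge0 andbT; apply/eqP => V0.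
  case/eqP: c0; apply/rowP => m; rewrite mxE -eE; apply/eqP.
  by rewrite -normr_le0 (le_trans (eN m _)) // -V0.
exists ((N V)^-1 *: V); split; last first.
  move=> f fl; rewrite linearZ /= (_ : act f V = 0) ?mulr0 //.
  have kl : (index f l < size l)%N by rewrite index_mem.
  have := congr1 (fun M : 'rV_(size l) => M 0 (Ordinal kl)) cA.
  rewrite !mxE => cA0; rewrite -[RHS]cA0 linear_sum; apply: eq_bigr => m _.
  by rewrite linearZ /= mxE /= nth_index // eE.
split.
- by apply: lspanZ; apply: lspan_sum => m _; exact: x_span.
- by rewrite linearZ normrZ normfV normr_id mulVf // gt_eqF.
- rewrite scaler_sumr; under eq_bigr do rewrite scalerA.
  apply: (@concentrated_sum _ F gsize (fun m => (N V)^-1 * e m) (fun m => y m)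
    (fun m => b (i * gsize + m)) (fun m => b (i * gsize + m).+1)).
  + move=> m; rewrite normrM normfV normr_id mulrC ler_pdivrMr // mul1r.
    exact: eN.
  + by move=> m; case: (x_conc (i * gsize + m)).
  + move=> m; split; apply: b_mono; first exact: leq_addr.
    by rewrite mulSn addnC ltn_add2r.
- exists (fun m => (N V)^-1 * e m); rewrite scaler_sumr; apply: eq_bigr => m _.
  by rewrite scalerA.
Qed.

Variables (th : R) (r q : nat).
Hypothesis th_gt0 : 0 < th.
Hypothesis dth : d *+ gsize <= th / 2.
Hypothesis r_large : 4 < r%:R * th ^+ 2.
Hypothesis gsize_large : (q * r < gsize)%N.

Lemma b_group i j : (i <= j)%N -> (b (i * gsize) <= b (j * gsize))%N.
Proof. by move=> ij; apply: b_mono; rewrite leq_mul2r ij orbT. Qed.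

Lemma concentrated_le (v : c00 R) a c (e e' : R) : e <= e' -> concentrated F v a c e -> concentrated F v a c e'.
Proof. by move=> ee cv h hh B; apply: le_trans (cv h hh B) ee. Qed.

Lemma backward_groups : exists z : nat -> c00 R, forall i, (i < q)%N ->
  group_vector i (z i) /\ forall j t, (i < j < q)%N -> is_representation t ->
    th < `|act (sg t) (z j)| -> act (spast t (b (j * gsize))) (z i) = 0.
Proof.
(* Here k counts the groups treated so far, from the last one down, and l collects their pasts, at
   most r for each group; [q * r < gsize] keeps the dimension count valid to the end. *)
suff H k : (k <= q)%N -> exists (z : nat -> c00 R) (l : seq (c00 R)), (size l <= k * r)%N /\
    forall i, (q - k <= i < q)%N -> [/\ group_vector i (z i),
      forall t, is_representation t -> th < `|act (sg t) (z i)| ->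
        spast t (b (i * gsize)) = 0 \/ spast t (b (i * gsize)) \in l &
      forall j t, (i < j < q)%N -> is_representation t ->
        th < `|act (sg t) (z j)| -> act (spast t (b (j * gsize))) (z i) = 0].
  have [z [l [_ zP]]] := H q (leqnn q); exists z => i iq.
  by have [] := zP i; rewrite ?subnn.
elim: k => [_|k IH kq].
  by exists (fun=> 0), [::]; split => // i; rewrite subn0; lia.
have [z [l [sl zP]]] := IH (ltnW kq).
have lg : (size l < gsize)%N.
  apply: leq_ltn_trans gsize_large; apply: leq_trans sl _.
  by rewrite leq_mul2r (ltnW kq) orbT.
pose i0 := (q - k.+1)%N.
have [z0 [[z0s z0N z0c z0x] z0k]] := group_vector_annihilating i0 lg.
have z01 : N z0 <= 1 by rewrite z0N.
have [l0 [sl0 l0P]] := finitely_many_pasts F_JTG sigma_coding X_JT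
  (b_group (leqnSn i0)) th_gt0 z01 (concentrated_le dth z0c) r_large.
exists (fun i => if i == i0 then z0 else z i), (l0 ++ l); split.
  by rewrite size_cat mulSn leq_add.
move=> i /andP[]; rewrite -/i0 leq_eqVlt => /predU1P[<- _|i0i iq].
  rewrite eqxx; split => //.
    by move=> t /l0P{}l0P /l0P[->|tl]; [left|right; rewrite mem_cat tl].
  move=> j t /andP[ij jq] ok; rewrite gtn_eqF // => big.
  have [|_ + _] := zP j; first by rewrite jq andbT /i0 in ij *; lia.
  by move=> /(_ t ok big)[->|/z0k//]; rewrite act0l.
rewrite gtn_eqF //; have [|gi li ki] := zP i; first by rewrite iq andbT; rewrite /i0 in i0i; lia.
split => //.
  by move=> t /li{}li /li[->|tl]; [left|right; rewrite mem_cat tl orbT].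
move=> j t /andP[ij jq]; rewrite gtn_eqF ?(ltn_trans i0i ij) //.
by apply: ki; rewrite ij.
Qed.

(** The interval of t meets the supports of [z i] and [z k], hence contains that of [z j]. So the
    parts of index below the window of [z k] act on [z j] as the uncut past, that is by 0, and the
    others have indices beyond the window of [z j]. *)
Lemma middle_small z i j k t : (i < j)%N -> (j < k)%N -> is_representation t ->
  group_vector i (z i) -> group_vector j (z j) -> group_vector k (z k) ->
  act (sg t) (z i) != 0 -> act (sg t) (z k) != 0 ->
  act (spast t (b (k * gsize))) (z j) = 0 ->
  `|act (sg t) (z j)| <= d *+ gsize.
Proof.
move=> ij jk ok [_ _ _ ci] [_ _ cz cj] [_ _ _ ck] gi gk pk.
have [_ itvE finE gE _] := ok.
have meet v : act (sg t) v != 0 -> exists2 n, v n != 0 & sE t n.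
  apply: contraNP => K; apply/eqP; rewrite /act fsbig1 // => n _.
  have [->|vn] := eqVneq (v n) 0; first by rewrite mulr0.
  rewrite gE /cut_fun; case: ifPn; rewrite ?mul0r // inE => En.
  by case: K; exists n.
have [n1 z1 E1] := meet _ gi; have [n2 z2 E2] := meet _ gk.
have zE : supp (z j) `<=` sE t.
  move=> n zn; apply: (itvE _ _ E1 E2); apply/andP; split; apply: ltnW.
    exact: (group_vector_lt_supp ij ci cj z1 zn).
  exact: (group_vector_lt_supp jk cj ck zn z2).
have pt := representation_parts F_JTG sigma_coding ok.
have hh := parts_selection pt; have [_ _ [B [_ HB]]] := pt.
rewrite (HB (maxn B (b (k * gsize)))) ?leq_maxl // (@big_cat_nat _ _ _ (b (k * gsize))) ?leq_maxr //=.
rewrite actC linearD /= -!(actC _ (z j)).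
have -> : act (\sum_(0 <= n < b (k * gsize)) spart t n) (z j) = 0.
  by rewrite -restr_sum act_restr restr_id.
rewrite add0r; apply: (concentrated_sub cz hh); left; exact: b_group.
Qed.

End Groups.
End GroupVectors.

Section SmallOnBasicFunctionals.
Variables (R : realType) (F : nat -> set (c00 R)).
Variables (Xi1 Xi2 : set nat) (sigma : seq (c00 R) -> nat).
Variables (X : completeNormedModType R) (iota : {linear c00 R -> X}).
Hypothesis F_JTG : JTG F.
Hypothesis sigma_coding : is_coding F Xi2 sigma.
Hypothesis X_JT : is_JT F Xi1 sigma iota.

Notation atom := (atom F Xi1 sigma).
Notation basic_functional := (basic_functional F Xi1 sigma).
Notation N x := (`|iota x|).
Notation is_representation := (is_representation F Xi1 sigma).

Lemma concentrated_single v a c (D : R) j f : concentrated F v a c D -> (a <= c)%N -> F j f ->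
  ~~ (a <= j < c)%N -> `|act f v| <= D.
Proof.
move=> cv ac Ff out; have := concentrated_act cv (singleton_parts Ff) ac.
rewrite (_ : \sum_(a <= k < c) _ = 0) ?act0l ?subr0 // big_nat big1 // => k kac.
by case: eqP => // kj; rewrite -kj kac in out.
Qed.

Lemma exists_small_vector w (eps : R) : block_seq setT w -> 0 < eps ->
  exists v, [/\ lspan (range w) v, v != 0 &
    forall g J, basic_functional g J -> `|act g v| <= eps * N v].
Proof.
move=> bw eps0; apply: contrapT => K.
have H v : lspan (range w) v -> v != 0 ->
    exists g J, basic_functional g J /\ eps * N v < `|act g v|.
  move=> vw v0; apply: contrapT => L; apply: K; exists v; split => // g J gJ.
  by rewrite leNgt; apply/negP => lt; apply: L; exists g, J.
have eps1 : eps < 1.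
  have w0 : w 0%N != 0 := bw.1 0%N I.
  have ws : lspan (range w) (w 0%N) by apply: lspan_gen; exists 0%N.
  have [g [J [gJ]]] := H _ ws w0.
  move=> /lt_le_trans /(_ (basic_functional_le X_JT _ gJ)).
  by rewrite gtr_pMl // (N_gt0 F_JTG X_JT).
(* The final contradiction compares [eps ^+ 2 * (q * (eps ^+ 2 / 4))] with 9. *)
pose q := Num.bound (36 / eps ^+ 4).
have e4 : 0 < eps ^+ 4 by rewrite exprn_gt0.
have qe : 36 < q%:R * eps ^+ 4.
  by rewrite -ltr_pdivrMr // archi_boundP // divr_ge0 // ltW.
have e41 : eps ^+ 4 <= eps.
  by rewrite exprS ger_pMr // exprn_ile1 // ltW.
have qe1 : 36 < q%:R * eps.
  by apply: lt_le_trans qe _; rewrite ler_wpM2l.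
have q1 : 1 < q%:R :> R.
  have : q%:R * eps <= q%:R by rewrite ger_pMr ?ltW // (_ : 0 < q%:R) // ltr0n lt0n; apply/eqP => q0; rewrite q0 mul0r in qe1; lra.
  lra.
have q0 : 0 < q%:R :> R by lra.
(* With this threshold the small values on the q groups add up to at most 1. *)
pose th : R := q%:R^-1.
have th0 : 0 < th by rewrite invr_gt0.
have qth : q%:R * th = 1 by rewrite divff // gt_eqF.
have th1 : th < 1 by rewrite invf_lt1.
have the : 36 * th < eps.
  by rewrite mulrC -ltr_pdivlMl ?invr_gt0 // invrK.
(* Counting pasts requires r th^2 > 4, that is r > 4 q^2. *)
pose r := (4 * q ^ 2).+1%N.
have r4 : 4 < r%:R * th ^+ 2.
  have -> : r%:R = 4 * q%:R ^+ 2 + 1 :> R by rewrite /r -[LHS]natr1 natrM natrX.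
  rewrite mulrDl -mulrA -exprMn qth expr1n mulr1 mul1r ltrDl.
  by rewrite exprn_gt0.
pose gsize := (q * r).+1%N.
(* The errors of all q groups together amount to th / 2. *)
pose D := th ^+ 2 / 2.
have D0 : 0 < D by rewrite divr_gt0 // exprn_gt0.
have Dth : D <= th / 2 by rewrite /D ler_pM2r ?invr_gt0 // expr2 ger_pMr // ltW.
have qD : q%:R * D = th / 2 by rewrite /D mulrA expr2 mulrA qth mul1r.
have gg0 : 0 < gsize%:R :> R by rewrite ltr0n.
have [x [b [bx b0 xs xc xl]]] :=
  concentrated_blocks F_JTG X_JT bw (divr_gt0 D0 gg0).
have dg : D / gsize%:R *+ gsize = D by rewrite -[LHS]mulr_natr divfK // gt_eqF.
have dth : D / gsize%:R *+ gsize <= th / 2 by rewrite dg.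
have [z zP] := backward_groups F_JTG sigma_coding X_JT bx xs xc xl th0 dth r4 (ltnSn (q * r)).
have zs (i : 'I_q) : group_vector F iota w x b (D / gsize%:R) gsize i (z i) by case: (zP i (ltn_ord i)).
have zN (i : 'I_q) : N (z i) = 1 by case: (zs i).
have zc (i : 'I_q) : concentrated F (z i) (b (i * gsize)%N) (b (i.+1 * gsize)%N) D.
  by case: (zs i); rewrite dg.
have zw (i : 'I_q) : lspan (range w) (z i) by case: (zs i).
have bg i j : (i <= j)%N -> (b (i * gsize)%N <= b (j * gsize)%N)%N.
  exact: (b_group gsize xc).
have b1 i : (1 <= b (i * gsize)%N)%N by rewrite -b0 -(mul0n gsize) bg.
pose Z := \sum_(i < q) z i.
have Zw : lspan (range w) Z.
  rewrite /Z; under eq_bigr do rewrite -[z _]scale1r.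
  exact: lspan_sum.
(* The functional norming [z i] is cut to the i-th window, at a cost of at most D. The result is an
   atom with indices in that window, and the other [z j] contribute at most q D to its value at
   Z. *)
have lower (i : 'I_q) : exists gJ : c00 R * set nat,
   [/\ atom gJ.1 gJ.2, gJ.2 `<=` [set j | (b (i * gsize)%N <= j < b (i.+1 * gsize)%N)%N] &
    eps / 2 <= `|act gJ.1 Z|].
  have zi0 : z i != 0.
    by apply/eqP => zi; have := zN i; rewrite zi linear0 normr0 => /eqP; rewrite eq_sym oner_eq0.
  have [g [J [gJ]]] := H _ (zw i) zi0; rewrite zN mulr1 => big.
  (* No member of [F 0] norms [z i], since index 0 lies in no window. *)
  case: gJ => [aJ|[F0g _]]; last first.
    have := concentrated_single (zc i) (bg _ _ (leqnSn i)) F0g; rewrite leqNgt b1 /= => /(_ isT).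
    by move: big; lra.
  have [h [ph tr]] := atom_parts F_JTG sigma_coding aJ.
  exists (\sum_(b (i * gsize)%N <= j < b (i.+1 * gsize)%N) h j,
          J `&` [set j | (b (i * gsize)%N <= j < b (i.+1 * gsize)%N)%N]); split => /=.
  - exact: tr.
  - by move=> j [].
  rewrite /Z linear_sum (bigD1 i) //=; set g' := \sum_(_ <= j < _) h j.
  have near := concentrated_act (zc i) ph (bg _ _ (leqnSn i)).
  have far : `|\sum_(j < q | j != i) act g' (z j)| <= q%:R * D.
    apply: le_trans (ler_norm_sum _ _ _) _.
    apply: (@le_trans _ _ (\sum_(j < q) D)); last by rewrite sumr_const card_ord mulr_natl.
    rewrite big_mkcond; apply: ler_sum => j _; case: ifPn => [ji|_]; last exact: ltW.
    apply: (concentrated_sub (zc j) (parts_selection ph)).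
    case: (ltngtP i j) => [ij|ij|/val_inj e]; last by rewrite e eqxx in ji.
      by right; apply: bg.
    by left; apply: bg.
  have e1 : `|act g (z i)| <= `|act g (z i) - act g' (z i)| + `|act g' (z i)|.
    by rewrite -{1}[act g (z i)](subrK (act g' (z i))) ler_normD.
  set s := \sum_(j < q | _) _ in far *.
  have e2 : `|act g' (z i)| <= `|act g' (z i) + s| + `|s|.
    by rewrite -{1}[act g' (z i)](addrK s) (le_trans (ler_normB _ _)).
  rewrite qD in far; rewrite -/g' in near.
  have := le_trans (ltW big) (le_trans e1 (lerD near (le_trans e2 (lerD (lexx _) far)))).
  by move: Dth the th0; set u := `|act g' (z i) + s|; clearbody u th D; lra.
have [G GP] := choice lower.
have Gdis (i j : 'I_q) : true -> true -> (G i).2 `&` (G j).2 !=set0 -> i = j.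
  move=> _ _ [k [ki kj]]; have [_ /(_ k ki) /= /andP[k1 k2] _] := GP i.
  have [_ /(_ k kj) /= /andP[k3 k4] _] := GP j.
  apply: val_inj => /=; case: (ltngtP i j) => // [ij|ji].
    by have := leq_trans (bg _ _ ij) k3; rewrite leqNgt k2.
  by have := leq_trans (bg _ _ ji) k1; rewrite leqNgt k4.
have Gat (i : 'I_q) : true -> atom (G i).1 (G i).2 by case: (GP i).
have NZ : q%:R * (eps ^+ 2 / 4) <= N Z ^+ 2.
  apply: le_trans (atoms_bessel X_JT Z Gat Gdis).
  rewrite mulr_natl -[X in _ *+ X]card_ord -sumr_const; apply: ler_sum => i _.
  have [_ _ eG] := GP i.
  have -> : eps ^+ 2 / 4 = (eps / 2) ^+ 2 by field.
  have e20 : 0 <= eps / 2 by rewrite divr_ge0 // ltW.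
  by rewrite -[leRHS]real_normK ?num_real // lerXn2r ?nnegrE.
have Z0 : Z != 0.
  apply/eqP => Z0; move: NZ; rewrite Z0 linear0 normr0 expr0n /= leNgt.
  by rewrite mulr_gt0 // divr_gt0 // exprn_gt0.
have [g [J [gJ]]] := H _ Zw Z0.
have upper : `|act g Z| <= 2 + q%:R * th.
  rewrite linear_sum; apply: sum_two_big; first exact: ltW.
    by move=> i; rewrite -(zN i) (basic_functional_le X_JT _ gJ).
  move=> i j k /andP[ij jk] ti tk.
  (* The windows are disjoint, so a functional with a single index is large on at most one group. *)
  have sing m : F m g -> `|act g (z j)| <= th.
    move=> Fg.
    have inw (l : 'I_q) : th < `|act g (z l)| -> (b (l * gsize)%N <= m < b (l.+1 * gsize)%N)%N.
      move=> tl; apply: contraLR tl => out; rewrite -leNgt.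
      by have := concentrated_single (zc l) (bg _ _ (leqnSn l)) Fg out; move: Dth th0; lra.
    have /andP[_ mi] := inw i ti; have /andP[mk _] := inw k tk.
    by have := leq_trans (bg _ _ (leq_trans ij (ltnW jk))) mk; rewrite leqNgt mi.
  case: gJ => [[[I [s [E [sp itvE finE gE JE]]]]|/single_withP[[g0 _]|[m [_ _ Fm _]]]]|[F0g _]].
  - pose t := Representation I s E g J.
    have ok : is_representation t by split.
    have := @middle_small _ F Xi1 Xi2 sigma X iota F_JTG sigma_coding w x b (D / gsize%:R) gsize bx xc z i j k t ij jk ok
      (zs i) (zs j) (zs k).
    rewrite dg /= => M; apply: (le_trans (M _ _ _)).
    + by rewrite -normr_gt0 (lt_trans th0).
    + by rewrite -normr_gt0 (lt_trans th0).
    + by have [_ /(_ k t)] := zP j (ltn_ord j); apply => //; rewrite jk /=.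
    + by move: Dth th0; lra.
  - by rewrite /= g0 act0l normr0 ltW.
  - exact: sing Fm.
  - exact: sing F0g.
rewrite qth in upper.
move=> /lt_le_trans /(_ upper) big.
have : (eps * N Z) ^+ 2 < 9.
  have -> : 9 = 3 ^+ 2 :> R by ring.
  rewrite ltrXn2r // ?nnegrE; last by lra.
  by rewrite mulr_ge0 // ltW.
apply/negP; rewrite -leNgt exprMn.
apply: (@le_trans _ _ (eps ^+ 2 * (q%:R * (eps ^+ 2 / 4)))).
  have -> : eps ^+ 2 * (q%:R * (eps ^+ 2 / 4)) = q%:R * eps ^+ 4 / 4 by field.
  lra.
by rewrite ler_wpM2l // exprn_ge0 // ltW.
Qed.

End SmallOnBasicFunctionals.

(** * Coordinates on the completion *)

Section Coordinates.
Variables (R : realType) (F : nat -> set (c00 R)).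
Variables (Xi1 Xi2 : set nat) (sigma : seq (c00 R) -> nat).
Variables (X : completeNormedModType R) (iota : {linear c00 R -> X}).
Hypothesis F_JTG : JTG F.
Hypothesis sigma_coding : is_coding F Xi2 sigma.
Hypothesis X_JT : is_JT F Xi1 sigma iota.

Notation N x := (`|iota x|).

Lemma iota_approx (y : X) (e : R) : 0 < e -> exists x, `|iota x - y| < e.
Proof.
move=> e0; have [] := X_JT.2 (ball y e).
- by exists y; exact: ballxx.
- exact: ball_open.
move=> z [zb [x _ xz]]; exists x; move: zb.
by rewrite xz -ball_normE /= distrC.
Qed.

(** Coordinates are 1-Lipschitz for the norm, so the constraints that approximations x of a point
    impose on its coordinate are pairwise compatible. *)
Lemma coord_exists (p : nat * X) : exists r : R,
  forall x : c00 R, `|x p.1 - r| <= `|iota x - p.2|.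
Proof.
case: p => k y /=; apply: (@common_center R (c00 R) 0) => x x'.
apply: le_trans (coord_le F_JTG X_JT (x - x') k) _; rewrite linearB /=.
have -> : iota x - iota x' = (iota x - y) - (iota x' - y) by rewrite opprB addrA subrK.
exact: ler_normB.
Qed.

Lemma coord_functional : exists co : nat -> X -> R,
  [/\ forall k (x : c00 R) y, `|x k - co k y| <= `|iota x - y|,
      forall k a y z, co k (a *: y + z) = a * co k y + co k z &
      forall y, y != 0 -> exists k, co k y != 0].
Proof.
have [co' Hco'] := choice coord_exists; pose co k y := co' (k, y).
have coP k (x : c00 R) y : `|x k - co k y| <= `|iota x - y| := Hco' (k, y) x.
exists co; split => //.
  move=> k a y z; apply/eqP; rewrite -subr_eq0 -normr_le0; apply/ler_addgt0Pr => e e0.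
  rewrite add0r; pose e1 := e / (2 * (`|a| + 1)).
  have e10 : 0 < e1 by rewrite divr_gt0 // mulr_gt0 // ltr_wpDl.
  have [x1 H1] := iota_approx y e10; have [x2 H2] := iota_approx z e10.
  have -> : co k (a *: y + z) - (a * co k y + co k z) =
      (a * (x1 k - co k y) + (x2 k - co k z)) - ((a *: x1 + x2) k - co k (a *: y + z)).
    by rewrite c00D c00Z; ring.
  have h1 := le_trans (coP k x1 y) (ltW H1); have h2 := le_trans (coP k x2 z) (ltW H2).
  have h3 : `|(a *: x1 + x2) k - co k (a *: y + z)| <= `|a| * e1 + e1.
    apply: le_trans (coP _ _ _) _; rewrite linearP /=.
    have -> : a *: iota x1 + iota x2 - (a *: y + z) =
       a *: (iota x1 - y) + (iota x2 - z).
      by rewrite scalerBr opprD addrACA.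
    by apply: le_trans (ler_normD _ _) _; rewrite normrZ lerD ?ler_wpM2l // ltW.
  apply: le_trans (ler_normB _ _) _.
  have h4 : `|a * (x1 k - co k y) + (x2 k - co k z)| <= `|a| * e1 + e1.
    by apply: le_trans (ler_normD _ _) _; rewrite normrM lerD ?ler_wpM2l.
  apply: le_trans (lerD h4 h3) _.
  rewrite (_ : _ + _ = e) // /e1; field.
  by rewrite gt_eqF // ltr_wpDl.
(* If all coordinates of y vanish, approximations of y have small coordinates. Let f in [F2] nearly
   norm an approximation x; being finitely supported, f is nearly 0 on an approximation x' chosen
   after f. With errors |y| / 8, the value of f at x would be above 3|y| / 4 and at most 3|y| /
   8. *)
move=> y y0; apply: contrapT => K.
have z k : co k y = 0 by apply/eqP; apply: contrapT => /negP ?; apply: K; exists k.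
have {}coP k (x : c00 R) : `|x k| <= `|iota x - y| by have := coP k x y; rewrite z subr0.
have e0 : 0 < `|y| / 8 by rewrite divr_gt0 // normr_gt0.
have [x xy] := iota_approx y e0; have [f f2 fx] := F2_approx X_JT x e0.
have e1 : 0 < `|y| / 8 / (1 + norm1 f) by rewrite divr_gt0 // ltr_wpDr // norm1_ge0.
have [x' x'y] := iota_approx y e1.
have h1 : `|act f x'| <= `|y| / 8.
  rewrite actC; apply: le_trans (act_le_norm1 f (fun n => le_trans (coP n x') (ltW x'y))) _.
  rewrite mulrAC ler_pdivrMr ?ltr_wpDr ?norm1_ge0 // ler_wpM2l ?ltW //.
  by rewrite ltrDr.
have h2 : `|act f (x - x')| <= `|iota x - y| + `|iota x' - y|.
  apply: le_trans (F2_norm_le X_JT (x - x') f2) _.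
  rewrite linearB /= (_ : _ - _ = (iota x - y) - (iota x' - y)); last first.
    by rewrite opprB addrA subrK.
  exact: ler_normB.
have h3 : `|y| <= `|iota x - y| + N x.
  by have := ler_normB (iota x) (iota x - y); rewrite subKr [X in _ <= X -> _]addrC.
have h4 : `|iota x' - y| <= `|y| / 8.
  apply: le_trans (ltW x'y) _; rewrite ler_pdivrMr ?ltr_wpDr ?norm1_ge0 //.
  by rewrite ler_pMr // lerDl norm1_ge0.
rewrite linearB /= in h2.
have := lerD (le_trans (ler_norm _) h2) (le_trans (ler_norm _) h1); rewrite subrK => h5.
clear h1 h2; move: e0 xy fx h3 h4 h5.
set a := act f x; set n1 := `|iota x - y|; set n2 := `|iota x' - y|.
set n3 := `|y|; set n4 := `|iota x|; clearbody a n1 n2 n3 n4; lra.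
Qed.

Section InY.
Variable Y : set X.
Hypothesis Y_sub : inf_dim_closed_subspace Y.

Lemma Y0 : Y 0.
Proof. by have [_ [Y0 _] _] := Y_sub; move: Y0; rewrite inE. Qed.

Lemma Y_lin a u v : Y u -> Y v -> Y (a *: u + v).
Proof.
by have [_ [_ H] _] := Y_sub => Yu Yv; have := H a u v; rewrite !inE; apply.
Qed.

Lemma Y_sum (I : Type) (r : seq I) (P : pred I) (c : I -> R) (u : I -> X) :
  (forall i, P i -> Y (u i)) -> Y (\sum_(i <- r | P i) c i *: u i).
Proof.
by move=> Yu; elim/big_rec: _ => [|i x Pi Yx]; [exact: Y0|apply: Y_lin => //; exact: Yu].
Qed.

Lemma Y_independent n : exists u : nat -> X, (forall i, (i < n)%N -> Y (u i)) /\
  forall c : nat -> R, \sum_(i < n) c i *: u i = 0 -> forall i, (i < n)%N -> c i = 0.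
Proof.
elim: n => [|n [u [Yu ui]]]; first by exists (fun=> 0).
have [_ _ infY] := Y_sub.
have [v [Yv vB]] : exists v, Y v /\ ~ lspan (u @` `I_n) v.
  apply: contrapT => K; apply: infY; exists (u @` `I_n).
    exact: finite_image (finite_II n).
  by move=> v Yv; apply: contrapT => vB; apply: K; exists v.
exists (fun i => if i == n then v else u i); split.
  by move=> i; rewrite ltnS leq_eqVlt; case: eqP => [_ _|_ /= /Yu].
move=> c; rewrite big_ord_recr /= eqxx.
have -> : \sum_(i < n) c i *: (if (i : nat) == n then v else u i) = \sum_(i < n) c i *: u i.
  by apply: eq_bigr => i _; rewrite ltn_eqF.
move=> c0; have cn : c n = 0.
  apply: contrapT => /eqP cn; apply: vB.
  have -> : v = - (c n)^-1 *: \sum_(i < n) c i *: u i.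
    have -> : \sum_(i < n) c i *: u i = - (c n *: v).
      by apply/eqP; rewrite -addr_eq0 c0.
    by rewrite scalerN scaleNr opprK scalerA mulVf ?scale1r.
  apply: lspanZ; apply: lspan_sum => i _; apply: lspan_gen; by exists i => /=.
move: c0; rewrite cn scale0r addr0 => /ui H i; rewrite ltnS leq_eqVlt.
by move=> /predU1P[->|/H].
Qed.

End InY.

End Coordinates.

Section Subspace.
Variables (R : realType) (F : nat -> set (c00 R)).
Variables (Xi1 Xi2 : set nat) (sigma : seq (c00 R) -> nat).
Variables (X : completeNormedModType R) (iota : {linear c00 R -> X}).
Hypothesis F_JTG : JTG F.
Hypothesis sigma_coding : is_coding F Xi2 sigma.
Hypothesis X_JT : is_JT F Xi1 sigma iota.

Notation basic_functional := (basic_functional F Xi1 sigma).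
Notation N x := (`|iota x|).

Variable Y : set X.
Hypothesis Y_sub : inf_dim_closed_subspace Y.

(** Among K + 1 independent vectors of [Y] some nonzero combination has its first K coordinates
    equal to 0. Those of a close approximation are then small enough to be deleted. *)
Lemma block_near_subspace K (e : R) : 0 < e ->
  exists (w : c00 R) (y : X), [/\ Y y, `|iota w - y| <= e, above K w & exists k, 1 <= w k].
Proof.
move=> e0; have [co [coP coL co0]] := coord_functional F_JTG X_JT.
have co_sum k n (c : 'I_n -> R) (u : 'I_n -> X) :
    co k (\sum_i c i *: u i) = \sum_i c i * co k (u i).
  have co00 : co k 0 = 0.
    by have := coL k 1 0 0; rewrite scaler0 addr0 mul1r => /eqP;
    rewrite -subr_eq0 opprD addrA subrr sub0r oppr_eq0 => /eqP.
  by elim/big_rec2: _ => // i a b _ <-; exact: coL.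
have [u [Yu ui]] := Y_independent Y_sub K.+1.
pose A := \matrix_(i < K.+1, k < K) co k (u i).
have [c c0 cA] := kernel_vector A (ltnSn K).
pose v := \sum_(i < K.+1) c 0 i *: u i.
have Yv : Y v by apply: (Y_sum Y_sub) => i _; exact: Yu.
have v0 : v != 0.
  apply: contraNN c0 => /eqP v0; apply/eqP/rowP => i; rewrite mxE.
  pose c' i := if insub i is Some j then c 0 j else 0.
  have c'E (j : 'I_K.+1) : c' j = c 0 j by rewrite /c' valK.
  rewrite -c'E; apply: ui => //; rewrite -[RHS]v0; apply: eq_bigr => j _.
  by rewrite c'E.
have vK k : (k < K)%N -> co k v = 0.
  move=> kK; have := congr1 (fun M : 'rV_K => M 0 (Ordinal kK)) cA.
  rewrite !mxE => H; rewrite co_sum -[RHS]H; apply: eq_bigr => i _.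
  by rewrite mxE.
have [k0 k0v] := co0 v v0.
(* Coordinate [k0] becomes 2, and it stays at least 1 after an approximation within [e1 <= 1]. *)
pose y := (2 / co k0 v) *: v.
have coy k : co k y = 2 / co k0 v * co k v.
  by have := co_sum k 1%N (fun=> 2 / co k0 v) (fun=> v); rewrite !big_ord1.
have yK k : (k < K)%N -> co k y = 0 by move=> kK; rewrite coy (vK k kK) mulr0.
have yk0 : co k0 y = 2 by rewrite coy divfK.
have Yy : Y y by rewrite -[y]addr0; apply: (Y_lin Y_sub) => //; exact: (Y0 Y_sub).
(* The 1 pays for the approximation, the sum for the deleted coordinates. *)
pose S := 1 + \sum_(k < K) N (unit_vec R k).
have S0 : 0 < S by rewrite ltr_wpDr // sumr_ge0.
pose e1 := Num.min 1 (e / S).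
have e10 : 0 < e1 by rewrite lt_min ltr01 divr_gt0.
have e1S : e1 * S <= e by rewrite -ler_pdivlMr // ge_min lexx orbT.
have e11 : e1 <= 1 by rewrite ge_min lexx.
have [x0 x0y] := iota_approx X_JT y e10.
have x0k k : `|x0 k - co k y| <= e1 := le_trans (coP k x0 y) (ltW x0y).
have inK n : (n \in [set n | (K <= n)%N]) = (K <= n)%N by apply/idP/idP; rewrite inE.
pose w := restr [set n | (K <= n)%N] x0.
have k0K : (K <= k0)%N.
  by rewrite leqNgt; apply: contraNN k0v => /vK ->.
exists w, y; split => //.
- have wE : iota w - y = (iota x0 - y) - \sum_(k < K) x0 k *: iota (unit_vec R k).
    have xw : x0 - w = \sum_(k < K) x0 k *: unit_vec R k.
      have xwE n : (x0 - w) n = if (K <= n)%N then 0 else x0 n.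
        rewrite c00D c00N restrE inK; case: (K <= n)%N; first by rewrite subrr.
        by rewrite subr0.
      rewrite [LHS](@c00_decomp _ _ K); last by move=> n Kn; rewrite xwE Kn.
      by apply: eq_bigr => k _; rewrite xwE leqNgt ltn_ord.
    have -> : w = x0 - (x0 - w) by rewrite subKr.
    rewrite linearB /= xw linear_sum /= addrAC; congr (_ - _ - _).
    by apply: eq_bigr => k _; rewrite linearZ.
  rewrite wE; apply: le_trans (ler_normB _ _) _; apply: le_trans e1S.
  rewrite mulrDr mulr1 lerD ?(ltW x0y) // mulr_sumr.
  apply: le_trans (ler_norm_sum _ _ _) _; apply: ler_sum => k _.
  by rewrite normrZ ler_wpM2r // -[x0 k]subr0 -(yK k).
- by move=> n nK; rewrite restrE inK leqNgt nK.
- exists k0; rewrite restrE inK k0K.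
  have := x0k k0; rewrite yk0 ler_norml => /andP[h _].
  lra.
Qed.

(** Each block has a coordinate at least 1, so a normalised combination has coefficients at most 1
    and inherits the summable distances to [Y]. *)
Lemma small_near_subspace (e : R) : 0 < e ->
  exists (x : c00 R) (y : X), [/\ N x = 1, Y y, `|iota x - y| <= e &
    forall g J, basic_functional g J -> `|act g x| <= e].
Proof.
move=> e0.
have [] := @block_choice R nat (fun n w n' => n' = n.+1 /\
   exists y, [/\ Y y, `|iota w - y| <= e / 2 ^+ n.+1 & exists k, 1 <= w k]) _ 0%N 0%N.
  move=> n K; have en : 0 < e / 2 ^+ n.+1 by rewrite divr_gt0 // exprn_gt0.
  have [w [y [Yy wy aw [k wk]]]] := block_near_subspace K en.
  exists w, n.+1; split => //; last first.
    by apply/eqP => w0; move: wk; rewrite w0 c00_0 ler10.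
  by split => //; exists y; split => //; exists k.
move=> w [t [t0 Qw bw _]].
have tn n : t n = n by elim: n => // n IH; have [-> _] := Qw n; rewrite IH.
have [y yP] := choice (fun n => (Qw n).2).
have [v [vw v0 vs]] := exists_small_vector F_JTG sigma_coding X_JT bw e0.
have Nv : 0 < N v by apply: (N_gt0 F_JTG X_JT).
have [d [c' vE]] := lspan_range vw.
pose c n := (N v)^-1 * c' n.
pose x := \sum_(n < d) c n *: w n.
have xE : x = (N v)^-1 *: v.
  by rewrite {2}vE scaler_sumr; apply: eq_bigr => n _; rewrite scalerA.
have Nx : N x = 1 by rewrite xE linearZ normrZ normfV normr_id mulVf // gt_eqF.
exists x, (\sum_(n < d) c n *: y n); split => //.
- by apply: (Y_sum Y_sub) => n _; case: (yP n).
- rewrite linear_sum -sumrB; apply: le_trans (ler_norm_sum _ _ _) _.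
  apply: le_trans (half_pow_sum d (ltW e0)); apply: ler_sum => n _.
  rewrite linearZ -scalerBr normrZ; have [_ H [k wk]] := yP n.
  rewrite tn in H; apply: le_trans H; rewrite ler_piMl // -Nx.
  have Fk : F 0%N (unit_vec R k) by rewrite (JTG_F0 F_JTG); exists k; left.
  have {}wk : 1 <= act (unit_vec R k) (w n) by rewrite act_unit.
  exact: (block_coef F_JTG X_JT c bw Fk wk (ltn_ord n)).
- move=> g J gJ; rewrite xE linearZ /= normrM normfV normr_id mulrC ler_pdivrMr //.
  exact: vs gJ.
Qed.

End Subspace.

(** * Almost isometric copies of the l2 basis *)

Definition meets_below (J : set nat) (c : nat) := exists2 j, J j & (j < c)%N.
(** The least element of J lies in [b, c); the formulation needs no minimum and is false for the
    empty set. *)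
Definition in_window b c (J : set nat) := ~ meets_below J b /\ meets_below J c.

Section Ell2Estimates.
Variables (R : realType) (F : nat -> set (c00 R)).
Variables (Xi1 Xi2 : set nat) (sigma : seq (c00 R) -> nat).
Variables (X : completeNormedModType R) (iota : {linear c00 R -> X}).
Hypothesis F_JTG : JTG F.
Hypothesis sigma_coding : is_coding F Xi2 sigma.
Hypothesis X_JT : is_JT F Xi1 sigma iota.

Notation atom := (atom F Xi1 sigma).
Notation N x := (`|iota x|).

(** Stated for arbitrary disjoint families: the upper estimate applies it to combinations in [F2],
    the lower one to the norming functionals of the other vectors. *)
Definition quasi_separated (x : c00 R) b c (e : R) :=
  forall (I : finType) (P : pred I) (g : I -> c00 R) (J : I -> set nat),
  (forall i, P i -> atom (g i) (J i)) ->
  (forall i j, P i -> P j -> J i `&` J j !=set0 -> i = j) ->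
  \sum_(i | P i && ~~ `[< in_window b c (J i) >]) `|act (g i) x| <= e.

Lemma sum_disjoint_le (I : finType) (P : pred I) (J : I -> set nat) (G : I -> R) j (M : R) :
  (forall i k, P i -> P k -> J i `&` J k !=set0 -> i = k) ->
  0 <= M -> (forall i, P i -> J i j -> G i <= M) -> (forall i, P i -> ~ J i j -> G i <= 0) ->
  \sum_(i | P i) G i <= M.
Proof.
move=> dis M0 GM G0.
case: (pselect (exists2 i, P i & J i j)) => [[i Pi Jij]|K].
  rewrite (bigD1 i) //= -[leRHS]addr0; apply: lerD; first exact: GM.
  apply: sumr_le0 => k /andP[Pk ki]; apply: G0 => // Jkj.
  by move/eqP: ki; apply; apply: dis => //; exists j.
apply: le_trans M0; apply: sumr_le0 => i Pi; apply: G0 => // Jij.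
by apply: K; exists i.
Qed.

Lemma quasi_separatedI x b c (e d : R) : 0 <= e ->
  (forall g J, atom g J -> `|act g x| <= e) ->
  (forall h, selection F h -> forall B, \sum_(c <= j < B) `|act (h j) x| <= d) ->
  quasi_separated x b c (e *+ b + d).
Proof.
move=> e0 small tail I P g J ag dis.
(* A functional outside the window has an index below b, or none below c. *)
pose P1 i := P i && `[< meets_below (J i) b >].
pose P2 i := P i && ~~ `[< meets_below (J i) c >].
apply: (@le_trans _ _ (\sum_(i | P1 i) `|act (g i) x| + \sum_(i | P2 i) `|act (g i) x|)).
  rewrite big_mkcond [X in _ <= X + _]big_mkcond [X in _ <= _ + X]big_mkcond -big_split /=.
  apply: ler_sum => i _; case: ifP => [/andP[Pi /asboolPn nw]|_]; last first.
    by rewrite addr_ge0 //; case: ifP.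
  rewrite /P1 /P2 Pi /=; case: (pselect (meets_below (J i) b)) => mb.
    by rewrite (asboolT mb) lerDl; case: ifP.
  case: (pselect (meets_below (J i) c)) => mc; first by case: nw.
  by rewrite (asboolF mc) /= lerDr; case: ifP.
apply: lerD.
  (* Each such functional is charged to its indices below b, and each index has at most one
     owner. *)
  pose T j (i : I) : R := if `[< J i j >] then 1 else 0.
  apply: (@le_trans _ _ (\sum_(i | P1 i) \sum_(j < b) e * T j i)).
    apply: ler_sum => i /andP[Pi /asboolP[j Jj jb]].
    apply: le_trans (small _ _ (ag i Pi)) _; rewrite (bigD1 (Ordinal jb)) //=.
    rewrite {1}/T (asboolT Jj) mulr1 lerDl; apply: sumr_ge0 => k _.
    by rewrite mulr_ge0 // /T; case: ifP.
  rewrite exchange_big /= -[X in _ *+ X]card_ord -sumr_const; apply: ler_sum => j _.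
  apply: (@sum_disjoint_le _ _ J _ j) => //.
  - by move=> i k /andP[Pi _] /andP[Pk _]; exact: dis.
  - by move=> i _ Jij; rewrite /T asboolT // mulr1.
  - by move=> i _ Jij; rewrite /T asboolF // mulr0.
have /choice[h Hh] : forall i, exists h, P i -> parts F (g i) (J i) h.
  move=> i; case: (boolP (P i)) => Pi; last by exists (fun=> 0).
  by have [h [ph _]] := atom_parts F_JTG sigma_coding (ag i Pi); exists h.
have /choice[B HB] : forall i, exists B, P i -> forall C, (B <= C)%N -> g i = \sum_(0 <= j < C) h i j.
  move=> i; case: (boolP (P i)) => Pi; last by exists 0%N.
  by have [_ _ [B [_ HB]]] := Hh i Pi; exists B.
pose C := (c + \sum_i B i)%N.
have BC i : (B i <= C)%N.
  by rewrite /C (bigD1 i) //= addnCA leq_addr.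
(* Disjointness merges the functionals into one selection: index j is served by the only functional
   owning it. *)
pose H j := if [pick i | P i && `[< J i j >]] is Some i then h i j else 0.
have selH : selection F H.
  move=> j; rewrite /H; case: pickP => [i /andP[Pi /asboolP Jij]|_]; last by right.
  by left; have [Fh _ _] := Hh i Pi; exact: Fh.
apply: le_trans (tail H selH C).
apply: (@le_trans _ _ (\sum_(i | P2 i) \sum_(c <= j < C) `|act (h i j) x|)).
  apply: ler_sum => i /andP[Pi /asboolPn mc].
  rewrite (HB i Pi C) // (@big_cat_nat _ _ _ c) ?leq_addr //= [X in X + _]big_nat big1 ?add0r.
    by rewrite act_suml; exact: ler_norm_sum.
  move=> j /andP[_ jc]; have [_ h0 _] := Hh i Pi; apply: h0 => Jij.
  by apply: mc; exists j.
rewrite exchange_big /=; apply: ler_sum => j _.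
apply: (@sum_disjoint_le _ _ J _ j) => //.
- by move=> i k /andP[Pi _] /andP[Pk _]; exact: dis.
- move=> i /andP[Pi _] Jij; rewrite /H; case: pickP => [k /andP[Pk /asboolP Jkj]|].
    by rewrite (dis i k) //; exists j.
  by move=> /(_ i); rewrite Pi asboolT.
- by move=> i /andP[Pi _] Jij; have [_ -> //] := Hh i Pi; rewrite act0l normr0.
Qed.

Lemma N_le x (M : R) : (forall f, F2 F Xi1 sigma f -> act f x <= M) -> N x <= M.
Proof.
move=> H; apply/ler_addgt0Pr => e e0; have [f f2 fx] := F2_approx X_JT x e0.
by rewrite -lerBlDr (le_trans (ltW fx)) // H.
Qed.

(** Norming combinations have varying lengths; as sequences padded by zeros they can be read up to
    one common length M for several vectors. *)
Record norming x b c (e : R) (a : nat -> R) (g : nat -> c00 R) (J : nat -> set nat) : Prop := {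
  n_atom : forall k, atom (g k) (J k);
  n_disj : forall k l, J k `&` J l !=set0 -> k = l;
  n_window : forall k j, J k j -> (b <= j < c)%N;
  n_coef : forall M, \sum_(k < M) a k ^+ 2 <= 1;
  n_value : exists d, forall M, (d <= M)%N -> 1 - 2 * e <= \sum_(k < M) a k * act (g k) x }.

Lemma F2_combination f : F2 F Xi1 sigma f -> F 0%N f \/
  exists (d : nat) (a : 'I_d -> R) (g : 'I_d -> c00 R) (J : 'I_d -> set nat),
    [/\ forall k, atom (g k) (J k), forall k l, J k `&` J l !=set0 -> k = l,
       \sum_k a k ^+ 2 <= 1 & f = \sum_k a k *: g k].
Proof.
case=> [|[d [a [g [J [a1 ag tJ ->]]]]]]; [by left|right].
exists d, (fun k => ratr (a k)), g, J; split => //.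
- by move=> k l; exact: tJ.
- under eq_bigr do rewrite -rmorphXn; rewrite -rmorph_sum /=.
  by rewrite -(rmorph1 (@ratr R)) ler_rat.
Qed.

Lemma coef_le1 (I : finType) (a : I -> R) k : \sum_i a i ^+ 2 <= 1 -> `|a k| <= 1.
Proof.
move=> a1; rewrite -(@ler_pXn2r _ 2) ?nnegrE // expr1n real_normK ?num_real //.
apply: le_trans a1; rewrite (bigD1 k) //= lerDl; apply: sumr_ge0 => i _.
exact: sqr_ge0.
Qed.

Lemma quasi_separated_act x b c e d (a : 'I_d -> R) (g : 'I_d -> c00 R) J :
  quasi_separated x b c e -> (forall k, atom (g k) (J k)) ->
  (forall k l, J k `&` J l !=set0 -> k = l) -> \sum_k a k ^+ 2 <= 1 ->
  act (\sum_k a k *: g k) x <=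
    \sum_(k | `[< in_window b c (J k) >]) a k * act (g k) x + e.
Proof.
move=> sx ag dis a1; rewrite act_suml (bigID (fun k => `[< in_window b c (J k) >])) /=.
apply: lerD; first by rewrite le_eqVlt; apply/orP; left; apply/eqP/eq_bigr => k _; rewrite actZl.
apply: le_trans (sx _ xpredT g J (fun k _ => ag k) (fun k l _ _ => dis k l)).
apply: ler_sum => k _; apply: le_trans (ler_norm _) _.
by rewrite actZl normrM ler_piMl // (coef_le1 _ a1).
Qed.

Lemma ell2_step (Y : set X) b (e : R) : inf_dim_closed_subspace Y -> 0 < e -> e < 1 / 2 ->
  exists (x : c00 R) (y : X) c a g J,
   [/\ N x = 1 /\ Y y, `|iota x - y| <= e /\ (b <= c)%N, quasi_separated x b c e,
     (forall f, F 0%N f -> `|act f x| <= e) & norming x b c e a g J].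
Proof.
(* At most b functionals with disjoint index sets have an index below b; together they cost at most
   e / 2. *)
move=> Y_sub e0 e2; pose e1 := e / 2 / b.+1%:R.
have e10 : 0 < e1 by rewrite !divr_gt0.
have [x [y [Nx Yy xy xs]]] := small_near_subspace F_JTG sigma_coding X_JT Y_sub e10.
have e1e : e1 <= e.
  rewrite /e1 -mulrA ger_pMr // -invfM invf_le1 ?mulr_gt0 //.
  by rewrite -natrM ler1n.
have e1b : e1 *+ b <= e / 2.
  rewrite /e1 -[leLHS]mulr_natr mulrAC ler_pdivrMr // ler_wpM2l ?ler_nat //.
  by rewrite divr_ge0 // ltW.
have x0 f : F 0%N f -> `|act f x| <= e.
  by move=> F0f; apply: le_trans (xs f [set 0%N] _) e1e; right.
have ed : 0 < e / 2 by rewrite divr_gt0.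
have [c0 Hc0] := tail_act F_JTG x ed.
have sepc c : (c0 <= c)%N -> quasi_separated x b c e.
  move=> cc I P g J ag dis.
  apply: (@le_trans _ _ (e1 *+ b + e / 2)); last by rewrite [leRHS](splitr e) lerD2r.
  apply: (@quasi_separatedI x b c e1 (e / 2)) => //; first exact: ltW.
    by move=> g' J' aJ; apply: (xs g' J'); left.
  move=> h hh B; apply: le_trans (Hc0 h hh B).
  have [Bc|cB] := leqP B c; first by rewrite big_geq // sumr_ge0.
  by rewrite [leRHS](@big_cat_nat _ _ _ c) //= ?lerDr ?sumr_ge0 // ltnW.
have [f f2 fx] := F2_approx X_JT x e0; rewrite Nx in fx.
(* A member of [F 0] is at most e on x, and e < 1 - e. *)
have [F0f|[d [a [g [J [ag dis a1 fE]]]]]] := F2_combination f2.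
  have := le_trans (ler_norm _) (x0 f F0f); move: fx e2.
  by set u := act f x; clearbody u; lra.
have /choice[bd Hbd] : forall k : 'I_d, exists B, forall j, J k j -> (j < B)%N.
  move=> k; have [h [[_ _ [B [HB _]]] _]] := atom_parts F_JTG sigma_coding (ag k).
  by exists B.
(* The right end passes both the tail bound and every index of the norming functional. *)
pose c := maxn (maxn b c0) (\sum_k bd k).
have cJ k j : J k j -> (j < c)%N.
  move=> /Hbd jk; apply: leq_trans jk _; rewrite /c leq_max; apply/orP; right.
  by rewrite (bigD1 k) //= leq_addr.
have bc : (b <= c)%N by rewrite /c !leq_max leqnn.
have cc0 : (c0 <= c)%N by rewrite /c !leq_max leqnn orbT.
pose W (k : 'I_d) := `[< in_window b c (J k) >].
(* Besides padding with z, this drops the functionals whose least index is outside the window. *)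
pose ex (T : Type) (z : T) (u : 'I_d -> T) (k : nat) : T :=
  if insub k is Some i then if W i then u i else z else z.
have exP (T : Type) (z : T) (u : 'I_d -> T) (Q : T -> Prop) :
    Q z -> (forall i, W i -> Q (u i)) -> forall k, Q (ex T z u k).
  move=> Qz Qu k; rewrite /ex; case: insubP => // i _ _; case: ifP => // Wi.
  exact: Qu.
have sum_ex (G : 'I_d -> R) M : (d <= M)%N -> \sum_(k < M) ex R 0 G k = \sum_(i | W i) G i.
  move=> dM; rewrite [RHS]big_mkcond -(subnKC dM) big_split_ord /=.
  rewrite [X in _ + X]big1 ?addr0; last first.
    by move=> i _; rewrite /ex insubF // ltnNge leq_addr.
  by apply: eq_bigr => i _; rewrite /ex valK.
exists x, y, c, (ex R 0 a), (ex (c00 R) 0 g), (ex (set nat) set0 J); split => //.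
- by split => //; exact: le_trans e1e.
- exact: sepc.
split.
- move=> k; rewrite /ex; case: insubP => [i _ _|_]; last exact: atom0.
  by case: ifP => // _; exact: atom0.
- move=> k l; rewrite /ex; case: insubP => [i _ ik|_]; last by move=> [j []].
  case: ifP => [_|_]; last by move=> [j []].
  case: insubP => [i' _ il|_]; last by move=> [j []].
  case: ifP => [_|_]; last by move=> [j []].
  by move=> /dis ii; rewrite -ik -il ii.
- move=> k j; apply: (exP (set nat) set0 J (fun K => K j -> (b <= j < c)%N)) => //.
  move=> i /asboolP[nm _] Jj; rewrite (cJ i j Jj) andbT leqNgt; apply/negP => jb.
  by apply: nm; exists j.
- move=> M; pose M' := maxn d M.
  apply: (@le_trans _ _ (\sum_(k < M') ex R 0 a k ^+ 2)).
    have MM : (M <= M')%N by rewrite leq_max leqnn orbT.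
    rewrite -(subnKC MM) big_split_ord /= lerDl; apply: sumr_ge0 => k _.
    exact: sqr_ge0.
  have sqE k : ex R 0 a k ^+ 2 = ex R 0 (fun i => a i ^+ 2) k.
    rewrite /ex; case: insubP => [i _ _|_]; last by rewrite expr0n.
    by case: ifP => // _; rewrite expr0n.
  under eq_bigr do rewrite sqE; rewrite sum_ex ?leq_maxl //.
  apply: le_trans a1; rewrite [leLHS]big_mkcond; apply: ler_sum => i _.
  by case: ifP => // _; exact: sqr_ge0.
- exists d => M dM.
  have prE k : ex R 0 a k * act (ex (c00 R) 0 g k) x = ex R 0 (fun i => a i * act (g i) x) k.
    rewrite /ex; case: insubP => [i _ _|_]; last by rewrite mul0r.
    by case: ifP => // _; rewrite mul0r.
  under eq_bigr do rewrite prE; rewrite sum_ex //.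
  (* One e is lost in norming x, another one in dropping functionals. *)
  have := quasi_separated_act (sepc c cc0) ag dis a1; rewrite -fE -/W.
  move: fx; set u := act f x; set v := \sum_(k | _) _; clearbody u v; lra.
Qed.

End Ell2Estimates.

Section Ell2Sequence.
Variables (R : realType) (F : nat -> set (c00 R)).
Variables (Xi1 Xi2 : set nat) (sigma : seq (c00 R) -> nat).
Variables (X : completeNormedModType R) (iota : {linear c00 R -> X}).
Hypothesis F_JTG : JTG F.
Hypothesis sigma_coding : is_coding F Xi2 sigma.
Hypothesis X_JT : is_JT F Xi1 sigma iota.

Notation atom := (atom F Xi1 sigma).
Notation N x := (`|iota x|).
Notation quasi_separated := (quasi_separated F Xi1 sigma).
Notation norming := (norming F Xi1 sigma).

Lemma ell2_sequence (Y : set X) (e : R) : inf_dim_closed_subspace Y -> 0 < e -> e < 1 ->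
  exists (x : nat -> c00 R) (y : nat -> X) b a g J, forall n,
   [/\ N (x n) = 1 /\ Y (y n), `|iota (x n) - y n| <= e / 2 ^+ n.+1 /\ (b n <= b n.+1)%N,
     quasi_separated (x n) (b n) (b n.+1) (e / 2 ^+ n.+1),
     (forall f, F 0%N f -> `|act f (x n)| <= e / 2 ^+ n.+1) &
     norming (x n) (b n) (b n.+1) (e / 2 ^+ n.+1) (a n) (g n) (J n)].
Proof.
move=> Y_sub e0 e1.
have en n : 0 < e / 2 ^+ n.+1 by rewrite divr_gt0 // exprn_gt0.
have en2 n : e / 2 ^+ n.+1 < 1 / 2.
  have p1 : (1 : R) <= 2 ^+ n by rewrite exprn_ege1 // ler1n.
  rewrite exprS invfM mulrA mulrAC ltr_pM2r ?invr_gt0 //.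
  rewrite ltr_pdivrMr ?exprn_gt0 // mul1r.
  exact: lt_le_trans p1.
pose T := (c00 R * X * nat * (nat -> R) * (nat -> c00 R) * (nat -> set nat))%type.
have /choice[f Hf] : forall p : nat * nat, exists t : T, let: (x, y, c, a, g, J) := t in
   [/\ N x = 1 /\ Y y, `|iota x - y| <= e / 2 ^+ p.1.+1 /\ (p.2 <= c)%N,
     quasi_separated x p.2 c (e / 2 ^+ p.1.+1),
     (forall f, F 0%N f -> `|act f x| <= e / 2 ^+ p.1.+1) &
     norming x p.2 c (e / 2 ^+ p.1.+1) a g J].
  move=> [n b] /=; have [x [y [c [a [g [J H]]]]]] :=
    ell2_step F_JTG sigma_coding X_JT b Y_sub (en n) (en2 n).
  by exists (x, y, c, a, g, J).
pose next (p : nat * nat) := let: (_, _, c, _, _, _) := f p in c.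
pose b := fix b n := if n is n'.+1 then next (n', b n') else 0%N.
pose t n := f (n, b n).
exists (fun n => (t n).1.1.1.1.1), (fun n => (t n).1.1.1.1.2), b,
  (fun n => (t n).1.1.2), (fun n => (t n).1.2), (fun n => (t n).2) => n.
have := Hf (n, b n); rewrite -/(t n).
have -> : b n.+1 = (t n).1.1.1.2 by rewrite /= /next -/(t n); case: (t n) => [[[[[]]]]].
by case: (t n) => [[[[[]]]]].
Qed.

Section Estimates.
Variables (x : nat -> c00 R) (b : nat -> nat) (a : nat -> nat -> R)
  (g : nat -> nat -> c00 R) (J : nat -> nat -> set nat) (e : R).
Hypothesis e_gt0 : 0 < e.
Hypothesis x_norm : forall n, N (x n) = 1.
Hypothesis b_incr : forall n, (b n <= b n.+1)%N.
Hypothesis x_sep : forall n, quasi_separated (x n) (b n) (b n.+1) (e / 2 ^+ n.+1).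
Hypothesis x_F0 : forall n f, F 0%N f -> `|act f (x n)| <= e / 2 ^+ n.+1.
Hypothesis x_norming : forall n,
  norming (x n) (b n) (b n.+1) (e / 2 ^+ n.+1) (a n) (g n) (J n).

Lemma bounds_mono m n : (m <= n)%N -> (b m <= b n)%N.
Proof.
by apply: (homo_leq (f := b) (r := leq)) => // ? ? ?; exact: leq_trans.
Qed.

Lemma coef_le_norm2 D (c : nat -> R) n : (n < D)%N ->
  `|c n| <= Num.sqrt (\sum_(m < D) c m ^+ 2).
Proof.
move=> nD; rewrite -sqrtr_sqr ler_wsqrtr // (bigD1 (Ordinal nD)) //= lerDl.
by apply: sumr_ge0 => i _; exact: sqr_ge0.
Qed.

Lemma sum_errors D (c : nat -> R) (r : nat -> R) :
  (forall n, (n < D)%N -> `|r n| <= e / 2 ^+ n.+1) ->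
  `|\sum_(n < D) c n * r n| <= e * Num.sqrt (\sum_(m < D) c m ^+ 2).
Proof.
move=> re; apply: le_trans (ler_norm_sum _ _ _) _.
set C := Num.sqrt _.
apply: (@le_trans _ _ (\sum_(n < D) C * (e / 2 ^+ n.+1))).
  apply: ler_sum => n _; rewrite normrM; apply: ler_pM => //.
    exact: coef_le_norm2.
  exact: re.
rewrite -mulr_sumr mulrC ler_wpM2r ?sqrtr_ge0 //; apply: half_pow_sum; exact: ltW.
Qed.

(** A least index lies in one window only, so each coefficient of a combination in [F2] enters at
    most one [A n], and Bessel's inequality bounds [A n] by the l2 norm of the coefficients entering
    it. The rest is error. *)
Lemma upper_ell2 D (c : nat -> R) :
  N (\sum_(n < D) c n *: x n) <= (1 + e) * Num.sqrt (\sum_(n < D) c n ^+ 2).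
Proof.
set C2 := \sum_(n < D) c n ^+ 2.
have C20 : 0 <= C2 by apply: sumr_ge0 => n _; exact: sqr_ge0.
apply: (N_le X_JT) => f f2; rewrite linear_sum mulrDl mul1r.
under eq_bigr do rewrite linearZ /=.
have [F0f|[d [al [h [K [ah dis a1 fE]]]]]] := F2_combination f2.
  apply: le_trans (ler_norm _) _.
  apply: le_trans (sum_errors c (r := fun n => act f (x n)) _) _.
    by move=> n _; exact: x_F0.
  by rewrite lerDr sqrtr_ge0.
pose W n k := `[< in_window (b n) (b n.+1) (K k) >].
pose A n := \sum_(k | W n k) al k * act (h k) (x n).
have fx n : act f (x n) = A n + (act f (x n) - A n) by rewrite addrC subrK.
under eq_bigr do rewrite fx mulrDr.
rewrite big_split /=; apply: lerD; last first.
  apply: le_trans (ler_norm _) _.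
  apply: (sum_errors c (r := fun n => act f (x n) - A n)) => n _.
  have -> : act f (x n) - A n = \sum_(k | ~~ W n k) al k * act (h k) (x n).
    apply/eqP; rewrite subr_eq addrC fE act_suml (bigID (W n)) /=; apply/eqP.
    by congr (_ + _); apply: eq_bigr => k _; rewrite actZl.
  apply: le_trans (ler_norm_sum _ _ _) _.
  have sp := @x_sep n _ xpredT h K (fun k _ => ah k) (fun k l _ _ => dis k l).
  apply: le_trans sp.
  apply: ler_sum => k _; rewrite normrM ler_piMl //.
  exact: (coef_le1 _ a1).
have A2 n : A n ^+ 2 <= \sum_(k | W n k) al k ^+ 2.
  apply: le_trans (cauchy_schwarz_sum _ _ _ _) _.
  rewrite ler_piMr //; first by apply: sumr_ge0 => k _; exact: sqr_ge0.
  have := atoms_bessel X_JT (x n) (P := W n) (fun k _ => ah k) (fun k l _ _ => dis k l).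
  by rewrite x_norm expr1n.
have sA : \sum_(n < D) A n ^+ 2 <= 1.
  apply: (@le_trans _ _ (\sum_(n < D) \sum_(k | W n k) al k ^+ 2)); first exact: ler_sum.
  under eq_bigr do rewrite big_mkcond; rewrite exchange_big /=.
  apply: le_trans a1; apply: ler_sum => k _.
  case: (pselect (exists n : 'I_D, W n k)) => [[n Wn]|no]; last first.
    rewrite big1 ?sqr_ge0 // => n _; case: ifP => // Wn.
    by case: no; exists n.
  rewrite (bigD1 n) //= Wn big1 ?addr0 // => m mn; case: ifP => // Wm.
  move: Wn Wm => /asboolP[n1 n2] /asboolP[m1 m2].
  have lt (i j : nat) : (i < j)%N -> ~ meets_below (K k) (b j) -> ~ meets_below (K k) (b i.+1).
    by move=> ij nj [l Kl lb]; apply: nj; exists l => //; exact: leq_trans (bounds_mono ij).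
  by case: (ltngtP m n) => [mn'|nm|/val_inj mn']; [case: (lt _ _ mn' n1)|case: (lt _ _ nm m1)|rewrite mn' eqxx in mn].
apply: le_trans (ler_norm _) _; rewrite -sqrtr_sqr; apply: ler_wsqrtr.
apply: le_trans (cauchy_schwarz_sum _ _ _ _) _.
by rewrite ler_piMr.
Qed.

(** The norming functionals of all the vectors are tested together, with coefficients [c n * a n k];
    different windows make their index sets disjoint. The diagonal loses 2e, the interaction of
    different vectors e. *)
Lemma lower_ell2 D (c : nat -> R) :
  (1 - 3 * e) * Num.sqrt (\sum_(n < D) c n ^+ 2) <= N (\sum_(n < D) c n *: x n).
Proof.
set C2 := \sum_(n < D) c n ^+ 2; set C := Num.sqrt C2; set Z := \sum_(n < D) _.
have C20 : 0 <= C2 by apply: sumr_ge0 => n _; exact: sqr_ge0.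
have CC : C ^+ 2 = C2 by rewrite sqr_sqrtr.
have [C0|Cn0] := eqVneq C 0; first by rewrite C0 mulr0 normr_ge0.
have C0 : 0 < C by rewrite lt_neqAle eq_sym Cn0 sqrtr_ge0.
have en n : 0 <= e / 2 ^+ n.+1 by rewrite divr_ge0 ?exprn_ge0 // ltW.
have ene n : e / 2 ^+ n.+1 <= e.
  by rewrite ler_piMr ?(ltW e_gt0) // invf_le1 ?exprn_gt0 // exprn_ege1 // ler1n.
have /choice[d Hd] : forall n, exists d, forall M, (d <= M)%N ->
    1 - 2 * (e / 2 ^+ n.+1) <= \sum_(k < M) a n k * act (g n k) (x n).
  by move=> n; case: (x_norming n).
pose M := (\sum_(n < D) d n)%N.
have dM n : (n < D)%N -> (d n <= M)%N.
  by move=> nD; rewrite /M (bigD1 (Ordinal nD)) //= leq_addr.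
pose I := ('I_D * 'I_M)%type.
pose gI (p : I) := g p.1 p.2; pose JI (p : I) := J p.1 p.2.
pose cI (p : I) := c p.1 * a p.1 p.2.
have aI (p : I) : xpredT p -> atom (gI p) (JI p).
  by move=> _; exact: (n_atom (x_norming p.1) p.2).
have nomeet n m k : (n < m)%N -> forall j, J n k j -> (j < b m)%N.
  move=> nm j /(n_window (x_norming n))/andP[_ jn].
  exact: leq_trans (bounds_mono nm).
have dI (p p' : I) : xpredT p -> xpredT p' -> JI p `&` JI p' !=set0 -> p = p'.
  case: p => n k; case: p' => n' k' _ _ [j [/= Jj Jj']]; rewrite /JI /= in Jj Jj'.
  have nn : n = n'.
    apply: val_inj => /=; case: (ltngtP n n') => // lt.
      have /andP[jn' _] := n_window (x_norming n') Jj'.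
      by have := nomeet _ _ _ lt _ Jj; rewrite ltnNge jn'.
    have /andP[jn _] := n_window (x_norming n) Jj.
    by have := nomeet _ _ _ lt _ Jj'; rewrite ltnNge jn.
  subst n'; congr pair; apply: val_inj; apply: (n_disj (x_norming n)).
  by exists j.
have cIC : \sum_p cI p ^+ 2 <= C2.
  rewrite -(pair_bigA _ (fun n k => cI (n, k) ^+ 2)) /=.
  apply: ler_sum => n _; rewrite /cI /=; under eq_bigr do rewrite exprMn.
  rewrite -mulr_sumr ler_piMr ?sqr_ge0 //.
  exact: (n_coef (x_norming n)).
(* The coefficients are real, so S is estimated by Cauchy-Schwarz and Bessel instead of an element
   of [F2]. *)
pose S := \sum_p cI p * act (gI p) Z.
have S_le : S <= C * N Z.
  apply: le_trans (ler_norm _) _; rewrite -(@ler_pXn2r _ 2) ?nnegrE ?mulr_ge0 ?(ltW C0) //.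
  rewrite real_normK ?num_real // exprMn CC; apply: le_trans (cauchy_schwarz_sum _ _ _ _) _.
  apply: ler_pM => //; first by apply: sumr_ge0 => p _; exact: sqr_ge0.
    by apply: sumr_ge0 => p _; exact: sqr_ge0.
  exact: (atoms_bessel X_JT Z aI dI).
pose Q m := \sum_(k < M) a m k * act (g m k) (x m).
pose E m := \sum_(p : I | (p.1 : nat) != m) cI p * act (gI p) (x m).
have SE : S = \sum_(m < D) c m * (c m * Q m + E m).
  transitivity (\sum_p \sum_(m < D) c m * (cI p * act (gI p) (x m))).
    apply: eq_bigr => p _; rewrite /Z linear_sum mulr_sumr; apply: eq_bigr => m _.
    by rewrite linearZ /= mulrCA.
  rewrite exchange_big /=; apply: eq_bigr => m _; rewrite -mulr_sumr; congr (_ * _).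
  rewrite (bigID (fun p : I => (p.1 : nat) == m)) /=; congr (_ + _).
  rewrite big_mkcond -(pair_bigA _ (fun (n : 'I_D) (k : 'I_M) => if (n : nat) == m
    then cI (n, k) * act (gI (n, k)) (x m) else 0)) /= (bigD1 m) //=.
  rewrite [X in _ + X]big1 ?addr0.
    rewrite /Q mulr_sumr; apply: eq_bigr => k _.
    by rewrite eqxx /cI /gI /= mulrA.
  move=> n nm; rewrite big1 // => k _; case: eqP => // /val_inj nm'.
  by rewrite nm' eqxx in nm.
(* The functionals of the other vectors do not have their least index in the m-th window, so
   [quasi_separated] applies. *)
have E_le m : (m < D)%N -> `|E m| <= C * (e / 2 ^+ m.+1).
  move=> mD; apply: le_trans (ler_norm_sum _ _ _) _.
  apply: (@le_trans _ _ (C * \sum_(p : I | (p.1 : nat) != m) `|act (gI p) (x m)|)).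
    rewrite mulr_sumr; apply: ler_sum => p _; rewrite normrM ler_wpM2r //.
    rewrite /cI normrM -[leRHS]mulr1; apply: ler_pM => //.
      exact: coef_le_norm2.
    exact: (@coef_le1 _ 'I_M (fun k => a p.1 k) p.2 (n_coef (x_norming p.1) M)).
  rewrite ler_pM2l //; apply: le_trans (@x_sep m _ xpredT gI JI aI dI).
  rewrite [leRHS]big_mkcond [leLHS]big_mkcond; apply: ler_sum => p _.
  case: ifP => [pm|_]; last by case: ifP.
  rewrite ifT //=; apply/asboolPn => -[w1 [j Jj jm]].
  case: (ltngtP p.1 m) pm => // lt _; last first.
    have /andP[jp _] := n_window (x_norming p.1) Jj.
    by have := leq_trans jm (bounds_mono lt); rewrite ltnNge jp.
  by apply: w1; exists j => //; exact: nomeet Jj.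
have QE (m : 'I_D) : c m ^+ 2 * (1 - 2 * e) <= c m * (c m * Q m).
  rewrite mulrA -expr2 ler_wpM2l ?sqr_ge0 //.
  apply: le_trans (Hd m M (dM m (ltn_ord m))).
  by rewrite lerD2l lerN2 ler_pM2l.
have S_ge : C ^+ 2 * (1 - 2 * e) - C * (e * C) <= S.
  rewrite SE; under eq_bigr do rewrite mulrDr; rewrite big_split /=; apply: lerD.
    by rewrite CC mulr_suml; apply: ler_sum.
  rewrite lerNl; apply: le_trans (ler_norm _) _; rewrite normrN.
  have -> : \sum_(i < D) c i * E i = C * \sum_(i < D) c i * (E i / C).
    by rewrite mulr_sumr; apply: eq_bigr => i _; rewrite mulrCA [C * _]mulrC divfK.
  rewrite normrM (gtr0_norm C0) ler_pM2l //; apply: (sum_errors c (r := fun n => E n / C)) => n nD.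
  rewrite normrM normfV (gtr0_norm C0) ler_pdivrMr // mulrC.
  exact: E_le.
rewrite -(ler_pM2l C0); apply: le_trans S_le; apply: le_trans S_ge.
rewrite le_eqVlt; apply/orP; left; apply/eqP; ring.
Qed.

End Estimates.

(** Passing from [x n] to [y n] costs a further e in both estimates. *)
Lemma almost_ell2_sequence (Y : set X) (e : R) :
  inf_dim_closed_subspace Y -> 0 < e -> e < 1 ->
  exists y : nat -> X, (forall n, Y (y n)) /\ forall D (c : nat -> R),
    (1 - 4 * e) * Num.sqrt (\sum_(n < D) c n ^+ 2) <= `|\sum_(n < D) c n *: y n| <=
    (1 + 2 * e) * Num.sqrt (\sum_(n < D) c n ^+ 2).
Proof.
move=> Y_sub e0 e1; have [x [y [b [a [g [J H]]]]]] := ell2_sequence Y_sub e0 e1.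
exists y; split=> [n|D c]; first by case: (H n) => -[].
have xn n : N (x n) = 1 by case: (H n) => -[].
have bi n : (b n <= b n.+1)%N by case: (H n) => _ [].
have xs n : quasi_separated (x n) (b n) (b n.+1) (e / 2 ^+ n.+1) by case: (H n).
have x0 n f : F 0%N f -> `|act f (x n)| <= e / 2 ^+ n.+1 by case: (H n) => _ _ _ + _; exact.
have xno n : norming (x n) (b n) (b n.+1) (e / 2 ^+ n.+1) (a n) (g n) (J n) by case: (H n).
have up := upper_ell2 e0 xn bi xs x0 D c.
have low := lower_ell2 e0 bi xs xno D c.
set C := Num.sqrt _ in up low *.
have near : `|iota (\sum_(n < D) c n *: x n) - \sum_(n < D) c n *: y n| <= e * C.
  rewrite linear_sum -sumrB; apply: le_trans (ler_norm_sum _ _ _) _.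
  under eq_bigr do rewrite linearZ -scalerBr normrZ.
  have := @sum_errors e e0 D (fun n => `|c n|) (fun n => `|iota (x n) - y n|).
  have -> : \sum_(m < D) `|c m| ^+ 2 = \sum_(m < D) c m ^+ 2.
    by apply: eq_bigr => m _; rewrite real_normK ?num_real.
  move=> /(_ _)/(le_trans (ler_norm _)); apply => n _.
  by rewrite normr_id; case: (H n) => _ [].
have t1 := ler_normB (iota (\sum_(n < D) c n *: x n))
  (iota (\sum_(n < D) c n *: x n) - \sum_(n < D) c n *: y n).
rewrite subKr in t1.
have t2 := lerB_normD (iota (\sum_(n < D) c n *: x n)) (\sum_(n < D) c n *: y n).
have t3 := ler_normD (iota (\sum_(n < D) c n *: x n) - \sum_(n < D) c n *: y n)
  (\sum_(n < D) c n *: y n).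
rewrite subrK in t3; clear t2.
move: up low near t1 t3; set n1 := `|iota _|; set n2 := `|iota _ - _|; set n3 := `|_|.
clearbody n1 n2 n3 C => *; apply/andP; split; lra.
Qed.
End Ell2Sequence.

(** * The sequence space l2 *)

Section Ell2Space.
Variable R : realType.

Lemma Lnorm2_counting (f : nat -> R) :
  ('N[@counting nat R]_2%:E[EFin \o f] `^ 2 = \sum_(k <oo) (f k ^+ 2)%:E)%E.
Proof.
rewrite poweR_Lnorm // ge0_integral_count; last by move=> k; rewrite poweR_ge0.
apply: congr_lim; apply/funext => n; apply: eq_bigr => k _.
by rewrite /= powR_mulrn // real_normK ?num_real.
Qed.

Lemma ell2_partial (x : ell2 R) n : \sum_(k < n) x k ^+ 2 <= `|x| ^+ 2.
Proof.
have := Lnorm2_counting x; rewrite -finite_norm_fine /= powR_mulrn; last first.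
  by rewrite fine_ge0 // Lnorm_ge0.
move=> H; rewrite -lee_fin [leRHS]H -(big_mkord xpredT (fun k => x k ^+ 2)) -sumEFin.
by apply: nneseries_lim_ge => k _ _; rewrite lee_fin sqr_ge0.
Qed.

Lemma ell2_of_bounded (f : nat -> R) (M : R) : 0 <= M ->
  (forall n, \sum_(k < n) f k ^+ 2 <= M ^+ 2) ->
  exists x : ell2 R, (forall n, x n = f n) /\ `|x| <= M.
Proof.
move=> M0 fM.
have S_le : (\sum_(k <oo) (f k ^+ 2)%:E <= (M ^+ 2)%:E)%E.
  apply: lime_le; first by apply: is_cvg_nneseries => k _ _; rewrite lee_fin sqr_ge0.
  by apply: nearW => n; rewrite sumEFin lee_fin big_mkord.
have fL : f \in Lfun (@counting nat R) 2%:E.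
  rewrite inE; apply/andP; split; first by rewrite inE.
  rewrite inE /= /finite_norm ltNge; apply/negP => Ny.
  have Ny' : ('N[@counting nat R]_2%:E[EFin \o f] = +oo)%E by apply/eqP; rewrite -leye_eq.
  by have := Lnorm2_counting f; rewrite Ny' => H; move: S_le; rewrite -H poweRyr // leye_eq.
exists (Lfun_Sub (lee1n 2) fL); split => //.
rewrite -(@ler_pXn2r _ 2) ?nnegrE // -lee_fin; apply: le_trans S_le.
rewrite -Lnorm2_counting -(finite_norm_fine (Lfun_Sub (lee1n 2) fL)) /= powR_mulrn //.
by rewrite fine_ge0 // Lnorm_ge0.
Qed.

Lemma ell2_ext (x z : ell2 R) : (forall n, x n = z n) -> x = z.
Proof. by move=> xz; apply/LfuneqP. Qed.

Lemma ell2_coord (x : ell2 R) n : `|x n| <= `|x|.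
Proof.
rewrite -(@ler_pXn2r _ 2) ?nnegrE // real_normK ?num_real //.
apply: le_trans (ell2_partial x n.+1); rewrite big_ord_recr /= lerDr.
by apply: sumr_ge0 => k _; exact: sqr_ge0.
Qed.

End Ell2Space.

(** * Synthesis operators *)

Lemma lspan_seq (R : realType) (V : lmodType R) (s : seq V) x :
  lspan [set` s] x -> exists c : 'I_(size s) -> R, x = \sum_i c i *: s`_i.
Proof.
move=> [n [a [v [vs ->]]]]; elim/big_ind: _ => [|u w|i _].
- by exists (fun=> 0); rewrite big1 // => i _; rewrite scale0r.
- move=> [c ->] [c' ->]; exists (fun i => c i + c' i); rewrite -big_split.
  by apply: eq_bigr => i _; rewrite scalerDl.
- have si : (index (v i) s < size s)%N by rewrite index_mem; exact: vs.
  exists (fun k => if k == Ordinal si then a i else 0); rewrite (bigD1 (Ordinal si)) //=.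
  rewrite eqxx nth_index ?big1 ?addr0 //; last exact: vs.
  by move=> k /negbTE ->; rewrite scale0r.
Qed.

Section Synthesis.
Variables (R : realType) (X : completeNormedModType R) (y : nat -> X) (k1 k2 : R).
Hypothesis k1_gt0 : 0 < k1.
Hypothesis k2_gt0 : 0 < k2.
Hypothesis y_ell2 : forall D (c : nat -> R),
  k1 * Num.sqrt (\sum_(n < D) c n ^+ 2) <= `|\sum_(n < D) c n *: y n| <=
  k2 * Num.sqrt (\sum_(n < D) c n ^+ 2).

Definition psum (c : nat -> R) n : X := \sum_(k < n) c k *: y k.

Definition converges (c : nat -> R) (z : X) := forall e, 0 < e ->
  exists m, forall n, (m <= n)%N -> `|z - psum c n| <= e.

Lemma psumD a c c' n : psum (fun k => a * c k + c' k) n = a *: psum c n + psum c' n.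
Proof.
rewrite /psum scaler_sumr -big_split; apply: eq_bigr => k _.
by rewrite scalerDl scalerA.
Qed.

Lemma psumB c c' n : psum (fun k => c k - c' k) n = psum c n - psum c' n.
Proof. by rewrite /psum -sumrB; apply: eq_bigr => k _; rewrite scalerBl. Qed.

Lemma psum_le (x : ell2 R) n : `|psum x n| <= k2 * `|x|.
Proof.
have /andP[_ h] := y_ell2 n x; apply: le_trans h _.
rewrite ler_pM2l //.
have -> : `|x| = Num.sqrt (`|x| ^+ 2) by rewrite sqrtr_sqr ger0_norm.
by apply: ler_wsqrtr; exact: ell2_partial.
Qed.

Lemma converges_uniq c z z' : converges c z -> converges c z' -> z = z'.
Proof.
move=> cz cz'; apply/eqP; rewrite -subr_eq0 -normr_le0; apply/ler_addgt0Pr => e e0.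
have e2 : 0 < e / 2 by rewrite divr_gt0.
have [m Hm] := cz _ e2; have [m' Hm'] := cz' _ e2.
have h := Hm (maxn m m') (leq_maxl _ _); have h' := Hm' (maxn m m') (leq_maxr _ _).
have -> : z - z' = (z - psum c (maxn m m')) - (z' - psum c (maxn m m')).
  by rewrite opprB addrA subrK.
by rewrite add0r (splitr e) (le_trans (ler_normB _ _)) // lerD.
Qed.

Lemma convergesD a c c' z z' : converges c z -> converges c' z' ->
  converges (fun k => a * c k + c' k) (a *: z + z').
Proof.
move=> cz cz' e e0.
have e1 : 0 < e / (1 + `|a|) by rewrite divr_gt0 // ltr_wpDr.
have e2 : 0 < e / 2 / (1 + `|a|) by rewrite !divr_gt0 // ltr_wpDr.
have [m Hm] := cz _ e2; have [m' Hm'] := cz' _ e2.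
exists (maxn m m') => n; rewrite geq_max => /andP[mn m'n]; rewrite psumD.
have -> : a *: z + z' - (a *: psum c n + psum c' n) =
    a *: (z - psum c n) + (z' - psum c' n) by rewrite scalerBr opprD addrACA.
apply: le_trans (ler_normD _ _) _; rewrite normrZ.
apply: le_trans (lerD (ler_wpM2l (normr_ge0 a) (Hm _ mn)) (Hm' _ m'n)) _.
rewrite -[X in _ + X]mul1r -mulrDl [_ + 1]addrC mulrCA divff ?mulr1; last first.
  by rewrite gt_eqF // ltr_wpDr.
by move: e0; lra.
Qed.

Lemma converges_ell2 (x : ell2 R) : exists z, converges x z.
Proof.
pose p n := \sum_(k < n) x k ^+ 2.
have hS : has_sup (range p).
  by split; [exists (p 0%N), 0%N|exists (`|x| ^+ 2) => _ [n _ <-]; exact: ell2_partial].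
(* The upper estimate is applied to the coefficients with the first N replaced by 0. *)
have tail N n : (N <= n)%N -> `|psum x n - psum x N| <= k2 * Num.sqrt (p n - p N).
  move=> Nn; pose c k := if (N <= k)%N then x k else 0.
  have split_sum (V : zmodType) (G : nat -> V) :
      \sum_(k < n) G k = \sum_(k < N) G k + \sum_(N <= k < n) G k.
    by rewrite -!(big_mkord xpredT G) (@big_cat_nat _ _ _ N).
  have cut (V : zmodType) (G H : nat -> V) : (forall k, (k < N)%N -> G k = 0) ->
      (forall k, (N <= k)%N -> G k = H k) ->
      \sum_(k < n) G k = \sum_(k < n) H k - \sum_(k < N) H k.
    move=> G0 GH; rewrite !split_sum addrAC subrr add0r big1 ?add0r; last first.
      by move=> k _; exact: G0.
    by apply: eq_big_nat => k /andP[Nk _]; exact: GH.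
  have cy : \sum_(k < n) c k *: y k = psum x n - psum x N.
    apply: (cut X (fun k => c k *: y k) (fun k => x k *: y k)) => k kN.
      by rewrite /c leqNgt kN scale0r.
    by rewrite /c kN.
  have cx : \sum_(k < n) c k ^+ 2 = p n - p N.
    apply: (cut R (fun k => c k ^+ 2) (fun k => x k ^+ 2)) => k kN.
      by rewrite /c leqNgt kN expr0n.
    by rewrite /c kN.
  by have /andP[_] := y_ell2 n c; rewrite cy cx.
have cv : cvg (psum x @ \oo).
  apply/cauchy_cvgP; apply: cauchy_exP => e e0.
  have d0 : 0 < (e / k2) ^+ 2 / 2 by rewrite divr_gt0 // exprn_gt0 // divr_gt0.
  have [_ [N _ <-] HN] := sup_adherent d0 hS.
  exists (psum x N); exists N => // n /= Nn; rewrite -ball_normE /= distrC.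
  apply: le_lt_trans (tail _ _ Nn) _; rewrite mulrC -ltr_pdivlMr //.
  have ek : 0 <= e / k2 by rewrite divr_ge0 // ltW.
  rewrite -[ltRHS](ger0_norm ek) -sqrtr_sqr ltr_sqrt ?exprn_gt0 ?divr_gt0 //.
  have pn : p n <= sup (range p) by apply: ub_le_sup; [exact: hS.2|exists n].
  have d1 : 0 < (e / k2) ^+ 2 by rewrite exprn_gt0 // divr_gt0.
  by move: HN pn d1; set u := sup _; set v := (e / k2) ^+ 2; clearbody u v; lra.
exists (lim (psum x @ \oo)) => e e0.
have /cvgrPdist_le/(_ e e0)[N _ HN] := cv.
by exists N => n Nn; exact: HN.
Qed.

Lemma synthesis : exists T : {linear ell2 R -> X}, forall x : ell2 R, converges x (T x).
Proof.
have [T HT] := choice converges_ell2.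
have lin : linear T.
  move=> a u v; apply: converges_uniq (HT _) _.
  exact: (convergesD a (HT u) (HT v)).
pose Tlin := GRing.isLinear.Build R (ell2 R) X *:%R T lin.
pose T' : {linear ell2 R -> X} := HB.pack T Tlin.
by exists T'.
Qed.

End Synthesis.

Section Range.
Variables (R : realType) (X : completeNormedModType R) (y : nat -> X) (k1 k2 : R).
Hypothesis k1_gt0 : 0 < k1.
Hypothesis k2_gt0 : 0 < k2.
Hypothesis y_ell2 : forall D (c : nat -> R),
  k1 * Num.sqrt (\sum_(n < D) c n ^+ 2) <= `|\sum_(n < D) c n *: y n| <=
  k2 * Num.sqrt (\sum_(n < D) c n ^+ 2).
Variable T : {linear ell2 R -> X}.
Hypothesis T_conv : forall x : ell2 R, converges y x (T x).

Lemma synthesis_upper x : `|T x| <= k2 * `|x|.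
Proof.
apply/ler_addgt0Pr => e e0; have [m Hm] := T_conv x e0.
rewrite -[T x](subrK (psum y x m)) addrC; apply: le_trans (ler_normD _ _) _.
by apply: lerD; [exact: (psum_le k2_gt0 y_ell2)|exact: Hm].
Qed.

Lemma synthesis_lower x : k1 * `|x| <= `|T x|.
Proof.
rewrite mulrC -ler_pdivlMr //.
have M0 : 0 <= `|T x| / k1 by rewrite divr_ge0 // ltW.
have pM n : \sum_(k < n) x k ^+ 2 <= (`|T x| / k1) ^+ 2.
  have p0 m : 0 <= \sum_(k < m) x k ^+ 2 by apply: sumr_ge0 => k _; exact: sqr_ge0.
  rewrite -[leLHS]sqr_sqrtr // lerXn2r ?nnegrE ?sqrtr_ge0 // ler_pdivlMr // mulrC.
  apply/ler_addgt0Pr => e e0; have [m Hm] := T_conv x e0.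
  pose N := maxn n m; have /andP[h _] := y_ell2 N x.
  apply: (@le_trans _ _ (k1 * Num.sqrt (\sum_(k < N) x k ^+ 2))).
    have nN : (n <= N)%N := leq_maxl n m.
    rewrite ler_pM2l // ler_wsqrtr // -(subnKC nN) big_split_ord /= lerDl.
    by apply: sumr_ge0 => k _; exact: sqr_ge0.
  apply: le_trans h _; rewrite -/(psum y x N).
  rewrite -[psum y x N](subKr (T x)); apply: le_trans (ler_normB _ _) _.
  by rewrite lerD2l; apply: Hm; exact: leq_maxr.
(* Applied to the coordinates of x itself, this turns the bound on partial sums into a bound on the
   norm. *)
have [z [zx zM]] := ell2_of_bounded M0 pM.
by move: zM; rewrite (ell2_ext zx).
Qed.

(** The preimage of a limit z is built coordinatewise: by the lower estimate the n-th coordinates of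
    all x with [T x] near z nearly agree, so they have a common centre [r n]. *)
Lemma synthesis_range_closed : closed (range T).
Proof.
move=> z cz.
have near (d : R) : 0 < d -> exists x, `|T x - z| < d.
  move=> d0; have [_ [[x _ <-]]] := cz _ (nbhsx_ballx z d d0).
  by rewrite -ball_normE /= distrC => ?; exists x.
have T_dist (x x' : ell2 R) : `|x - x'| <= `|T x - z| / k1 + `|T x' - z| / k1.
  rewrite -mulrDl ler_pdivlMr // mulrC; apply: le_trans (synthesis_lower _) _.
  rewrite linearB /=; have -> : T x - T x' = (T x - z) - (T x' - z) by rewrite opprB addrA subrK.
  exact: ler_normB.
have /choice[r Hr] n : exists r : R, forall x : ell2 R, `|x n - r| <= `|T x - z| / k1.
  apply: (@common_center R (ell2 R) 0) => x x'.
  exact: le_trans (ell2_coord (x - x') n) (T_dist x x').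
pose L := k2 / k1.
have L0 : 0 <= L by rewrite divr_ge0 // ltW.
(* The comparison passes through an x' whose image is so close to z, depending on N, that its first
   N coordinates are almost those of r. *)
have psum_near N (x : ell2 R) : `|psum y r N - psum y x N| <= L * `|T x - z|.
  pose S := L + \sum_(n < N) `|y n| / k1 + 1.
  have S0 : 0 <= \sum_(n < N) `|y n| / k1 by apply: sumr_ge0 => n _; rewrite divr_ge0 // ltW.
  have S1 : 0 < S by rewrite /S ltr_wpDl // addr_ge0.
  apply/ler_addgt0Pr => e e0.
  have [x' Hx'] := near _ (divr_gt0 e0 S1).
  have -> : psum y r N - psum y x N = (psum y r N - psum y x' N) + psum y (x' - x) N.
    have -> : psum y (x' - x) N = psum y x' N - psum y x N by rewrite -psumB.
    by rewrite addrA subrK.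
  apply: le_trans (ler_normD _ _) _.
  have h1 : `|psum y r N - psum y x' N| <= (\sum_(n < N) `|y n| / k1) * `|T x' - z|.
    rewrite -psumB; apply: le_trans (ler_norm_sum _ _ _) _; rewrite mulr_suml.
    apply: ler_sum => n _; rewrite normrZ distrC mulrC -mulrA ler_wpM2l //.
    by rewrite mulrC; exact: Hr.
  have h2 : `|psum y (x' - x) N| <= L * `|T x' - z| + L * `|T x - z|.
    apply: le_trans (psum_le k2_gt0 y_ell2 (x' - x) N) _.
    apply: le_trans (ler_wpM2l (ltW k2_gt0) (T_dist x' x)) _.
    by rewrite mulrDr /L -!mulrA ![k1^-1 * _]mulrC.
  apply: le_trans (lerD h1 h2) _; rewrite addrCA addrA addrC lerD2l -mulrDl.
  apply: (@le_trans _ _ (S * `|T x' - z|)).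
    by rewrite ler_wpM2r // /S addrC lerDl.
  by rewrite mulrC -ler_pdivlMr // ltW.
have [x0 Hx0] := near 1 ltr01.
pose M := (L + k2 * `|x0|) / k1.
have M0 : 0 <= M by rewrite divr_ge0 ?(ltW k1_gt0) // addr_ge0 // mulr_ge0 // ltW.
have rM n : \sum_(k < n) r k ^+ 2 <= M ^+ 2.
  have p0 : 0 <= \sum_(k < n) r k ^+ 2 by apply: sumr_ge0 => k _; exact: sqr_ge0.
  rewrite -[leLHS]sqr_sqrtr // lerXn2r ?nnegrE ?sqrtr_ge0 // ler_pdivlMr // mulrC.
  have /andP[h _] := y_ell2 n r; apply: le_trans h _; rewrite -/(psum y r n).
  rewrite -[psum y r n](subrK (psum y x0 n)); apply: le_trans (ler_normD _ _) _.
  apply: lerD; last exact: (psum_le k2_gt0 y_ell2).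
  by apply: le_trans (psum_near n x0) _; rewrite ler_piMr // ltW.
have [p [pr _]] := ell2_of_bounded M0 rM.
exists p => //; apply: (converges_uniq (T_conv p)) => e e0.
have psum_pr n : psum y p n = psum y r n by apply: eq_bigr => k _; rewrite pr.
have L2 : 0 < L + 2 by rewrite ltr_wpDl.
have d0 := divr_gt0 e0 L2; have [x Hx] := near _ d0; have [m Hm] := T_conv x d0.
exists m => n mn; rewrite psum_pr.
have -> : z - psum y r n = - (T x - z) + (T x - psum y x n) - (psum y r n - psum y x n).
  by rewrite opprB opprB -[z - T x + _]addrA !addrA subrK subrK.
apply: le_trans (ler_normB _ _) _; apply: le_trans (lerD (ler_normD _ _) (lexx _)) _.
rewrite normrN.
have h := le_trans (psum_near n x) (ler_wpM2l L0 (ltW Hx)).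
apply: le_trans (lerD (lerD (ltW Hx) (Hm n mn)) h) _.
have we : e / (L + 2) * (L + 2) = e by rewrite divfK // gt_eqF.
rewrite -[leRHS]we le_eqVlt; apply/orP; left; apply/eqP; ring.
Qed.

Lemma synthesis_inj : injective T.
Proof.
move=> x x' e; apply/eqP; rewrite -subr_eq0 -normr_le0 -(pmulr_rle0 _ k1_gt0).
by apply: le_trans (synthesis_lower _) _; rewrite linearB /= e subrr normr0.
Qed.

Lemma synthesis_basis n : range T (y n).
Proof.
pose f k : R := (k == n)%:R.
have fM m : \sum_(k < m) f k ^+ 2 <= 1 ^+ 2.
  rewrite expr1n; have [nm|mn] := ltnP n m.
    rewrite (bigD1 (Ordinal nm)) //= /f eqxx expr1n big1 ?addr0 // => k.
    by rewrite -val_eqE /= => /negbTE ->; rewrite expr0n.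
  rewrite big1 // => k _; rewrite /f ltn_eqF ?expr0n //.
  exact: leq_trans mn.
have [x [xf _]] := ell2_of_bounded ler01 fM.
exists x => //; apply: (converges_uniq (T_conv x)) => e e0; exists n.+1 => m nm.
rewrite /psum (bigD1 (Ordinal nm)) //= xf /f eqxx scale1r big1 ?addr0 ?subrr ?normr0 ?ltW //.
by move=> k; rewrite -val_eqE /= xf /f => /negbTE ->; rewrite scale0r.
Qed.

Lemma synthesis_range_sub (Y : set X) : closed Y -> submod_closed [in Y] ->
  (forall n, Y (y n)) -> range T `<=` Y.
Proof.
move=> cY [Y0 Ylin] Yy _ [x _ <-]; apply: cY => B /nbhs_ballP[e /= e0 eB].
have e2 : 0 < e / 2 by rewrite divr_gt0.
have [m Hm] := T_conv x e2; exists (psum y x m); split; last first.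
  apply: eB; rewrite -ball_normE /=; apply: le_lt_trans (Hm m (leqnn m)) _.
  by rewrite ltr_pdivrMr // ltr_pMr // ltr1n.
rewrite /psum; elim/big_rec: _ => [|k v _ Yv]; first by move: Y0; rewrite inE.
by have := Ylin (x k) (y k) v; rewrite !inE; apply.
Qed.

Lemma synthesis_range_subspace : inf_dim_closed_subspace (range T).
Proof.
split; first exact: synthesis_range_closed.
  split; first by rewrite inE; exists 0; rewrite ?linear0.
  move=> a u v; rewrite !inE => -[x _ <-] [x' _ <-]; exists (a *: x + x') => //.
  by rewrite linearP.
(* If finitely many vectors spanned the range, one more of the [y i] would satisfy a nontrivial
   relation, against the lower estimate. *)
move=> [B /finite_seqP[s sB] TB].
have /choice[A HA] (i : 'I_(size s).+1) : exists c : 'I_(size s) -> R, y i = \sum_j c j *: s`_j.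
  by apply: lspan_seq; rewrite -sB; apply: TB; exact: synthesis_basis.
pose M := \matrix_(i < (size s).+1, j < size s) A i j.
have [c c0 cM] := kernel_vector M (ltnSn _).
pose c' i := if insub i is Some j then c 0 j else 0.
have c'E (j : 'I_(size s).+1) : c' j = c 0 j by rewrite /c' valK.
have c'0 : \sum_(i < (size s).+1) c' i *: y i = 0.
  under eq_bigr do rewrite HA c'E scaler_sumr.
  rewrite exchange_big big1 //= => j _.
  under eq_bigr do rewrite scalerA.
  rewrite -scaler_suml; have := congr1 (fun K : 'rV_(size s) => K 0 j) cM.
  rewrite !mxE; under eq_bigr do rewrite mxE.
  by move=> ->; rewrite scale0r.
have /andP[h _] := y_ell2 (size s).+1 c'; move: h.
rewrite c'0 normr0 pmulr_rle0 // -sqrtr0 => h.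
case/eqP: c0; apply/rowP => i; rewrite mxE -c'E; apply/eqP.
have S0 : 0 <= \sum_(n < (size s).+1) c' n ^+ 2 by apply: sumr_ge0 => k _; exact: sqr_ge0.
have : c' i ^+ 2 <= 0.
  apply: (@le_trans _ _ (\sum_(n < (size s).+1) c' n ^+ 2)).
    by rewrite (bigD1 i) //= lerDl; apply: sumr_ge0 => k _; exact: sqr_ge0.
  by rewrite sqrtr0 in h; rewrite -sqrtr_eq0 eq_le h sqrtr_ge0.
by move=> h2; rewrite -sqrf_eq0 eq_le h2 sqr_ge0.
Qed.

Lemma lipschitz_continuous (V W : normedModType R) (A : set V) (f : V -> W) (k : R) :
  0 < k -> (forall u v, A u -> A v -> `|f u - f v| <= k * `|u - v|) ->
  {within A, continuous f}.
Proof.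
move=> k0 fk; apply/subspace_continuousP => u Au; apply/cvgrPdist_lt => e e0.
rewrite near_withinE; near=> v => Av.
apply: le_lt_trans (fk _ _ Au Av) _; rewrite mulrC -ltr_pdivlMr //.
near: v; apply/nbhs_ballP; exists (e / k); first by rewrite /= divr_gt0.
by move=> v; rewrite -ball_normE.
Unshelve. all: by end_near. Qed.

Lemma synthesis_isomorphic : isomorphic_onto (ell2 R) (k2 / k1) (range T).
Proof.
(* The inverse of T on its range, extended by 0. *)
pose S z : ell2 R := if pselect (range T z) is left h then sval (cid2 h) else 0.
have TS z : range T z -> T (S z) = z.
  by move=> h; rewrite /S; case: pselect => // h'; case: (cid2 h').
have ST : cancel T S by move=> x; apply: synthesis_inj; apply: TS; exists x.
have k1i : 0 < k1^-1 by rewrite invr_gt0.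
exists T, S; split => //.
- apply/continuous_subspace_setT; apply: (lipschitz_continuous k2_gt0) => u v _ _.
  by rewrite -linearB synthesis_upper.
- apply: (lipschitz_continuous k1i) => u v Tu Tv.
  rewrite mulrC ler_pdivlMr // mulrC; apply: le_trans (synthesis_lower _) _.
  by rewrite linearB /= !TS.
have T1 : (opnorm setT T <= k2%:E)%E.
  apply: ge_ereal_sup => _ [x [_ x1] <-]; rewrite lee_fin.
  by apply: le_trans (synthesis_upper _) _; rewrite ger_pMr.
have S1 : (opnorm (range T) S <= k1^-1%:E)%E.
  apply: ge_ereal_sup => _ [z [Tz z1] <-]; rewrite lee_fin -[k1^-1]mul1r ler_pdivlMr //.
  by rewrite mulrC (le_trans (synthesis_lower _)) // TS.
have T00 : (0 <= opnorm setT T)%E.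
  apply: ereal_sup_ubound; exists 0; first by split => //; rewrite normr0.
  by rewrite linear0 normr0.
have S00 : (0 <= opnorm (range T) S)%E.
  apply: ereal_sup_ubound; exists 0.
    by split; [exists 0; rewrite ?linear0|rewrite normr0].
  by rewrite -[X in S X](linear0 T) ST normr0.
by rewrite EFinM; exact: lee_pmul.
Qed.

End Range.

Theorem theoremB14 (R : realType) (F : nat -> set (c00 R))
  (Xi1 Xi2 : set nat) (sigma : seq (c00 R) -> nat)
  (X : completeNormedModType R) (iota : {linear c00 R -> X})
  (F_JTG : JTG F)
  (Xi1_pos : Xi1 `<=` [set j | (1 <= j)%N])
  (Xi2_pos : Xi2 `<=` [set j | (1 <= j)%N])
  (Xi1_inf : infinite_set Xi1) (Xi2_inf : infinite_set Xi2)
  (Xi_disj : Xi1 `&` Xi2 = set0)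
  (sigma_coding : is_coding F Xi2 sigma)
  (X_JT : is_JT F Xi1 sigma iota)
  (Y : set X) (Y_sub : inf_dim_closed_subspace Y) (eps : R) (eps_gt0 : 0 < eps) :
  exists Z : set X, [/\ inf_dim_closed_subspace Z, Z `<=` Y &
    isomorphic_onto (ell2 R) (1 + eps) Z].
Proof.
(* The bound [(1 + 2 * e) / (1 - 4 * e) <= 1 + eps] amounts to [e * (6 + 4 * eps) <= eps]; the
   constant 8 leaves some slack. *)
pose e := eps / (8 + 4 * eps).
have d0 : 0 < 8 + 4 * eps by lra.
have e0 : 0 < e by rewrite divr_gt0.
have de : e * (8 + 4 * eps) = eps by rewrite divfK // gt_eqF.
have e4 : 0 < 1 - 4 * e by nra.
have e1 : e < 1 by lra.
have [y [Yy y2]] := almost_ell2_sequence F_JTG sigma_coding X_JT Y_sub e0 e1.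
have k2 : 0 < 1 + 2 * e by lra.
have [T HT] := synthesis k2 y2.
have [cY sY _] := Y_sub.
exists (range T); split.
- exact: (synthesis_range_subspace e4 k2 y2 HT).
- exact: (synthesis_range_sub HT cY sY Yy).
have [T' [S [h1 h2 h3 h4 h5]]] := synthesis_isomorphic e4 k2 y2 HT.
exists T', S; split => //; apply: le_trans h5 _.
by rewrite lee_fin ler_pdivrMr //; nra.
Qed.
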